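(* Let $d_g$ be the Riemannian distance on $M(n)$ associated with the Riemannian metric $g$, and let $d_{\overline{M}}$ be the distance on the space of weighted flags $\mathcal{W}\mathcal{F}(n)$ induced by the length $L_{\overline{M}}$. Then the metric space $(\mathcal{W}\mathcal{F}(n), d_{\overline{M}})$ is the completion of the Riemannian metric space $(M(n), d_g)$ (via the inclusion $M(n)\subset \mathcal{W}\mathcal{F}(n)$).
   Context: Fix an integer $n\ge 1$; $\mathrm{O}(n)$ is the orthogonal group, $\mathrm{Skew}(n)$ the space of real skew-symmetric $n\times n$ matrices. **Flags.** A type is a tuple $I=(p_1,\dots,p_r)$ of positive integers with $p_1+\dots+p_r=n$. $\mathrm{O}(I)\subset\mathrm{O}(n)$ is the subgroup of block-diagonal matrices $\mathrm{diag}(R_1,\dots,R_r)$, $R_i\in\mathrm{O}(p_i)$. $\mathcal{F}_I=\mathrm{O}(n)/\mathrm{O}(I)$ (quotient by right multiplication) carries the quotient topology and the unique smooth structure making the quotient map $\pi_I:\mathrm{O}(n)\to\mathcal{F}_I$ a smooth submersion. **Weighted flags.** $\Delta(n)=\{\mu\in[0,1]^n:\sum_i\mu_i=1\}$. For $\mu\in\Delta(n)$ let $k_1<\dots<k_s$ be the indices $i$ with $\mu_i>0$. The type $\tau(\mu)$ is $(k_1,k_2-k_1,\dots,k_s-k_{s-1})$ if $k_s=n$, and $(k_1,k_2-k_1,\dots,k_s-k_{s-1},n-k_s)$ if $k_s<n$. On $\Delta(n)\times\mathrm{O}(n)$ put $(\alpha,U)\sim(\beta,V)$ iff $\alpha=\beta$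 and $\pi_{\tau(\alpha)}(U)=\pi_{\tau(\alpha)}(V)$. $\mathcal{W}\mathcal{F}(n)=(\Delta(n)\times\mathrm{O}(n))/\!\sim$ has the quotient topology; its elements are written $(\mu,W)$ with $\mu\in\Delta(n)$, $W\in\mathcal{F}_{\tau(\mu)}$. **The top cell and the metric $g$.** $M(n)=\{(\mu,W)\in\mathcal{W}\mathcal{F}(n):\mu_i>0\ \forall i\}=\mathring\Delta(n)\times\mathcal{F}_{(1,\dots,1)}$, where $\mathring\Delta(n)=\{\mu\in\Delta(n):\mu_i>0\ \forall i\}$ (product smooth structure), with $T_\mu\mathring\Delta(n)=\{\alpha\in\mathbb{R}^n:\sum\alpha_i=0\}$. Fix $f:[0,1]^n\to\mathbb{R}_+$ Lipschitz continuous on $[0,1]^n$, $C^2$ on $[0,1]^n\setminus\{0\}$, with $f(\mu)=0$ iff $\mu=0$. For $i<j$, $\mu_{i\to j}\in[0,1]^n$ has $l$-th entry $\mu_l$ if $i\le l\le j-1$ and $0$ otherwise. For $(\mu,W)\in M(n)$, $W=\pi_{(1,\dots,1)}(U)$, and tangent vectors $(\alpha,X),(\beta,Y)$, let $B=(b_{ij}),C=(c_{ij})\in\mathrm{Skew}(n)$ be the unique matrices with $X=T_U\pi_{(1,\dots,1)}\cdot UB$, $Y=T_U\pi_{(1,\dots,1)}\cdot UC$; then $$g_{\mu,W}((\alpha,X),(\beta,Y))=\sum_{i=1}^n\alpha_i\beta_i+\sum_{1\le i<j\le n}f(\mu_{i\to j})^2b_{ij}c_{ij}.$$ **Length and distance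 on $\mathcal{W}\mathcal{F}(n)$.** A continuous $\gamma:[a,b]\to\mathcal{W}\mathcal{F}(n)$ is a piecewise $C^1$ path if there are $a=a_0<a_1<\dots<a_N=b$ such that for every $i$, $\gamma(]a_{i-1},a_i[)\subset M(n)$ and $\gamma|_{]a_{i-1},a_i[}$ extends to $[a_{i-1},a_i]$ as a $C^1$ path in the manifold with boundary $\Delta(n)\times\mathcal{F}_{(1,\dots,1)}$ (with its product structure). Its length is $L_{\overline{M}}(\gamma)=\int_a^b\sqrt{g_{\gamma(t)}(\dot\gamma(t),\dot\gamma(t))}\,dt$ (finitely many times $a_i$ are disregarded), and $d_{\overline{M}}(p,q)$ is the infimum of $L_{\overline{M}}(\gamma)$ over piecewise $C^1$ paths $\gamma:[0,1]\to\mathcal{W}\mathcal{F}(n)$ with $\gamma(0)=p$, $\gamma(1)=q$. *)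

(* Defs.v *)
From HB Require Import structures.
From mathcomp Require Import all_boot all_order all_algebra generic_quotient.
From mathcomp Require Import all_classical all_reals all_analysis.

Set Implicit Arguments.
Unset Strict Implicit.
Unset Printing Implicit Defensive.

Import Order.TTheory GRing.Theory Num.Theory.
Import numFieldNormedType.Exports.

Local Open Scope classical_set_scope.
Local Open Scope ring_scope.
Local Open Scope quotient_scope.

Section flags.
Variables (R : realType) (n : nat).

Definition orthogonal_group (k : nat) : set 'M[R]_k :=
  [set U | U^T *m U = 1%:M].
Arguments orthogonal_group : clear implicits.

Definition skew_matrices : set 'M[R]_n := [set B | B^T = - B].

Definition block_orthogonal (I : seq nat) : set 'M[R]_n :=
  [set U | exists (e : (\sum_(i < size I) nth 0 I i)%N = n)
                  (Q : forall i : 'I_(size I), 'M[R]_(nth 0%N I i)),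
     (forall i, orthogonal_group _ (Q i)) /\
     U = castmx (e, e) (\mxdiag_(i < size I) Q i)].

(* F_I = O(n)/O(I) is the set of left cosets U O(I) with U in O(n). *)
Definition flag_proj (I : seq nat) (U : 'M[R]_n) : set 'M[R]_n :=
  [set U *m Q | Q in block_orthogonal I].

Definition full_type : seq nat := nseq n 1%N.

Definition cube : set 'rV[R]_n := [set mu | forall i, 0 <= mu 0 i <= 1].

Definition simplex : set 'rV[R]_n := cube `&` [set mu | \sum_i mu 0 i = 1].

(* The 1-based list k_1 < ... < k_s. *)
Definition support_indices (mu : 'rV[R]_n) : seq nat :=
  [seq (nat_of_ord i).+1 | i <- enum 'I_n & 0 < mu 0 i].

Definition weight_type (mu : 'rV[R]_n) : seq nat :=
  let k := support_indices mu in
  let p := pairmap (fun k1 k2 => (k2 - k1)%N) 0%N k in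
  if last 0%N k == n then p else rcons p (n - last 0%N k)%N.

Local Notation prewf := ((simplex : Type) * (orthogonal_group n : Type))%type.

Definition wf_rel (x y : prewf) : bool :=
  `[< set_val x.1 = set_val y.1 /\
      flag_proj (weight_type (set_val x.1)) (set_val x.2) =
      flag_proj (weight_type (set_val y.1)) (set_val y.2) >].

Lemma wf_rel_refl : reflexive wf_rel.
Proof. by move=> x; apply/asboolP. Qed.

Lemma wf_rel_sym : symmetric wf_rel.
Proof. by move=> x y; apply/asboolP/asboolP => -[-> ->]. Qed.

Lemma wf_rel_trans : transitive wf_rel.
Proof.
move=> y x z /asboolP[xy xyW] /asboolP[yz yzW].
by apply/asboolP; split; [rewrite xy | rewrite xyW].
Qed.

Canonical wf_equiv := EquivRel wf_rel wf_rel_refl wf_rel_sym wf_rel_trans.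

Definition weighted_flag : Type := quotient_topology {eq_quot wf_equiv}.
HB.instance Definition _ := Topological.on weighted_flag.

Definition wf_class (x : prewf) : weighted_flag :=
  (\pi_(weighted_flag) x)%qT.

(* p = (mu, W) with mu in Delta(n) and W in F_{tau(mu)}. *)
Definition wf_coords (p : weighted_flag) (mu : 'rV[R]_n) (W : set 'M[R]_n) :=
  exists x : prewf, [/\ p = wf_class x, mu = set_val x.1 &
                        W = flag_proj (weight_type mu) (set_val x.2)].

Definition top_cell : set weighted_flag :=
  [set p | exists mu W, wf_coords p mu W /\ forall i, 0 < mu 0 i].

End flags.
Arguments cube : clear implicits.
Arguments simplex : clear implicits.
Arguments orthogonal_group : clear implicits.
Arguments top_cell : clear implicits.

Section regularity.
Variable R : realType.

Definition C1_open n (V : set 'rV[R]_n) (h : 'rV[R]_n -> R) :=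
  forall v, (forall x, V x -> derivable h x v) /\
            (forall x, V x -> {for x, continuous ('D_v h)}).

Definition C2_open n (V : set 'rV[R]_n) (h : 'rV[R]_n -> R) :=
  C1_open V h /\ forall v, C1_open V ('D_v h).

(* C^2 on a possibly non-open set: C^2 extensions exist locally. *)
Definition C2_on n (A : set 'rV[R]_n) (h : 'rV[R]_n -> R) :=
  forall x, A x -> exists (V : set 'rV[R]_n) (k : 'rV[R]_n -> R),
    [/\ open V, V x, C2_open V k & {in V `&` A, h =1 k}].

(* C^1 on a nondegenerate interval J, with one-sided derivatives at the
   endpoints that belong to J. *)
Definition C1_on (E : normedModType R) (J : set R) (u : R -> E) :=
  exists2 du : R -> E,
    forall t, J t ->
      (fun s => (s - t)^-1 *: (u s - u t)) @ within J t^' --> du t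
    & {within J, continuous du}.

End regularity.

Section paths.
Variables (R : realType) (n : nat).
Local Notation WF := (weighted_flag R n).
Local Notation full_flag := (@flag_proj R n (full_type n)).

(* O(1,...,1) is the finite group of diagonal sign matrices, so O(n) and
   F_(1,...,1) have the same dimension and the projection is a submersion
   exactly for the smooth structure in which it is a local diffeomorphism.
   The charts of F_(1,...,1) are then those of O(n) (a submanifold of 'M_n)
   composed with local inverses of the projection, and a path is C^1 iff near
   each time it is the projection of a C^1 path in O(n). *)
Definition C1_flag_path (J : set R) (W : R -> set 'M[R]_n) :=
  forall t, J t -> exists2 e : R, 0 < e & exists V : R -> 'M[R]_n,
    C1_on (J `&` ball t e) V /\
    forall s, (J `&` ball t e) s ->
      orthogonal_group R n (V s) /\ W s = full_flag (V s).

Definition C1_path (J : set R) (m : R -> 'rV[R]_n) (W : R -> set 'M[R]_n) :=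
  [/\ C1_on J m, forall t, J t -> simplex R n (m t) & C1_flag_path J W].

Definition wf_path_piece (gamma : R -> WF) (c d : R) :=
  exists m W, C1_path `[c, d] m W /\
    forall t, t \in `]c, d[ -> top_cell R n (gamma t) /\ wf_coords (gamma t) (m t) (W t).

Definition top_path_piece (gamma : R -> WF) (c d : R) :=
  exists m W, C1_path `[c, d] m W /\
    forall t, t \in `[c, d] -> top_cell R n (gamma t) /\ wf_coords (gamma t) (m t) (W t).

Definition piecewise (P : R -> R -> Prop) (a b : R) :=
  exists s : seq R, itv_partition a b s /\
    forall i, (i < size s)%N -> P (nth b (a :: s) i) (nth b (a :: s) i.+1).

Definition wf_path (gamma : R -> WF) (a b : R) :=
  {within `[a, b], continuous gamma} /\ piecewise (wf_path_piece gamma) a b.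

Definition top_path (gamma : R -> WF) (a b : R) :=
  piecewise (top_path_piece gamma) a b.

Variable f : 'rV[R]_n -> R.

(* With 0-based indices, the entries i <= l < j are kept. *)
Definition truncation (mu : 'rV[R]_n) (i j : 'I_n) : 'rV[R]_n :=
  \row_l (if (i <= l < j)%N then mu 0 l else 0).

(* A tangent vector (alpha, X) at (mu, W) with W the class of U and X the image
   of U B is given by (alpha, B); replacing U by another representative U D,
   with D a diagonal sign matrix, turns B into D B D. *)
Definition metric_g (mu : 'rV[R]_n) (v w : 'rV[R]_n * 'M[R]_n) : R :=
  \sum_(i < n) v.1 0 i * w.1 0 i +
  \sum_(i < n) \sum_(j < n | (i < j)%N) f (truncation mu i j) ^+ 2 * v.2 i j * w.2 i j.

Definition has_velocity (gamma : R -> WF) (t : R) (mu : 'rV[R]_n)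
    (alpha : 'rV[R]_n) (B : 'M[R]_n) :=
  exists (m : R -> 'rV[R]_n) (V : R -> 'M[R]_n),
    [/\ \forall s \near t, [/\ top_cell R n (gamma s), orthogonal_group R n (V s) &
                               wf_coords (gamma s) (m s) (full_flag (V s))],
        m t = mu, skew_matrices B, is_derive t (1 : R) m alpha &
        is_derive t (1 : R) V (V t *m B)].

(* Set to 0 where the path has no velocity (finitely many times for a piecewise
   C^1 path). *)
Definition speed (gamma : R -> WF) (t : R) : R :=
  xget 0 [set v | exists mu alpha B, has_velocity gamma t mu alpha B /\
                    v = Num.sqrt (metric_g mu (alpha, B) (alpha, B))].

Definition path_length (gamma : R -> WF) (a b : R) : \bar R :=
  (\int[@lebesgue_measure R]_(t in `[a, b]) (speed gamma t)%:E)%E.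

Definition wf_dist (p q : WF) : \bar R :=
  ereal_inf [set path_length gamma 0 1 | gamma in
    [set gamma | [/\ wf_path gamma 0 1, gamma 0 = p & gamma 1 = q]]].

Definition riemannian_dist (p q : WF) : \bar R :=
  ereal_inf [set path_length gamma 0 1 | gamma in
    [set gamma | [/\ top_path gamma 0 1, gamma 0 = p & gamma 1 = q]]].

End paths.

Section completion.
Variables (R : realType) (T : Type).
Local Open Scope ereal_scope.

Definition metric_on (A : set T) (d : T -> T -> \bar R) :=
  [/\ forall x y, A x -> A y -> 0 <= d x y < +oo,
      forall x y, A x -> A y -> (d x y = 0 <-> x = y),
      forall x y, A x -> A y -> d x y = d y x &
      forall x y z, A x -> A y -> A z -> d x z <= d x y + d y z].

Definition complete_dist (d : T -> T -> \bar R) :=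
  forall u : nat -> T,
    (forall e : R, (0 < e)%R -> exists N, forall i j,
        (N <= i)%N -> (N <= j)%N -> d (u i) (u j) < e%:E) ->
    exists x, forall e : R, (0 < e)%R -> exists N, forall i,
        (N <= i)%N -> d (u i) x < e%:E.

Definition dense_dist (A : set T) (d : T -> T -> \bar R) :=
  forall x (e : R), (0 < e)%R -> exists2 y, A y & d x y < e%:E.

Definition is_completion (A : set T) (dA d : T -> T -> \bar R) :=
  [/\ metric_on A dA, metric_on setT d, complete_dist d, dense_dist A d &
      forall x y, A x -> A y -> d x y = dA x y].

End completion.

(* Main.v *)
From HB Require Import structures.
From mathcomp Require Import all_boot all_order all_algebra generic_quotient.
From mathcomp Require Import all_classical all_reals all_analysis.
From mathcomp Require Import measurable_realfun ring lra zify.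
Require Import Defs.

(** Both distances turn out to be infima over the same kind of objects. A
    weighted flag is represented by a pair [(mu, U)] with [U] orthogonal
    ([rep]); two such pairs give the same point exactly when the weights agree
    and [U^T V] vanishes outside the diagonal blocks cut out by the positive
    weights ([rep_eq]). A path of weighted flags that is C^1 lifts locally to a
    C^1 arc [(m, V)] in the simplex times O(n), and its speed is the norm of
    [(m', V^T V')] for the metric, whatever the lift ([velocity_norm]). So each
    distance is the infimum of the lengths of finite chains of such arcs
    ([conn], [wf_distE], [riemannian_distE]); consecutive arcs of a chain share
    a weighted flag, not a matrix, and the interior of an arc (for the
    Riemannian distance: also its ends) has positive weights. The metric
    statements are then proved for chains.

    Different points are at positive distance ([conn_dist0]). A chain of length
    [L] changes each weight by at most [L]. For two flags with the same weight
    [mu], fix [r > 0] below the positive entries of [mu] and follow the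
    symmetric matrix [S = V diag(theta) V^T], where [theta_i] is the sum of
    [max(0, m_l - r)^2] over [l >= i]. It depends on the weighted flag only, and
    at [mu] it determines the flag, since the eigenvalues jump between
    consecutive blocks. Turning the frame with velocity [B] changes [S] by terms
    [B_ij (theta_i - theta_j)]; the gap of eigenvalues vanishes unless some [m_l]
    with [i <= l < j] exceeds [r], and there [f(m_{i->j})] is bounded below by
    compactness. So [S] is Lipschitz for the length ([conn_flag_le]).

    The two distances agree on the top cell ([conn_dist_top]) because every
    chain can be pushed into the top cell by pulling its weights towards the
    barycentre by a factor [e] ([conn_push]). As [f] is Lipschitz, the length of
    the arcs changes little. Where two arcs meet at a flag of weight [mu] with
    representatives [U] and [U Q], [Q] block-diagonal for [mu], the pulled arcs
    no longer meet; but the gap can be closed by a rotation inside the blocks of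
    [mu], which only uses directions [(i, j)] where [mu_{i->j} = 0], so that
    after the pull the factor of the metric is O(e). The ends of the chain are
    joined to their pulled images by straight segments of weights of length
    O(e), which also gives density.

    Completeness ([conn_dist_complete]) follows from compactness of the simplex
    times O(n): a Cauchy sequence has representatives clustering at some
    [(nu, V)], and close representatives are joined by short chains
    ([conn_near]).

    Rotations are realised by Cayley curves [(1 + t A) (1 - t A)^-1] with [A]
    skew. They reach [Q] if [Q + 1] is invertible, which can be arranged by
    changing signs of columns of [Q] ([sign_shift]), a change that a full flag
    does not see; and [A], being a rational function of [Q], has the same
    block-diagonal shape. *)

Set Implicit Arguments.
Unset Strict Implicit.
Unset Printing Implicit Defensive.

Import Order.TTheory GRing.Theory Num.Theory.
Import numFieldNormedType.Exports.

Local Open Scope classical_set_scope.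
Local Open Scope ring_scope.

(** * Block-diagonal matrices and walls between blocks *)

Section Blocks.
Variable R : realType.

(** [tagnat.sig1] sends an index to the number of its block, so this
    replaces the existential description by blocks with a pattern of zeros:
    the diagonal blocks of an orthogonal matrix with that pattern are
    orthogonal because the matrix [Q^T Q] is computed blockwise. *)
Lemma block_orthogonalP (I : seq nat) n (e : (\sum_(i < size I) nth 0 I i)%N = n)
    (Q : 'M[R]_n) :
  block_orthogonal I Q <->
  orthogonal_group R n Q /\
  forall s t, tagnat.sig1 (cast_ord (esym e) s) !=
              tagnat.sig1 (cast_ord (esym e) t) -> Q s t = 0.
Proof.
case: _ / e Q => Q; split.
- move=> [e [B [oB ->]]]; rewrite (eq_irrelevance e erefl) castmx_id.
  split=> [|s t]; last first.
    rewrite !cast_ord_id => /negbTE st.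
    by rewrite mxE st mxE.
  rewrite /orthogonal_group /= tr_mxdiag mul_mxdiag_mxblock -mxdiagZ.
  apply/eq_mxblock => i j; case: eqVneq => [<-|_]; last by rewrite mulmx0.
  by rewrite !conform_mx_id; exact: oB.
- move=> [oQ Q0].
  have QE : Q = \mxdiag_i submxblock Q i i.
    rewrite -{1}(submxblockK Q); apply/eq_mxblock => i j.
    case: eqVneq => [<-|ij]; first by rewrite conform_mx_id.
    apply/matrixP => a b; rewrite !mxE; apply: Q0.
    by rewrite !cast_ord_id !tagnat.Rank1K.
  exists erefl, (fun i => submxblock Q i i); split; last by rewrite castmx_id.
  move: oQ; rewrite /orthogonal_group /= {1 2}QE tr_mxdiag mul_mxdiag_mxblock.
  rewrite -mxdiagZ => QQ i.
  have := congr1 (fun A => submxblock A i i) QQ.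
  by rewrite mxblockK submxblock_diag eqxx conform_mx_id.
Qed.

(** A positive weight [mu_l] cuts between the positions [l] and [l + 1], so two
    indices lie in different blocks of the type of [mu] exactly when such an
    [l] separates them. Block-diagonal shape is expressed through this relation
    alone, which avoids the casts coming with lists of block sizes. *)
Definition wall n (mu : 'rV[R]_n) (i j : nat) : bool :=
  [exists l : 'I_n, ((i <= l < j) || (j <= l < i))%N && (0 < mu 0 l)].

Lemma wallC n (mu : 'rV[R]_n) i j : wall mu i j = wall mu j i.
Proof. by apply: eq_existsb => l; rewrite orbC. Qed.

Lemma wallxx n (mu : 'rV[R]_n) i : wall mu i i = false.
Proof. by apply/existsP => -[l]; rewrite orbb; lia. Qed.

(** The partial sums [k_1 < ... < k_s = n] of the type of [mu]. *)
(* The type is recovered as the list of successive differences starting at 0,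
   which is why the value [n] is appended when the last weight is zero. *)
Definition breakpoints n (mu : 'rV[R]_n) : seq nat :=
  let k := support_indices mu in if last 0%N k == n then k else rcons k n.

Lemma weight_typeE n (mu : 'rV[R]_n) :
  weight_type mu = pairmap (fun a b => (b - a)%N) 0%N (breakpoints mu).
Proof.
rewrite /weight_type /breakpoints; case: ifP => // _.
by rewrite -!cats1 pairmap_cat.
Qed.

Lemma support_indicesP n (mu : 'rV[R]_n) k :
  reflect (exists2 l : 'I_n, 0 < mu 0 l & k = l.+1) (k \in support_indices mu).
Proof.
apply: (iffP mapP) => [[l]|[l ml ->]].
  by rewrite mem_filter => /andP[? _] ->; exists l.
by exists l => //; rewrite mem_filter ml mem_enum.
Qed.

Lemma sorted_breakpoints n (mu : 'rV[R]_n) : (0 < n)%N ->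
  path ltn 0%N (breakpoints mu) /\ last 0%N (breakpoints mu) = n.
Proof.
move=> n0; have st : path ltn 0%N (support_indices mu).
  rewrite (path_sortedE ltn_trans); apply/andP; split.
    by apply/allP => k /support_indicesP[l _ ->].
  rewrite sorted_map; apply: sorted_filter; first by move=> a b c; exact: ltn_trans.
  have : sorted ltn (map val (enum 'I_n)) by rewrite val_enum_ord iota_ltn_sorted.
  by rewrite sorted_map.
rewrite /breakpoints; case: eqP => // /eqP lk; rewrite last_rcons; split=> //.
rewrite rcons_path st /= ltn_neqAle lk.
have : last 0%N (support_indices mu) \in 0%N :: support_indices mu.
  exact: mem_last.
by rewrite inE => /orP[/eqP->|/support_indicesP[l _ ->]] //=.
Qed.

Lemma mem_breakpoints n (mu : 'rV[R]_n) (k : nat) : (k < n)%N ->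
  reflect (exists2 l : 'I_n, 0 < mu 0 l & k = l.+1) (k \in breakpoints mu).
Proof.
move=> kn; rewrite /breakpoints; case: eqP => _; first exact: support_indicesP.
rewrite mem_rcons inE ltn_eqF //=; exact: support_indicesP.
Qed.

Lemma sum_pairmap_sub (K : seq nat) x j : path ltn x K -> (j <= size K)%N ->
  (x + \sum_(0 <= i < j) nth 0 (pairmap (fun a b => b - a) x K) i)%N =
  nth 0%N (x :: K) j.
Proof.
elim: K x j => [|y K IH] x [|j] //=; do ?by rewrite big_geq // addn0.
move=> /andP[xy pK] jK; rewrite big_nat_recl //=.
by rewrite addnA subnKC ?(ltnW xy) // IH.
Qed.

Lemma sum_weight_type n (mu : 'rV[R]_n) : (0 < n)%N ->
  (\sum_(i < size (weight_type mu)) nth 0 (weight_type mu) i)%N = n.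
Proof.
move=> n0; have [p l] := sorted_breakpoints mu n0.
rewrite -(big_mkord xpredT (fun i => nth 0 (weight_type mu) i)%N).
rewrite weight_typeE size_pairmap.
have := sum_pairmap_sub p (leqnn _); rewrite add0n => ->.
by rewrite -last_nth.
Qed.

(** The block of [u] is the one with [k_b <= u < k_(b+1)], so two indices are in
    different blocks when some [k_b] lies between them, and below [n] the
    numbers [k_b] are the [l + 1] with [mu_l] positive. *)
Lemma sig1_wall n (mu : 'rV[R]_n) (n0 : (0 < n)%N) (s t : 'I_n) :
  let e := esym (sum_weight_type mu n0) in
  (tagnat.sig1 (cast_ord e s) != tagnat.sig1 (cast_ord e t)) = wall mu s t.
Proof.
move=> e; have [p l] := sorted_breakpoints mu n0.
set K := breakpoints mu in p l.
have sK : size (weight_type mu) = size K by rewrite weight_typeE size_pairmap.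
have sumE j : (j <= size K)%N ->
    (\sum_(i < size (weight_type mu) | (i < j)%N) nth 0 (weight_type mu) i)%N
    = nth 0%N (0%N :: K) j.
  move=> jK; rewrite -(sum_pairmap_sub p jK) add0n weight_typeE.
  rewrite -weight_typeE in sK *; rewrite big_mkord.
  rewrite (big_ord_widen_cond _ xpredT (fun i => nth 0 (weight_type mu) i)%N
    (_ : (j <= size (weight_type mu))%N)) //.
  by rewrite sK.
pose sg (u : 'I_n) := tagnat.sig1 (cast_ord e u).
have sgK u : (sg u < size K)%N by rewrite -sK.
have lo (u : 'I_n) : (nth 0%N (0%N :: K) (sg u) <= u)%N.
  have /= := tagnat.rect (cast_ord e u).
  rewrite -/(sg u) => ->; rewrite sumE ?leq_addr // ltnW //.
have hi (u : 'I_n) : (u < nth 0%N (0%N :: K) (sg u).+1)%N.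
  rewrite -sumE //; have /= := tagnat.rect (cast_ord e u); rewrite -/(sg u) => ->.
  rewrite [ltnRHS](bigID (fun i : 'I__ => (i < sg u)%N)) /=.
  have -> : (\sum_(i < size (weight_type mu) | (i < (sg u).+1) && (i < sg u))
      nth 0 (weight_type mu) i =
      \sum_(i < size (weight_type mu) | i < sg u) nth 0 (weight_type mu) i)%N.
    apply: eq_bigl => i; rewrite ltnS.
    by case: (ltnP i (sg u)) => [/ltnW->|]; rewrite ?andbF.
  rewrite ltn_add2l; apply: leq_trans (ltn_ord _) _; rewrite -/(sg u).
  by rewrite (bigD1 (sg u)) /= ?ltnn ?ltnSn ?leq_addr.
have nthmono i j : (i < j)%N -> (j <= size K)%N ->
    (nth 0%N (0%N :: K) i < nth 0%N (0%N :: K) j)%N.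
  move=> ij jK; have : sorted ltn (0%N :: K) by [].
  by move/(sorted_ltn_nth ltn_trans 0%N); apply => //; rewrite inE /=; lia.
have nthmonoW i j : (i <= j)%N -> (j <= size K)%N ->
    (nth 0%N (0%N :: K) i <= nth 0%N (0%N :: K) j)%N.
  by rewrite leq_eqVlt => /orP[/eqP->//|ij jK]; exact/ltnW/nthmono.
rewrite -/(sg s) -/(sg t).
wlog st : s t / (s <= t)%N => [W|].
  by have [/W//|/ltnW/W] := leqP s t; rewrite eq_sym wallC.
have sgm : (sg s <= sg t)%N by apply: tagnat.le_sig1; rewrite leEord.
apply/idP/idP.
  rewrite -val_eqE => ne; have {}ne : (sg s < sg t)%N by rewrite ltn_neqAle ne.
  pose k := nth 0%N (0%N :: K) (sg s).+1.
  have sk : (s < k)%N by exact: hi.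
  have kt : (k <= t)%N by apply: leq_trans (lo t); apply: nthmonoW => //; exact/ltnW.
  have kn : (k < n)%N by exact: leq_ltn_trans kt _.
  have kK : k \in K by rewrite /k /= mem_nth.
  have [l' ml ke] := mem_breakpoints mu kn kK.
  by apply/existsP; exists l'; rewrite ml andbT; apply/orP; left; lia.
move=> /existsP[l' /andP[/orP[|] cond ml]]; last by lia.
apply/eqP => /(congr1 val) /= eqs.
have l'n : (l'.+1 < n)%N by have := ltn_ord t; lia.
have : l'.+1 \in K by apply/(mem_breakpoints mu l'n); exists l'.
move=> /(nthP 0%N)[j jK ej].
have [jl|jl] := leqP (sg s) j; last first.
  have := nthmonoW j.+1 (sg s) jl (ltnW (sgK s)); rewrite /= ej.
  by have := lo s; lia.
have := nthmonoW (sg t).+1 j.+1; rewrite ltnS -eqs => /(_ jl jK) /=.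
by rewrite ej; have := hi t; rewrite -eqs /=; lia.
Qed.

Lemma block_orthogonal_wall n (mu : 'rV[R]_n) (n0 : (0 < n)%N) (Q : 'M[R]_n) :
  block_orthogonal (weight_type mu) Q <->
  orthogonal_group R n Q /\ forall s t : 'I_n, wall mu s t -> Q s t = 0.
Proof.
rewrite (block_orthogonalP (sum_weight_type mu n0)); split=> -[oQ Q0];
  by split=> // s t; have := Q0 s t; rewrite sig1_wall.
Qed.
End Blocks.

(** * Representatives and the symmetric matrix of a weighted flag *)

Section Representatives.
Variables (R : realType) (n : nat).
Implicit Types (mu nu : 'rV[R]_n) (U V Q : 'M[R]_n).
Local Notation WF := (weighted_flag R n).

(** Squaring makes the truncated weight differentiable at [x = r]. *)
Definition bump_sq (r x : R) : R := Num.max 0 (x - r) ^+ 2.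

(** The eigenvalue attached to position [i]. Between positions [i <= j] it drops
    by the sum of the truncated weights [l] with [i <= l < j], so it is constant
    on each block of [mu], and jumps at every wall as soon as [r] is smaller
    than all positive weights. *)
(* With [r = 0] it separates all weighted flags at once; [r > 0] is needed to
   compare with the metric, because [f] may vanish at 0 faster than any power of
   the weights. *)
Definition theta (r : R) mu : 'rV[R]_n :=
  \row_i \sum_(l < n | (i <= l)%N) bump_sq r (mu 0 l).

Definition blocky mu Q := forall s t : 'I_n, wall mu s t -> Q s t = 0.

(** A weighted flag seen as a symmetric matrix: for [r] below the positive
    weights, the subspaces of the flag are sums of its eigenspaces. *)
Definition flag_mx (r : R) mu U : 'M[R]_n :=
  U *m diag_mx (theta r mu) *m U^T.

Lemma bump_sq_ge0 r x : 0 <= bump_sq r x. Proof. exact: sqr_ge0. Qed.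

Lemma bump_sq_gt0 r x : (0 < bump_sq r x) = (r < x).
Proof.
rewrite /bump_sq; case: (leP 0 (x - r)) => xr; last first.
  by rewrite expr0n /= ltxx; apply/esym/negbTE; rewrite -leNgt -subr_le0 ltW.
by rewrite exprn_even_gt0 //= subr_eq0 lt_neqAle eq_sym -subr_ge0 xr andbT.
Qed.

Lemma thetaB r mu (i j : 'I_n) : (i <= j)%N ->
  theta r mu 0 i - theta r mu 0 j = \sum_(l < n | (i <= l < j)%N) bump_sq r (mu 0 l).
Proof.
move=> ij; rewrite !mxE (bigID (fun l : 'I_n => (l < j)%N)) /=.
rewrite -addrA [X in _ + X](_ : _ = 0) ?addr0 //.
apply/eqP; rewrite subr_eq0; apply/eqP/eq_bigl => l.
by rewrite -leqNgt andb_idl // => /(leq_trans ij).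
Qed.

Lemma theta_eq r mu (i j : 'I_n) : 0 <= r ->
  ~~ wall mu i j -> theta r mu 0 i = theta r mu 0 j.
Proof.
move=> r0; wlog ij : i j / (i <= j)%N => [W|].
  by have [/W//|/ltnW/W] := leqP i j; rewrite wallC => H /H ->.
move=> /existsPn nw; apply/eqP; rewrite -subr_eq0 thetaB //.
rewrite big1 // => l lij; have := nw l; rewrite lij /= -leNgt => ml.
apply/eqP; rewrite -[_ == _]negbK; apply/negP => ne.
have : 0 < bump_sq r (mu 0 l) by rewrite lt_neqAle eq_sym ne bump_sq_ge0.
by rewrite bump_sq_gt0 => /(le_lt_trans r0); rewrite ltNge ml.
Qed.

Lemma theta_neq r mu (i j : 'I_n) : (forall l, 0 < mu 0 l -> r < mu 0 l) ->
  wall mu i j -> theta r mu 0 i != theta r mu 0 j.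
Proof.
move=> rm; wlog ij : i j / (i <= j)%N => [W|].
  by have [/W//|/ltnW/W] := leqP i j; rewrite wallC eq_sym => H /H.
move=> /existsP[l /andP[/orP[lij|]]]; last by lia.
move=> /rm ml; rewrite -subr_eq0 thetaB // (bigD1 l) //= gt_eqF //.
by rewrite ltr_pwDl ?bump_sq_gt0 // sumr_ge0 // => k _; exact: bump_sq_ge0.
Qed.

Lemma mul_mx_diagE Q (d : 'rV[R]_n) s t : (Q *m diag_mx d) s t = Q s t * d 0 t.
Proof. by rewrite mul_mx_diag mxE. Qed.

Lemma mul_diag_mxE Q (d : 'rV[R]_n) s t : (diag_mx d *m Q) s t = d 0 s * Q s t.
Proof. by rewrite mul_diag_mx mxE. Qed.

Lemma blocky_comm r mu Q : 0 <= r ->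
  blocky mu Q -> Q *m diag_mx (theta r mu) = diag_mx (theta r mu) *m Q.
Proof.
move=> r0 bQ; apply/matrixP => s t; rewrite mul_mx_diagE mul_diag_mxE mulrC.
have [/bQ->|/(theta_eq r0)->//] := boolP (wall mu s t); by rewrite !mulr0.
Qed.

Lemma comm_blocky r mu Q : (forall l, 0 < mu 0 l -> r < mu 0 l) ->
  Q *m diag_mx (theta r mu) = diag_mx (theta r mu) *m Q -> blocky mu Q.
Proof.
move=> rm /matrixP cQ s t /(theta_neq rm); rewrite -subr_eq0 => ne.
have := cQ s t; rewrite mul_mx_diagE mul_diag_mxE mulrC => /eqP.
by rewrite -subr_eq0 -mulrBl mulf_eq0 subr_eq0 eq_sym -subr_eq0 (negbTE ne) => /eqP.
Qed.

(** Commuting with a diagonal matrix whose entries are constant exactly on the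
    blocks. The closure properties of [blocky] become one-line consequences. *)
Lemma blockyP mu Q :
  blocky mu Q <-> Q *m diag_mx (theta 0 mu) = diag_mx (theta 0 mu) *m Q.
Proof. by split; [exact: blocky_comm|exact: comm_blocky]. Qed.

Lemma blocky1 mu : blocky mu 1%:M.
Proof. by apply/blockyP; rewrite mul1mx mulmx1. Qed.

Lemma blockyM mu Q Q' : blocky mu Q -> blocky mu Q' -> blocky mu (Q *m Q').
Proof.
move=> /blockyP a /blockyP b; apply/blockyP.
by rewrite -mulmxA b mulmxA a mulmxA.
Qed.

Lemma blockyT mu Q : blocky mu Q -> blocky mu Q^T.
Proof. by move=> bQ s t; rewrite wallC mxE => /bQ. Qed.

Lemma blockyD mu Q Q' : blocky mu Q -> blocky mu Q' -> blocky mu (Q + Q').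
Proof. by move=> a b s t w; rewrite mxE a // b // addr0. Qed.

Lemma blockyZ mu c Q : blocky mu Q -> blocky mu (c *: Q).
Proof. by move=> a s t w; rewrite mxE a // mulr0. Qed.

Lemma blockyV mu Q : blocky mu Q -> blocky mu (invmx Q).
Proof.
move=> bQ; have [uQ|uQ] := boolP (Q \in unitmx); last by rewrite /invmx (negbTE uQ).
move: bQ => /blockyP a; apply/blockyP.
apply: (can_inj (mulKmx uQ)).
by rewrite mulmxA mulmxV // mul1mx mulmxA a -mulmxA mulmxV // mulmx1.
Qed.

Lemma orthT U : orthogonal_group R n U -> U *m U^T = 1%:M.
Proof. exact: mulmx1C. Qed.

Lemma orthM U V : orthogonal_group R n U -> orthogonal_group R n V ->
  orthogonal_group R n (U *m V).
Proof.
rewrite /orthogonal_group /= => oU oV.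
by rewrite trmx_mul mulmxA -(mulmxA V^T) oU mulmx1.
Qed.

Lemma orth_tr U : orthogonal_group R n U -> orthogonal_group R n U^T.
Proof. by move=> oU; rewrite /orthogonal_group /= trmxK orthT. Qed.

Lemma orth1 : orthogonal_group R n 1%:M.
Proof. by rewrite /orthogonal_group /= trmx1 mulmx1. Qed.

Lemma orth_row U i : orthogonal_group R n U -> \sum_j U i j ^+ 2 = 1.
Proof.
move=> /orthT/matrixP/(_ i i); rewrite !mxE eqxx => e; rewrite -[RHS]e.
by apply: eq_bigr => j _; rewrite mxE expr2.
Qed.

Lemma orth_le1 U i j : orthogonal_group R n U -> `|U i j| <= 1.
Proof.
move=> /(@orth_row _ i) s; rewrite -(@expr_le1 _ 2) //.
rewrite real_normK ?num_real // -[leRHS]s (bigD1 j) //= lerDl.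
by rewrite sumr_ge0 // => k _; exact: sqr_ge0.
Qed.

Hypothesis n_gt0 : (0 < n)%N.

Lemma flag_proj_eq mu U V : orthogonal_group R n U -> orthogonal_group R n V ->
  (flag_proj (weight_type mu) U = flag_proj (weight_type mu) V) <->
  blocky mu (U^T *m V).
Proof.
move=> oU oV; have bw Q := block_orthogonal_wall mu n_gt0 Q.
split=> [e|bQ].
  have : flag_proj (weight_type mu) V V.
    by exists 1%:M; rewrite ?mulmx1 //; apply/bw; split; [exact: orth1|exact: blocky1].
  rewrite -e => -[Q /bw[_ bQ] <-]; rewrite mulmxA.
  by rewrite (_ : U^T *m U = 1%:M) // mul1mx.
have oQ : orthogonal_group R n (U^T *m V) by apply: orthM => //; exact: orth_tr.
apply/seteqP; split=> _ [Q' /bw[oQ' bQ'] <-].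
  exists ((U^T *m V)^T *m Q').
    apply/bw; split; last by apply: blockyM => //; exact: blockyT.
    by apply: orthM => //; exact: orth_tr.
  by rewrite trmx_mul trmxK !mulmxA orthT // mul1mx.
exists (U^T *m V *m Q').
  by apply/bw; split; [exact: orthM|exact: blockyM].
by rewrite !mulmxA orthT // mul1mx.
Qed.

(** The pair [(mu, U)] is one of the representatives of [p]; from here on the
    quotient is only used through this relation. *)
Definition rep (p : WF) mu U :=
  exists x, [/\ p = wf_class x, mu = set_val x.1 & U = set_val x.2].

Lemma rep_simplex p mu U : rep p mu U -> simplex R n mu.
Proof. by move=> [x [_ -> _]]; exact: set_valP. Qed.

Lemma rep_orth p mu U : rep p mu U -> orthogonal_group R n U.
Proof. by move=> [x [_ _ ->]]; exact: set_valP. Qed.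

Lemma rep_ex (p : WF) : exists mu U, rep p mu U.
Proof.
exists (set_val (repr p).1), (set_val (repr p).2), (repr p); split=> //.
by rewrite /wf_class reprK.
Qed.

Lemma rep_make mu U : simplex R n mu -> orthogonal_group R n U ->
  exists p, rep p mu U.
Proof.
move=> sm oU; pose x := (SigSub (mem_set sm), SigSub (mem_set oU)).
by exists (wf_class x), x; split.
Qed.

Lemma wf_classP x y : wf_class x = wf_class y <-> @wf_rel R n x y.
Proof. by split; [move/eqquotP|move=> h; apply/eqquotP]. Qed.

Lemma rep_eq p q mu nu U V : rep p mu U -> rep q nu V ->
  p = q <-> mu = nu /\ blocky mu (U^T *m V).
Proof.
move=> rp rq; have oU := rep_orth rp; have oV := rep_orth rq.
move: rp rq => [x [-> mE UE]] [y [-> nE VE]]; rewrite wf_classP.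
split=> [/asboolP[]|[mn b]]; rewrite -?mE -?nE -?UE -?VE.
  by move=> <- /flag_proj_eq; split=> //; auto.
apply/asboolP; rewrite -?mE -?nE -?UE -?VE -mn; split=> //.
exact/flag_proj_eq.
Qed.

Lemma rep_fun p mu nu U V : rep p mu U -> rep p nu V ->
  mu = nu /\ blocky mu (U^T *m V).
Proof. by move=> a b; apply/(rep_eq a b). Qed.

Lemma rep_same p mu U V : rep p mu U -> orthogonal_group R n V ->
  blocky mu (U^T *m V) -> rep p mu V.
Proof.
move=> rp oV b; have [q rq] := rep_make (rep_simplex rp) oV.
by have -> : p = q by apply/(rep_eq rp rq).
Qed.

Lemma wf_coordsP p mu W :
  wf_coords p mu W <-> exists U, rep p mu U /\ W = flag_proj (weight_type mu) U.
Proof.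
split=> [[x [-> mE ->]]|[U [[x [-> mE UE]] ->]]].
  by exists (set_val x.2); split=> //; exists x.
by exists x; rewrite -UE.
Qed.

Lemma top_cellP p mu U : rep p mu U -> top_cell R n p <-> forall i, 0 < mu 0 i.
Proof.
move=> rp; split=> [[nu [W [/wf_coordsP[V [rq _]] pos]]]|pos].
  by have [->] := rep_fun rp rq.
exists mu, (flag_proj (weight_type mu) U); split=> //.
by apply/wf_coordsP; exists U.
Qed.

Lemma weight_type_pos mu : (forall i, 0 < mu 0 i) -> weight_type mu = full_type n.
Proof.
move=> pos; have sE : support_indices mu = iota 1 n.
  rewrite /support_indices; have -> : [seq i <- enum 'I_n | 0 < mu 0 i] = enum 'I_n.
    by apply/all_filterP/allP => i _; exact: pos.
  rewrite (map_comp S (@nat_of_ord n)) -/val val_enum_ord.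
  by rewrite -(addn0 1%N) iotaDl.
have lE : last 0%N (iota 1 n) = n.
  by rewrite (last_nth 0%N) /= size_iota -[iota 1 n]/(behead (iota 0 n.+1))
    -[0%N :: _]/(iota 0 n.+1) nth_iota.
rewrite weight_typeE /breakpoints sE lE eqxx /full_type.
have gen m k : pairmap (fun a b => (b - a)%N) m (iota m.+1 k) = nseq k 1%N.
  by elim: k m => //= k IH m; rewrite IH subSnn.
exact: gen.
Qed.

(** Representatives of one weighted flag differ by a matrix commuting with the
    eigenvalues, so the symmetric matrix depends on the weighted flag only. *)
Lemma flag_mx_fun r p mu nu U V : 0 <= r -> rep p mu U -> rep p nu V ->
  flag_mx r mu U = flag_mx r nu V.
Proof.
move=> r0 rp rq; have [<-] := rep_fun rp rq.
move=> /(blocky_comm r0) c; rewrite /flag_mx.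
have oU := orthT (rep_orth rp); have oV := orthT (rep_orth rq).
have VE : V = U *m (U^T *m V) by rewrite mulmxA oU mul1mx.
have QQ : (U^T *m V) *m (U^T *m V)^T = 1%:M.
  by rewrite trmx_mul trmxK mulmxA -(mulmxA _ V) oV mulmx1 (rep_orth rp).
rewrite VE; move: (U^T *m V) c QQ => Q c QQ.
by rewrite trmx_mul -(mulmxA U Q) c !mulmxA -(mulmxA _ Q) QQ mulmx1.
Qed.

(** Conversely [U^T V] commutes with the eigenvalues when both matrices agree,
    and distinct blocks have distinct eigenvalues. *)
Lemma flag_mx_sep r p q mu U V :
  (forall l, 0 < mu 0 l -> r < mu 0 l) -> rep p mu U -> rep q mu V ->
  flag_mx r mu U = flag_mx r mu V -> p = q.
Proof.
move=> rm rp rq e; apply/(rep_eq rp rq); split=> //; apply: (comm_blocky rm).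
have oU : U^T *m U = 1%:M := rep_orth rp; have oV : V^T *m V = 1%:M := rep_orth rq.
have := congr1 (fun X => U^T *m X *m V) e; rewrite /flag_mx !mulmxA oU mul1mx => ->.
by rewrite -!mulmxA oV mulmx1.
Qed.

End Representatives.

(** * Curves of class C^1 without division or one-sided limits *)

Section Calculus.
Variable R : realType.

Lemma mx_norm_leP m n (A : 'M[R]_(m, n)) (e : R) : 0 <= e ->
  `|A| <= e <-> forall i j, `|A i j| <= e.
Proof.
move=> e0; rewrite [`|A|]mx_normrE; split=> [le i j|le].
  by apply: le_trans le; exact: (le_bigmax _ (fun ij => `|A ij.1 ij.2|) (i, j)).
by apply/bigmax_leP; split=> // -[i j] _; exact: le.
Qed.

Lemma mx_entry_le m n (A : 'M[R]_(m, n)) i j : `|A i j| <= `|A|.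
Proof. by have /(_ i j) := (mx_norm_leP A (normr_ge0 A)).1 (lexx _). Qed.

Lemma mulmx_norm_le m n p (A : 'M[R]_(m, n)) (B : 'M[R]_(n, p)) :
  `|A *m B| <= n%:R * `|A| * `|B|.
Proof.
apply/mx_norm_leP => [|i j]; first by rewrite !mulr_ge0.
rewrite mxE; apply: le_trans (ler_norm_sum _ _ _) _.
apply: (@le_trans _ _ (\sum_(k < n) `|A| * `|B|)).
  by apply: ler_sum => k _; rewrite normrM ler_pM // mx_entry_le.
by rewrite sumr_const card_ord -mulrA mulr_natl.
Qed.

Variable E : normedModType R.
Implicit Types (u du : R -> E) (t : R).

Lemma nearP (P : R -> Prop) t : (\forall s \near t, P s) <->
  exists2 d : R, 0 < d & forall s, `|s - t| < d -> P s.
Proof.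
split=> [/nbhs_ballP[d /= d0 dP]|[d d0 dP]].
  by exists d => // s sd; apply: dP; rewrite /ball /= distrC.
by apply/nbhs_ballP; exists d => // s; rewrite /ball /= distrC; exact: dP.
Qed.

(** Differentiability as an estimate on the increment. Without a quotient the
    point [s = t] needs no separate treatment, and the estimate passes through
    clamping, restriction and affine substitution. *)
Lemma is_deriveP u t (l : E) : is_derive t (1 : R) u l <->
  forall e : R, 0 < e -> exists2 d : R, 0 < d &
    forall s, `|s - t| < d -> `|u s - u t - (s - t) *: l| <= e * `|s - t|.
Proof.
split.
  move=> [+ <-] e e0; rewrite /derivable => /cvgrPdist_le /(_ e e0).
  rewrite near_withinE => /nearP[d d0 H]; exists d => // s sd.
  have [->|st] := eqVneq s t; first by rewrite !subrr scale0r subrr !normr0 mulr0.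
  rewrite -subr_eq0 in st.
  have K : `|'D_1 u t - (s - t)^-1 *: (u s - u t)| <= e.
    have := H (s - t); rewrite subr0 => /(_ sd st).
    by rewrite /= [(s - t) *: 1]mulr1 subrK.
  rewrite -[u s - u t](scalerKV st) -scalerBr normrZ mulrC ler_pM2r ?normr_gt0 //.
  by rewrite distrC.
move=> H; have C : h^-1 *: (u (h *: 1 + t) - u t) @[h --> 0^'] --> l.
  apply/cvgrPdist_le => e /H[d d0 K]; rewrite near_withinE; apply/nearP.
  exists d => // h; rewrite subr0 => hd h0.
  have := K (h + t); rewrite addrK => /(_ hd).
  rewrite -[u _ - u t](scalerKV h0) -scalerBr normrZ mulrC ler_pM2r ?normr_gt0 //.
  by rewrite distrC [h *: 1]mulr1.
split; first by apply/cvg_ex; exists l.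
by apply: cvg_lim C.
Qed.

Definition C1R u du := (forall t, is_derive t (1 : R) u (du t)) /\ continuous du.

(** The nearest point of the segment from [c] to [d]. *)
Definition clamp (c d t : R) := Num.max c (Num.min t d).

Lemma clamp_id c d t : c <= t <= d -> clamp c d t = t.
Proof. by move=> /andP[ct td]; rewrite /clamp min_l // max_r. Qed.

Lemma clamp_in c d t : c <= d -> c <= clamp c d t <= d.
Proof. by move=> cd; rewrite /clamp le_max lexx ge_max cd ge_min lexx orbT. Qed.

Lemma clamp_lt c d t : c <= d -> t <= c -> clamp c d t = c.
Proof. by move=> cd tc; rewrite /clamp min_l ?max_l // (le_trans tc). Qed.

Lemma clamp_gt c d t : c <= d -> d <= t -> clamp c d t = d.
Proof. by move=> cd dt; rewrite /clamp min_r ?max_r. Qed.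

Lemma clamp_lip c d s t : `|clamp c d s - clamp c d t| <= `|s - t|.
Proof.
have maxl (a x y : R) : `|Num.max a x - Num.max a y| <= `|x - y|.
  have := ler_norm (x - y); have := ler_norm (y - x); rewrite distrC.
  move: (normr_ge0 (x - y)); move: `|x - y| => N ? ? ?; rewrite ler_norml.
  by case: (leP a x) => ?; case: (leP a y) => ?; apply/andP; split; lra.
have minl (a x y : R) : `|Num.min x a - Num.min y a| <= `|x - y|.
  have := ler_norm (x - y); have := ler_norm (y - x); rewrite distrC.
  move: (normr_ge0 (x - y)); move: `|x - y| => N ? ? ?; rewrite ler_norml.
  by case: (leP x a) => ?; case: (leP y a) => ?; apply/andP; split; lra.
by rewrite /clamp; apply: le_trans (maxl _ _ _) (minl _ _ _).
Qed.

Lemma continuous_clamp (T : topologicalType) (g : R -> T) c d : c <= d ->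
  {within `[c, d], continuous g} -> continuous (g \o clamp c d).
Proof.
move=> cd /subspace_continuousP gc t; have tin := clamp_in t cd.
apply: cvg_comp (gc (clamp c d t) _); last by rewrite /= in_itv.
move=> A HA.
have /nearP[e e0 H] : \forall s \near clamp c d t, `[c, d]%classic s -> A s by exact: HA.
apply/nearP; exists e => // s st; apply: H; last by rewrite /= in_itv /= clamp_in.
exact: le_lt_trans (clamp_lip c d s t) st.
Qed.

Lemma C1_onP (J : set R) u du t :
  (fun s => (s - t)^-1 *: (u s - u t)) @ within J t^' --> du t <->
  forall e : R, 0 < e -> exists2 d : R, 0 < d & forall s, J s ->
    `|s - t| < d -> `|u s - u t - (s - t) *: du t| <= e * `|s - t|.
Proof.
split=> [/cvgrPdist_le H e /H|H].
  rewrite !near_withinE => /nearP[d d0 K]; exists d => // s Js sd.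
  have [->|st] := eqVneq s t; first by rewrite !subrr scale0r subrr !normr0 mulr0.
  have := K _ sd st Js; rewrite -subr_eq0 in st => {}K.
  rewrite -[u s - u t](scalerKV st) -scalerBr normrZ mulrC ler_pM2r ?normr_gt0 //.
  by rewrite distrC.
apply/cvgrPdist_le => e /H[d d0 K].
rewrite !near_withinE; apply/nearP; exists d => // s sd st Js.
have := K _ Js sd; rewrite -subr_eq0 in st => {}K; move: K.
rewrite -[u s - u t](scalerKV st) -scalerBr normrZ mulrC ler_pM2r ?normr_gt0 //.
by rewrite distrC scalerK.
Qed.

(** Prolong [u] by its tangent lines at the two ends. A C^1 arc on a closed
    segment thus becomes the restriction of a C^1 curve on the whole line, and
    one-sided derivatives disappear from the rest of the argument. *)
Lemma C1_on_extend u c d : c < d -> C1_on `[c, d] u ->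
  exists v dv, C1R v dv /\ {in `[c, d], v =1 u}.
Proof.
move=> cd [du Du Dc]; have cd' := ltW cd.
(* For t in the segment the correction vanishes; outside, this is the tangent line. *)
pose v t := u (clamp c d t) + (t - clamp c d t) *: du (clamp c d t).
exists v, (du \o clamp c d); split; last first.
  by move=> t; rewrite in_itv /= => tcd; rewrite /v clamp_id // subrr scale0r addr0.
split; last exact: continuous_clamp.
have vl t : t <= c -> v t = u c + (t - c) *: du c.
  by move=> tc; rewrite /v clamp_lt.
have vr t : d <= t -> v t = u d + (t - d) *: du d.
  by move=> tc; rewrite /v clamp_gt.
have vm t : c <= t <= d -> v t = u t.
  by move=> tcd; rewrite /v clamp_id // subrr scale0r addr0.
have aff a b (s t : R) : a + (s - b) *: du b - (a + (t - b) *: du b) - (s - t) *: du b = 0.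
  rewrite opprD addrACA subrr add0r -scalerBl -scalerBl.
  by rewrite (_ : _ - _ = 0) ?scale0r //; ring.
move=> t; apply/is_deriveP => e e0.
have triv (s : R) : 0 <= e * `|s - t| by rewrite mulr_ge0 // ltW.
have [tc|ct] := ltP t c.
  exists (c - t) => [|s]; first by rewrite subr_gt0.
  move=> st; have sc : s <= c by move: (ltr_normlW st); rewrite ltrD2r => /ltW.
  by rewrite /= clamp_lt ?(ltW tc) // (vl s) ?(vl t) ?(ltW tc) // aff normr0.
have [td|dt] := ltP d t.
  exists (t - d) => [|s]; first by rewrite subr_gt0.
  move=> st; have sd : d <= s by move: st; rewrite distrC => /ltr_normlW; lra.
  by rewrite /= clamp_gt ?(ltW td) // (vr s) ?(vr t) ?(ltW td) // aff normr0.
have tcd : c <= t <= d by rewrite ct dt.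
have /C1_onP/(_ e e0)[r r0 H] := Du t tcd.
pose r1 := if t == c then r else t - c; pose r2 := if t == d then r else d - t.
exists (Num.min r (Num.min r1 r2)) => [|s].
  rewrite !lt_min r0 /r1 /r2; case: eqP => [_|/eqP tc]; case: eqP => [_|/eqP td] /=;
    rewrite ?r0 ?subr_gt0 ?lt_neqAle ?ct ?dt ?td ?andbT // 1?eq_sym //.
rewrite !lt_min => /and3P[sr sr1 sr2].
rewrite /= clamp_id // (vm t) //.
have [sc|cs] := ltP s c.
  move: sr1; rewrite /r1; case: eqP => [te _|_ st].
    by rewrite (vl s) ?(ltW sc) // te addrAC addrK subrr normr0 mulr_ge0 // ltW.
  by exfalso; move: st; rewrite distrC => /ltr_normlW; lra.
have [sd|ds] := ltP d s.
  move: sr2; rewrite /r2; case: eqP => [te _|_ st].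
    by rewrite (vr s) ?(ltW sd) // te addrAC addrK subrr normr0 mulr_ge0 // ltW.
  by exfalso; have := ltr_normlW st; lra.
by rewrite (vm s) ?cs ?ds //; apply: H => //=; rewrite in_itv /= cs.
Qed.

Lemma C1R_C1_on u du (J : set R) : C1R u du -> C1_on J u.
Proof.
move=> [Du Dc]; exists du; last exact: continuous_subspaceT.
move=> t _; apply/C1_onP => e e0; have /is_deriveP/(_ e e0)[r r0 H] := Du t.
by exists r => // s _; exact: H.
Qed.

Lemma C1_on_sub u (J J' : set R) : J' `<=` J -> C1_on J u -> C1_on J' u.
Proof.
move=> JJ [du Du Dc]; exists du; last exact: continuous_subspaceW Dc.
move=> t /JJ/Du/C1_onP D; apply/C1_onP => e /D[r r0 H].
by exists r => // s /JJ; exact: H.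
Qed.

Lemma C1R_affine u du (a b : R) : C1R u du ->
  C1R (fun t => u (a * t + b)) (fun t => a *: du (a * t + b)).
Proof.
move=> [Du Dc]; split; last first.
  move=> t; apply: cvgZr; apply: (@continuous_comp _ _ _ (fun t : R => a * t + b) du).
    by apply: cvgD; [apply: cvgM; [exact: cvg_cst|exact: cvg_id]|exact: cvg_cst].
  exact: Dc.
move=> t; apply/is_deriveP => e e0.
have [->|a0] := eqVneq a 0.
  (* A constant curve: the substitution below divides by a. *)
  exists 1 => // s _; rewrite !mul0r !scale0r scaler0 subrr subr0 normr0.
  by rewrite mulr_ge0 // ltW.
have a0' : 0 < `|a| by rewrite normr_gt0.
have /is_deriveP/(_ (e / `|a|))[] := Du (a * t + b); first exact: divr_gt0.
move=> r r0 H; exists (r / `|a|) => [|s sd]; first exact: divr_gt0.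
have sE : a * s + b - (a * t + b) = a * (s - t) by ring.
have := H (a * s + b); rewrite sE normrM -ltr_pdivlMl // mulrC => /(_ sd).
by rewrite scalerA [(s - t) * a]mulrC mulrA divfK ?gt_eqF.
Qed.
End Calculus.

Section MatrixCalculus.
Variables (R : realType) (m n : nat).
Implicit Types (u du : R -> 'M[R]_(m, n)).

Lemma is_derive_mxP u t (l : 'M[R]_(m, n)) : is_derive t (1 : R) u l <->
  forall i j, is_derive t (1 : R) (fun s => u s i j) (l i j).
Proof.
split=> [D i j|D].
  apply/is_deriveP => e e0; have /is_deriveP/(_ e e0)[r r0 H] := D.
  exists r => // s /H; apply: le_trans; apply: le_trans (mx_entry_le _ i j).
  by rewrite !mxE.
apply/is_deriveP => e e0.
have : \forall s \near t, forall ij : 'I_m * 'I_n,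
   `|u s ij.1 ij.2 - u t ij.1 ij.2 - (s - t) *: l ij.1 ij.2| <= e * `|s - t|.
  apply: (@filter_forall _ _ (fun (ij : 'I_m * 'I_n) s =>
    `|u s ij.1 ij.2 - u t ij.1 ij.2 - (s - t) *: l ij.1 ij.2| <= e * `|s - t|)
    (nbhs t) (@nbhs_filter R t)).
  move=> -[i j]; apply/nearP.
  by have /is_deriveP/(_ e e0) := D i j.
move=> /nearP[r r0 H]; exists r => // s /H {}H.
apply/mx_norm_leP => [|i j]; first by rewrite mulr_ge0 // ltW.
by have := H (i, j); rewrite !mxE.
Qed.

Lemma continuous_mxP (T : topologicalType) (u : T -> 'M[R]_(m, n)) (x : T) :
  (forall i j, {for x, continuous (fun s => u s i j)}) -> {for x, continuous u}.
Proof.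
move=> C; apply/cvgrPdist_le => e e0.
have : \forall s \near x, forall ij : 'I_m * 'I_n,
   `|u x ij.1 ij.2 - u s ij.1 ij.2| <= e.
  apply: (@filter_forall _ _ (fun (ij : 'I_m * 'I_n) s =>
    `|u x ij.1 ij.2 - u s ij.1 ij.2| <= e)
    (nbhs x) (@nbhs_filter T x)).
  move=> -[i j].
  by have /cvgrPdist_le/(_ e e0) := C i j.
apply: filterS => s H; apply/mx_norm_leP => [|i j]; first exact: ltW.
by have := H (i, j); rewrite !mxE.
Qed.

Lemma continuous_entry (T : topologicalType) (u : T -> 'M[R]_(m, n)) (x : T) i j :
  {for x, continuous u} -> {for x, continuous (fun s => u s i j)}.
Proof.
move=> C; apply/cvgrPdist_le => e e0.
have /cvgrPdist_le/(_ e e0) := C.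
apply: filterS => s; apply: le_trans; apply: le_trans (mx_entry_le _ i j).
by rewrite !mxE.
Qed.

End MatrixCalculus.

(** * Primitives and length comparison *)

Section Primitives.
Variable R : realType.

Lemma continuous_sumf (T : topologicalType) (x : T) I (r : seq I) (P : pred I)
    (F : I -> T -> R) : (forall i, P i -> {for x, continuous (F i)}) ->
  {for x, continuous (fun t => \sum_(i <- r | P i) F i t)}.
Proof.
move=> C; elim: r => [|i r IH].
  rewrite (_ : (fun _ => _) = cst 0); first exact: cvg_cst.
  by apply/funext => t; rewrite big_nil.
rewrite (_ : (fun _ => _) = fun t => (if P i then F i t else 0) + \sum_(j <- r | P j) F j t).
  by apply: cvgD => //; case: ifP => [/C//|_]; exact: cvg_cst.
by apply/funext => t; rewrite big_cons; case: ifP => //; rewrite add0r.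
Qed.

Lemma is_derive_sumf (t : R) I (r : seq I) (P : pred I)
    (F : I -> R -> R) dF : (forall i, P i -> is_derive t (1 : R) (F i) (dF i)) ->
  is_derive t (1 : R) (fun s => \sum_(i <- r | P i) F i s) (\sum_(i <- r | P i) dF i).
Proof.
move=> C; elim: r => [|i r IH].
  rewrite big_nil (_ : (fun _ => _) = cst 0); first exact: is_derive_cst.
  by apply/funext => s; rewrite big_nil.
rewrite big_cons; case: ifP => [Pi|nPi].
  rewrite (_ : (fun _ => _) = F i + fun s => \sum_(j <- r | P j) F j s).
    exact: (is_deriveD (C _ Pi) IH).
  by apply/funext => s; rewrite big_cons Pi.
by rewrite (_ : (fun _ => _) = fun s => \sum_(j <- r | P j) F j s) //;
  apply/funext => s; rewrite big_cons nPi.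
Qed.

Lemma is_derive_mulf (t : R) (g h : R -> R) dg dh :
  is_derive t (1 : R) g dg -> is_derive t (1 : R) h dh ->
  is_derive t (1 : R) (fun s => g s * h s) (dg * h t + g t * dh).
Proof. by move=> Dg Dh; apply: is_derive_eq; rewrite addrC mulrC. Qed.

(** Lengths are handled as increments of a primitive of the speed: additivity,
    substitution and comparison then need derivatives only, and integrals enter
    once, when the length of an actual path is identified. *)
Definition primitive (P : R -> R) (c d : R) (s : R -> R) :=
  forall t, c <= t <= d -> is_derive t (1 : R) P (s t).

Lemma is_derive_cont (P : R -> R) t l : is_derive t (1 : R) P l ->
  {for t, continuous P}.
Proof.
by move=> D; apply: differentiable_continuous; apply/derivable1_diffP; case: D.
Qed.

Lemma derive_ge0_mono (h : R -> R) (c d : R) (dh : R -> R) : c <= d ->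
  {within `[c, d], continuous h} ->
  (forall t, c < t < d -> is_derive t (1 : R) h (dh t)) ->
  (forall t, c < t < d -> 0 <= dh t) -> h c <= h d.
Proof.
move=> cd C D D0; apply: (@ger0_derive1_le_cc _ h c d) => //.
- by move=> t; rewrite in_itv /= => /D[].
- by move=> t; rewrite in_itv /= => tcd; have [_ de] := D _ tcd; rewrite derive1E de D0.
- by rewrite in_itv /= lexx.
- by rewrite in_itv /= lexx andbT.
Qed.

(** The difference of the two primitives has a nonnegative derivative. *)
Lemma primitive_le P Q c d s s' : c <= d -> primitive P c d s -> primitive Q c d s' ->
  (forall t, c < t < d -> s t <= s' t) -> P d - P c <= Q d - Q c.
Proof.
move=> cd DP DQ ss.
have := @derive_ge0_mono (Q - P) c d (fun t => s' t - s t) cd.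
have QP x : (Q - P) x = Q x - P x by [].
rewrite !QP => H.
suff : Q c - P c <= Q d - P d by lra.
apply: H => [|t tcd|t tcd].
- apply: continuous_in_subspaceT => t; rewrite inE /= in_itv /= => tcd.
  by apply: cvgB; apply: is_derive_cont; [exact: DQ|exact: DP].
- have tcd' : c <= t <= d by lra.
  exact: (is_deriveB (DQ _ tcd') (DP _ tcd')).
- by rewrite subr_ge0 ss.
Qed.

Lemma primitive_lin (K c d : R) : primitive (fun t => K * t) c d (fun=> K).
Proof.
move=> t _; have := is_derive_mulf (is_derive_cst K t 1) (is_derive_id t 1).
by rewrite mul0r add0r mulr1.
Qed.

Lemma primitive_bound P c d s (K : R) : c <= d -> primitive P c d s ->
  (forall t, c < t < d -> s t <= K) -> P d - P c <= K * (d - c).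
Proof.
move=> cd DP sK; rewrite mulrBr.
exact: (primitive_le cd DP (@primitive_lin K c d) sK).
Qed.

Lemma primitive_ge0 P c d s : c <= d -> primitive P c d s ->
  (forall t, 0 <= s t) -> 0 <= P d - P c.
Proof.
move=> cd DP s0; have := primitive_le cd (@primitive_lin 0 c d) DP (fun t _ => s0 t).
by rewrite !mul0r subr0.
Qed.

(** The speed [s] dominates [dh] up to the factor [K], so [h] moves at most [K]
    times the length. *)
Lemma primitive_abs_le P (h dh : R -> R) (c d : R) s (K : R) : c <= d -> 0 <= K ->
  primitive P c d s -> primitive h c d dh ->
  (forall t, c < t < d -> `|dh t| <= K * s t) ->
  `|h d - h c| <= K * (P d - P c).
Proof.
move=> cd K0 DP Dh le.
have DKP : primitive (fun t => K * P t) c d (fun t => K * s t).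
  move=> t tcd; have := is_derive_mulf (is_derive_cst K t 1) (DP t tcd).
  by rewrite mul0r add0r.
have DN : primitive (- h) c d (- dh) by move=> t tcd; exact: (is_deriveN (Dh t tcd)).
rewrite ler_norml mulrBr; apply/andP; split.
  have NE x : (- h) x = - h x by [].
  rewrite lerNl opprB (_ : h c - h d = (- h) d - (- h) c); last by rewrite !NE; ring.
  apply: (primitive_le cd DN DKP) => t /le; rewrite ler_norml => /andP[+ _].
  by rewrite lerNl.
by apply: (primitive_le cd Dh DKP) => t /le; rewrite ler_norml => /andP[].
Qed.

(** Integrate the clamped speed from a point strictly left of [c], so that the
    fundamental theorem gives a two-sided derivative at both ends. *)
Lemma primitive_exists (c d : R) (s : R -> R) : c < d -> continuous (s \o clamp c d) ->
  exists P, primitive P c d s.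
Proof.
move=> cd C; set g := s \o clamp c d in C.
(* The starting point c - 1 leaves room on the left of c. *)
pose P x := (\int[@lebesgue_measure R]_(t in `[(c - 1), x]) g t)%R.
exists P => t /andP[ct td].
have [] := @continuous_FTC1_closed R g (c - 1) t (t + 1) _ _ _ _.
- by rewrite ltrDl.
- apply: continuous_compact_integrable; first exact: segment_compact.
  exact: continuous_subspaceT.
- by lra.
- exact: C.
move=> D1 D2; rewrite -[s t]/((s \o id) t).
have -> : (s \o id) t = g t by rewrite /g /= clamp_id // ct.
by rewrite -D2 derive1E; exact: derivableP.
Qed.

End Primitives.

(** * The norm of a velocity and C^1 arcs of weighted frames *)

Section Metric.
Variables (R : realType) (n : nat) (f : 'rV[R]_n -> R) (kf : R).
Hypothesis n_gt0 : (0 < n)%N.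
Hypothesis f_ge0 : forall mu, cube R n mu -> 0 <= f mu.
Hypothesis kf_ge0 : 0 <= kf.
Hypothesis f_lip : forall x y, cube R n x -> cube R n y ->
  `|f x - f y| <= kf * `|x - y|.
Hypothesis f_eq0 : forall mu, cube R n mu -> (f mu = 0 <-> mu = 0).
Implicit Types (mu nu a : 'rV[R]_n) (B : 'M[R]_n).

Definition gnorm mu a B := Num.sqrt (metric_g f mu (a, B) (a, B)).

Lemma trunc_cube mu i j : cube R n mu -> cube R n (truncation mu i j).
Proof. by move=> c k; rewrite mxE; case: ifP => // _; rewrite lexx ler01. Qed.

Lemma trunc_lip mu nu i j : `|truncation mu i j - truncation nu i j| <= `|mu - nu|.
Proof.
apply/mx_norm_leP => [//|k l]; rewrite !mxE.
case: ifP => _; last by rewrite subrr normr0.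
by have := mx_entry_le (mu - nu) 0 l; rewrite !mxE.
Qed.

Lemma metric_gE mu a B : metric_g f mu (a, B) (a, B) =
  \sum_i a 0 i ^+ 2 +
  \sum_(i < n) \sum_(j < n | (i < j)%N) (f (truncation mu i j) * B i j) ^+ 2.
Proof.
rewrite /metric_g /=; congr (_ + _); apply: eq_bigr => i _; rewrite -?expr2 //.
by apply: eq_bigr => j _; rewrite exprMn expr2 -mulrA.
Qed.

Lemma sum_sq_ge0 I (r : seq I) (P : pred I) (F : I -> R) :
  0 <= \sum_(i <- r | P i) F i ^+ 2.
Proof. by apply: sumr_ge0 => i _; exact: sqr_ge0. Qed.

Lemma metric_ge0 mu a B : 0 <= metric_g f mu (a, B) (a, B).
Proof.
by rewrite metric_gE addr_ge0 ?sum_sq_ge0 // sumr_ge0 // => i _; exact: sum_sq_ge0.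
Qed.

Lemma gnorm_ge0 mu a B : 0 <= gnorm mu a B. Proof. exact: sqrtr_ge0. Qed.

Lemma abs_le_sqrt (x y : R) : x ^+ 2 <= y -> `|x| <= Num.sqrt y.
Proof. by move=> xy; rewrite -sqrtr_sqr ler_wsqrtr. Qed.

Lemma gnorm_ge_a mu a B i : `|a 0 i| <= gnorm mu a B.
Proof.
apply: abs_le_sqrt; rewrite metric_gE (bigD1 i) //= -addrA lerDl.
rewrite addr_ge0 ?sum_sq_ge0 // sumr_ge0 // => k _; exact: sum_sq_ge0.
Qed.

Lemma gnorm_ge_B mu a B (i j : 'I_n) : (i < j)%N ->
  `|f (truncation mu i j) * B i j| <= gnorm mu a B.
Proof.
move=> ij; apply: abs_le_sqrt; rewrite metric_gE.
rewrite addrC (bigD1 i) //= (bigD1 j) //= -!addrA lerDl.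
rewrite !addr_ge0 ?sum_sq_ge0 // sumr_ge0 // => k _; exact: sum_sq_ge0.
Qed.

(** There are [n] terms bounded by [x^2] and at most [n^2] bounded by [y^2]. *)
Lemma gnorm_le mu a B (x y : R) : 0 <= x -> 0 <= y ->
  (forall i, `|a 0 i| <= x) ->
  (forall i j : 'I_n, (i < j)%N -> `|f (truncation mu i j) * B i j| <= y) ->
  gnorm mu a B <= n%:R * (x + y).
Proof.
move=> x0 y0 ax By; have n1 : 1 <= n%:R :> R by rewrite ler1n.
have n0 : 0 <= n%:R :> R by [].
rewrite -[leRHS]ger0_norm ?mulr_ge0 ?addr_ge0 // -sqrtr_sqr ler_wsqrtr // metric_gE.
have sq (u v : R) : `|u| <= v -> u ^+ 2 <= v ^+ 2.
  by move=> uv; rewrite -(real_normK (num_real u)) lerXn2r ?nnegrE // (le_trans _ uv).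
have Sa : \sum_i a 0 i ^+ 2 <= n%:R * x ^+ 2.
  apply: (@le_trans _ _ (\sum_(i < n) x ^+ 2)); first by apply: ler_sum => i _; exact: sq.
  by rewrite sumr_const card_ord mulr_natl.
have SB : \sum_(i < n) \sum_(j < n | (i < j)%N) (f (truncation mu i j) * B i j) ^+ 2
    <= n%:R * (n%:R * y ^+ 2).
  apply: (@le_trans _ _ (\sum_(i < n) n%:R * y ^+ 2)); last first.
    by rewrite sumr_const card_ord [leRHS]mulr_natl.
  apply: ler_sum => i _; apply: (@le_trans _ _ (\sum_(j < n) y ^+ 2)).
    rewrite [leRHS](bigID (fun j : 'I_n => (i < j)%N)) /= -[leLHS]addr0 lerD //.
      by apply: ler_sum => j ij; apply: sq; exact: By.
    exact: sum_sq_ge0.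
  by rewrite sumr_const card_ord mulr_natl.
apply: le_trans (lerD Sa SB) _.
have : n%:R * x ^+ 2 <= n%:R * (n%:R * x ^+ 2).
  by rewrite ler_wpM2l // ler_peMl // sqr_ge0.
have : 0 <= n%:R * (n%:R * (x * y)) by rewrite !mulr_ge0.
rewrite exprMn sqrrD; move: (n%:R : R) => N; nra.
Qed.

(** The square root of [s^2 + n^2 d^2] is at most [s + n d]. *)
Lemma gnorm_add mu nu a a' B (d : R) : 0 <= d ->
  (forall i, `|a' 0 i| <= `|a 0 i|) ->
  (forall i j : 'I_n, (i < j)%N -> (f (truncation nu i j) * B i j) ^+ 2 <=
     (f (truncation mu i j) * B i j) ^+ 2 + d ^+ 2) ->
  gnorm nu a' B <= gnorm mu a B + n%:R * d.
Proof.
move=> d0 aa BB; have S0 : 0 <= gnorm mu a B + n%:R * d.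
  by rewrite addr_ge0 ?gnorm_ge0 // mulr_ge0.
rewrite -[leRHS]ger0_norm // -sqrtr_sqr ler_wsqrtr // sqrrD.
rewrite sqr_sqrtr ?metric_ge0 // !metric_gE.
rewrite -addrA -addrA lerD //.
  apply: ler_sum => i _; rewrite -(real_normK (num_real (a' 0 i))).
  by rewrite -(real_normK (num_real (a 0 i))) lerXn2r ?nnegrE.
apply: (@le_trans _ _ (\sum_(i < n) (\sum_(j < n | (i < j)%N)
    (f (truncation mu i j) * B i j) ^+ 2 + n%:R * d ^+ 2))).
  apply: ler_sum => i _.
  apply: (@le_trans _ _ (\sum_(j < n | (i < j)%N)
    ((f (truncation mu i j) * B i j) ^+ 2 + d ^+ 2))).
    by apply: ler_sum => j ij; exact: BB.
  rewrite big_split /= lerD2l sumr_const -[leLHS]mulr_natl ler_wpM2r ?sqr_ge0 //.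
  by rewrite ler_nat -[leqRHS]card_ord max_card.
rewrite big_split /= lerD2l sumr_const card_ord -[leLHS]mulr_natl mulrA -expr2 -exprMn.
rewrite lerDr.
by rewrite mulrn_wge0 // !mulr_ge0 ?gnorm_ge0.
Qed.

(** The speed of the arc [(m, V)]: the skew matrix [B] of the metric is the
    logarithmic derivative [V^T V']. *)
Definition sigma (m dm : R -> 'rV[R]_n) (V dV : R -> 'M[R]_n) t :=
  gnorm (m t) (dm t) ((V t)^T *m dV t).

Lemma simplex_cube mu : simplex R n mu -> cube R n mu. Proof. by case. Qed.

Lemma continuous_gnorm (T : topologicalType) (m dm : T -> 'rV[R]_n)
    (B : T -> 'M[R]_n) x :
  (forall t, cube R n (m t)) -> {for x, continuous m} -> {for x, continuous dm} ->
  {for x, continuous B} -> {for x, continuous (fun t => gnorm (m t) (dm t) (B t))}.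
Proof.
move=> mc Cm Cdm CB.
apply: (@continuous_comp _ _ _ (fun t => metric_g f (m t) (dm t, B t) (dm t, B t)));
  last exact: sqrt_continuous.
rewrite /metric_g /=; apply: cvgD; apply: continuous_sumf => i _.
  by apply: cvgM; exact: continuous_entry.
apply: continuous_sumf => j ij.
have Cf : {for x, continuous (fun t => f (truncation (m t) i j))}.
  apply/cvgrPdist_le => e e0.
  have e1 : 0 < e / (kf + 1) by rewrite divr_gt0 // ltr_wpDl.
  move/cvgrPdist_le : Cm => /(_ _ e1); apply: filterS => t mt.
  apply: (le_trans (f_lip _ _)); do ?exact: trunc_cube.
  apply: (@le_trans _ _ (kf * (e / (kf + 1)))).
    by rewrite ler_wpM2l // (le_trans (trunc_lip _ _ _ _)).
  rewrite mulrCA ler_piMr ?(ltW e0) //.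
  by rewrite ler_pdivrMr ?ltr_wpDl // mul1r lerDl.
apply: cvgM; last exact: continuous_entry.
apply: cvgM; last exact: continuous_entry.
by rewrite /GRing.exp /=; apply: cvgM.
Qed.

Lemma continuous_mulmx (T : topologicalType) p q r (M : T -> 'M[R]_(p, q))
    (N : T -> 'M[R]_(q, r)) x :
  {for x, continuous M} -> {for x, continuous N} ->
  {for x, continuous (fun t => M t *m N t)}.
Proof.
move=> CM CN; apply: continuous_mxP => i j.
rewrite (_ : (fun _ => _) = fun t => \sum_k M t i k * N t k j).
  by apply: continuous_sumf => k _; apply: cvgM; exact: continuous_entry.
by apply/funext => t; rewrite mxE.
Qed.

Lemma continuous_trmx (T : topologicalType) p q (M : T -> 'M[R]_(p, q)) x :
  {for x, continuous M} -> {for x, continuous (fun t => (M t)^T)}.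
Proof.
move=> CM; apply: continuous_mxP => i j.
rewrite (_ : (fun _ => _) = fun t => M t j i); first exact: continuous_entry.
by apply/funext => t; rewrite mxE.
Qed.

Lemma C1R_cont (E : normedModType R) (u du : R -> E) : C1R u du -> continuous u.
Proof.
move=> [D _] t; apply: differentiable_continuous; apply/derivable1_diffP.
by case: (D t).
Qed.

(** A C^1 arc in the simplex times O(n), which lifts a piece of a path of
    weighted flags, or of a path in the top cell when [top] holds; only the
    former may start or end on the boundary. *)
Definition seg (top : bool) (c d : R) (m dm : R -> 'rV[R]_n)
    (V dV : R -> 'M[R]_n) :=
  [/\ c < d, C1R m dm, C1R V dV,
      forall t, c <= t <= d -> simplex R n (m t) /\ orthogonal_group R n (V t) &
      forall t, (if top then c <= t <= d else c < t < d) -> forall i, 0 < m t 0 i].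

Lemma seg_sigma_clamp top c d m dm V dV : seg top c d m dm V dV ->
  continuous (sigma m dm V dV \o clamp c d).
Proof.
move=> [cd Cm CV sp _] t.
have Ck : continuous (clamp c d).
  apply: (@continuous_clamp R R id c d (ltW cd)).
  by apply: continuous_subspaceT => x; exact: cvg_id.
have comp (T : topologicalType) (u : R -> T) : continuous u ->
    {for t, continuous (u \o clamp c d)}.
  by move=> Cu; apply: continuous_comp; [exact: Ck|exact: Cu].
apply: (@continuous_gnorm R (m \o clamp c d) (dm \o clamp c d)
  (fun t => (V (clamp c d t))^T *m dV (clamp c d t))).
- by move=> s; apply: simplex_cube; have [] := sp _ (clamp_in s (ltW cd)).
- exact/comp/(C1R_cont Cm).
- by apply: comp; case: Cm.
- apply: continuous_mulmx; first apply: continuous_trmx.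
    exact: (comp _ _ (C1R_cont CV)).
  by apply: (comp _ dV); case: CV.
Qed.

Lemma seg_primitive top c d m dm V dV : seg top c d m dm V dV ->
  exists P, primitive P c d (sigma m dm V dV).
Proof.
move=> S; apply: primitive_exists; first by case: S.
exact: seg_sigma_clamp S.
Qed.

Lemma is_derive_uniq (E : normedModType R) (u : R -> E) t l l' :
  is_derive t (1 : R) u l -> is_derive t (1 : R) u l' -> l = l'.
Proof. by move=> [_ <-] [_ <-]. Qed.

Lemma near_oo (P : R -> Prop) c t d : c < t -> t < d ->
  (forall s, c < s < d -> P s) -> \forall s \near t, P s.
Proof.
move=> ct td H; have tin : t \in `]c, d[ by rewrite in_itv /= ct td.
by apply: filterS (near_in_itvoo tin) => s; rewrite in_itv; exact: H.
Qed.

(** Differentiate [V^T V = 1]. *)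
Lemma orth_skew (V : R -> 'M[R]_n) dV t : is_derive t (1 : R) V dV ->
  (\forall s \near t, orthogonal_group R n (V s)) ->
  skew_matrices ((V t)^T *m dV).
Proof.
move=> /is_derive_mxP D nO; apply/matrixP => i j.
rewrite [LHS]mxE [in RHS]mxE.
pose h s := \sum_k V s k i * V s k j.
have Dh : is_derive t (1 : R) h (\sum_k (dV k i * V t k j + V t k i * dV k j)).
  by apply: is_derive_sumf => k _; exact: is_derive_mulf.
have D0 : is_derive t (1 : R) h 0.
  apply: near_eq_is_derive (is_derive_cst ((1%:M : 'M[R]_n) i j) t 1).
  apply: filterS nO => s oV; rewrite /h /cst -oV mxE.
  by apply: eq_bigr => k _; rewrite mxE.
have := is_derive_uniq Dh D0; rewrite big_split /= => /eqP.
rewrite addr_eq0 => /eqP e; rewrite !mxE.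
rewrite (eq_bigr (fun k => dV k i * V t k j)); last by move=> k _; rewrite mxE mulrC.
by rewrite e; congr (- _); apply: eq_bigr => k _; rewrite mxE.
Qed.

Lemma seg_skew top c d m dm V dV t : seg top c d m dm V dV -> c < t < d ->
  skew_matrices ((V t)^T *m dV t).
Proof.
move=> [cd _ [CV _] sp _] /andP[ct td]; apply: (orth_skew (CV t)).
apply: (near_oo ct td) => s csd; have [] // := sp s; lra.
Qed.

End Metric.

(** * Chains of arcs and lower bounds for their length *)

Section LowerBound.
Variables (R : realType) (n : nat) (f : 'rV[R]_n -> R) (kf : R).
Hypothesis n_gt0 : (0 < n)%N.
Hypothesis f_ge0 : forall mu, cube R n mu -> 0 <= f mu.
Hypothesis kf_ge0 : 0 <= kf.
Hypothesis f_lip : forall x y, cube R n x -> cube R n y ->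
  `|f x - f y| <= kf * `|x - y|.
Hypothesis f_eq0 : forall mu, cube R n mu -> (f mu = 0 <-> mu = 0).
Implicit Types (mu nu a : 'rV[R]_n) (B : 'M[R]_n).
Local Notation WF := (weighted_flag R n).
Local Notation sigma := (sigma f).

(** Consecutive arcs meet at a weighted flag, where their representatives may
    differ: at a boundary point a chain turns inside the blocks at no cost. *)
Inductive conn (top : bool) : R -> WF -> WF -> Prop :=
| conn_seg c d m dm V dV P p q : seg top c d m dm V dV ->
    primitive P c d (sigma m dm V dV) -> rep p (m c) (V c) -> rep q (m d) (V d) ->
    conn top (P d - P c) p q
| conn_cat L1 L2 p q r : conn top L1 p q -> conn top L2 q r ->
    conn top (L1 + L2) p r.

(** By compactness: the points of the cube with [l]-th coordinate at least [r]
    form a compact set that does not contain the only zero of [f]. *)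
Lemma f_lower_bound (r : R) (l : 'I_n) : 0 < r ->
  exists c, 0 < c /\ forall x, cube R n x -> r <= x 0 l -> c <= f x.
Proof.
move=> r0; pose A := [set x : 'rV[R]_n | forall i, `[(if i == l then r else 0), 1]%classic (x 0 i)].
have AE x : A x <-> cube R n x /\ r <= x 0 l.
  split=> [Ax|[cx rx] i].
    split=> [i|]; last by have := Ax l; rewrite /= in_itv /= eqxx => /andP[].
    have := Ax i; rewrite /= in_itv /=; case: eqP => [->|_ //] /andP[a ->].
    by rewrite andbT; exact: le_trans (ltW r0) a.
  rewrite /= in_itv /=; have /andP[a b] := cx i.
  by case: eqP => [->|_]; rewrite ?rx ?a ?b //; have /andP[] := cx l.
have cA : compact A.
  apply: (@rV_compact R n (fun i => `[(if i == l then r else 0), 1]%classic)) => i.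
  exact: segment_compact.
have [A0|A0] := pselect (A !=set0); last first.
  by exists 1; split=> // x cx rx; exfalso; apply: A0; exists x; apply/AE.
have fc : {within A, continuous f}.
  apply/subspace_continuousP => x /AE[cx _].
  apply/cvgrPdist_le => e e0; rewrite near_withinE.
  have e1 : 0 < e / (kf + 1) by rewrite divr_gt0 // ltr_wpDl.
  have : \forall y \near x, `|x - y| <= e / (kf + 1).
    by have /cvgrPdist_le/(_ _ e1) := @cvg_id _ (nbhs x).
  apply: filterS => y xy /AE[cy _]; apply: (le_trans (f_lip cx cy)).
  apply: (@le_trans _ _ (kf * (e / (kf + 1)))); first by rewrite ler_wpM2l.
  rewrite mulrCA ler_piMr ?(ltW e0) //.
  by rewrite ler_pdivrMr ?ltr_wpDl // mul1r lerDl.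
have [x + xmin] := EVT_min_rV A0 cA fc; rewrite inE => /AE[cx rx].
exists (f x); split=> [|y cy ry]; last by apply: xmin; rewrite inE; apply/AE.
rewrite lt_neqAle f_ge0 // andbT eq_sym; apply/eqP => /(f_eq0 cx) x0.
by move: rx; rewrite x0 mxE leNgt r0.
Qed.

Lemma bump_sq_le1 (r x : R) : 0 <= r -> x <= 1 -> bump_sq r x <= 1.
Proof.
move=> r0 x1; rewrite /bump_sq expr_le1 // ?le_max ?lexx // ge_max ler01.
by rewrite lerBlDr (le_trans x1) // lerDl.
Qed.

(** Each truncated weight in the gap is at most 1, and is zero unless the weight
    itself exceeds [r], in which case [f] of the truncation is at least [c_l]. *)
Lemma theta_gap (r : R) : 0 < r -> exists2 K, 0 <= K &
  forall mu (i j : 'I_n), cube R n mu -> (i < j)%N ->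
  0 <= theta r mu 0 i - theta r mu 0 j <= K * f (truncation mu i j).
Proof.
move=> r0; have [c cP] := choice (fun l => f_lower_bound l r0).
have c0 l : 0 < c l by have [] := cP l.
exists (\sum_l (c l)^-1).
  by apply: sumr_ge0 => l _; rewrite invr_ge0 ltW.
move=> mu i j cmu ij; rewrite thetaB ?(ltnW ij) //; apply/andP; split.
  by apply: sumr_ge0 => l _; exact: bump_sq_ge0.
have cT := trunc_cube i j cmu.
rewrite mulr_suml [leRHS](bigID (fun l : 'I_n => (i <= l < j)%N)) /= -[leLHS]addr0.
rewrite lerD //; last first.
  by apply: sumr_ge0 => l _; rewrite mulr_ge0 ?f_ge0 // invr_ge0 ltW.
apply: ler_sum => l lij; have [ml|ml] := ltP r (mu 0 l); last first.
  have -> : bump_sq r (mu 0 l) = 0; last by rewrite mulr_ge0 ?f_ge0 // invr_ge0 ltW.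
  by apply/eqP; rewrite eq_le bump_sq_ge0 andbT leNgt bump_sq_gt0 -leNgt.
have [_ m1] := andP (cmu l).
apply: le_trans (bump_sq_le1 (ltW r0) m1) _.
rewrite mulrC ler_pdivlMr // mul1r; have [_] := cP l; apply=> //.
by rewrite mxE lij ltW.
Qed.

Lemma is_derive_bump (r x : R) :
  is_derive x (1 : R) (bump_sq r) (2 * Num.max 0 (x - r)).
Proof.
apply/is_deriveP => e e0; exists e => // y ye; rewrite /bump_sq.
apply: (@le_trans _ _ (`|y - x| * `|y - x|)); last first.
  by rewrite ler_wpM2r // ltW.
rewrite -normrM (ger0_norm (_ : 0 <= (y - x) * (y - x))) -?expr2 ?sqr_ge0 //.
have -> : (y - x) *: (2 * Num.max 0 (x - r)) = (y - x) * (2 * Num.max 0 (x - r)) by [].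
rewrite (_ : y - x = (y - r) - (x - r)); last by ring.
move: (y - r) (x - r) => a b; rewrite ler_norml.
have := sqr_ge0 (a - b); have := sqr_ge0 a; have := sqr_ge0 b => ? ? ?.
case: (leP 0 a) => a0; case: (leP 0 b) => b0; apply/andP; split.
all: nra.
Qed.

Definition dtheta (r : R) mu a : 'rV[R]_n :=
  \row_i \sum_(l < n | (i <= l)%N) 2 * Num.max 0 (mu 0 l - r) * a 0 l.

Lemma is_derive_theta (r : R) (m : R -> 'rV[R]_n) dm t k :
  is_derive t (1 : R) m dm ->
  is_derive t (1 : R) (fun s => theta r (m s) 0 k) (dtheta r (m t) dm 0 k).
Proof.
move=> /is_derive_mxP D; rewrite mxE.
rewrite (_ : (fun _ => _) = fun s => \sum_(l < n | (k <= l)%N) bump_sq r (m s 0 l)).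
  apply: is_derive_sumf => l _.
  exact: (@is_derive1_comp _ (bump_sq r) (fun s => m s 0 l) t _ _ (is_derive_bump r _) (D 0 l)).
by apply/funext => s; rewrite mxE.
Qed.

Lemma dtheta_le (r : R) mu a (K : R) k : 0 <= r -> cube R n mu ->
  (forall l, `|a 0 l| <= K) -> `|dtheta r mu a 0 k| <= n%:R * (2 * K).
Proof.
move=> r0 cmu aK; rewrite mxE; apply: le_trans (ler_norm_sum _ _ _) _.
apply: (@le_trans _ _ (\sum_(l < n) 2 * K)); last first.
  by rewrite sumr_const card_ord [leRHS]mulr_natl.
rewrite [leRHS](bigID (fun l : 'I_n => (k <= l)%N)) /= -[leLHS]addr0 lerD //.
  apply: ler_sum => l _; rewrite !normrM (ger0_norm (ler0n _ 2)) -mulrA ler_wpM2l //.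
  have : `|Num.max 0 (mu 0 l - r)| <= 1.
    have /andP[_ m1] := cmu l.
    rewrite ger0_norm ?le_max ?lexx // ge_max ler01 /=; lra.
  move=> h; rewrite -[leRHS]mul1r; exact: ler_pM.
apply: sumr_ge0 => l _; rewrite mulr_ge0 //; exact: le_trans (aK l).
Qed.

Definition dflag (r : R) (mu a : 'rV[R]_n) (U dU : 'M[R]_n) x y : R :=
  \sum_k (dU x k * (theta r mu 0 k * U y k) +
    U x k * (dtheta r mu a 0 k * U y k + theta r mu 0 k * dU y k)).

Lemma flag_mxE (r : R) mu U x y :
  flag_mx r mu U x y = \sum_k U x k * (theta r mu 0 k * U y k).
Proof.
rewrite mxE; apply: eq_bigr => k _.
by rewrite mul_mx_diagE [U^T k y]mxE -mulrA.
Qed.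

Lemma is_derive_flag (r : R) m dm U dU (t : R) x y :
  is_derive t (1 : R) m dm -> is_derive t (1 : R) U dU ->
  is_derive t (1 : R) (fun s => flag_mx r (m s) (U s) x y) (dflag r (m t) dm (U t) dU x y).
Proof.
move=> Dm DU; have DUe := (is_derive_mxP _ _ _).1 DU.
rewrite (_ : (fun _ => _) =
  fun s => \sum_k U s x k * (theta r (m s) 0 k * U s y k)); last first.
  by apply/funext => s; rewrite flag_mxE.
apply: is_derive_sumf => k _; apply: is_derive_mulf => //.
by apply: is_derive_mulf => //; exact: is_derive_theta.
Qed.

(** With [V' = V B] and [B] skew, the entry [(x, y)] of the derivative of
    [V diag(theta) V^T] is the sum of [V_xj V_yk B_jk (theta_k - theta_j)] plus
    the terms with the derivative of [theta], which involve only the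
    derivatives of the weights. Entries of orthogonal matrices are at most 1. *)
Lemma dflag_le (r K s : R) mu a U dU x y : 0 <= r -> 0 <= K -> 0 <= s ->
  cube R n mu -> orthogonal_group R n U -> skew_matrices (U^T *m dU) ->
  (forall l, `|a 0 l| <= s) ->
  (forall i j : 'I_n, (i < j)%N ->
    `|(U^T *m dU) i j| * (theta r mu 0 i - theta r mu 0 j) <= K * s) ->
  (forall i j : 'I_n, (i < j)%N -> 0 <= theta r mu 0 i - theta r mu 0 j) ->
  `|dflag r mu a U dU x y| <= (n%:R * (n%:R * K) + n%:R * (n%:R * 2)) * s.
Proof.
move=> r0 K0 s0 cmu oU sk as_ Bs th0; set B := U^T *m dU in sk Bs.
have dUE : dU = U *m B by rewrite /B mulmxA orthT // mul1mx.
pose th (i : 'I_n) : R := theta r mu 0 i.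
have BE i j : B j i = - B i j.
  have skB : B^T = - B := sk.
  by have := congr1 (fun M : 'M[R]_n => M i j) skB; rewrite [LHS]mxE [RHS]mxE.
have -> : dflag r mu a U dU x y =
    \sum_k \sum_j U x j * U y k * (B j k * (th k - th j)) +
    \sum_k U x k * dtheta r mu a 0 k * U y k.
  rewrite /dflag.
  have -> : \sum_k (dU x k * (theta r mu 0 k * U y k) +
    U x k * (dtheta r mu a 0 k * U y k + theta r mu 0 k * dU y k)) =
    \sum_k dU x k * (th k * U y k) + \sum_k U x k * (th k * dU y k) +
    \sum_k U x k * dtheta r mu a 0 k * U y k.
    by rewrite -!big_split /=; apply: eq_bigr => k _; rewrite /th; ring.
  congr (_ + _); rewrite {1 2}dUE.
  have -> : \sum_k (U *m B) x k * (th k * U y k) =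
      \sum_k \sum_j U x j * U y k * (B j k * th k).
    by apply: eq_bigr => k _; rewrite mxE mulr_suml; apply: eq_bigr => j _; ring.
  have -> : \sum_k U x k * (th k * (U *m B) y k) =
      \sum_k \sum_j U x j * U y k * (- B j k * th j).
    rewrite exchange_big /=; apply: eq_bigr => k _.
    rewrite mxE !mulr_sumr; apply: eq_bigr => j _.
    by rewrite -BE; ring.
  rewrite -big_split /=; apply: eq_bigr => k _.
  by rewrite -big_split /=; apply: eq_bigr => j _; ring.
have Uij i j : `|U i j| <= 1 by exact: orth_le1.
rewrite mulrDl; apply: le_trans (ler_normD _ _) _; rewrite lerD //.
  apply: le_trans (ler_norm_sum _ _ _) _.
  apply: (@le_trans _ _ (\sum_(k < n) n%:R * (K * s))); last first.
    by rewrite sumr_const card_ord -[leLHS]mulr_natl !mulrA.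
  apply: ler_sum => k _; apply: le_trans (ler_norm_sum _ _ _) _.
  apply: (@le_trans _ _ (\sum_(j < n) (K * s))); last first.
    by rewrite sumr_const card_ord -[leLHS]mulr_natl.
  apply: ler_sum => j _; rewrite normrM.
  have UU : `|U x j * U y k| <= 1 by rewrite normrM mulr_ile1.
  have Bth : `|B j k * (th k - th j)| <= K * s.
    rewrite normrM; case: (ltngtP j k) => [jk|kj|/val_inj ->].
    - by rewrite distrC (ger0_norm (th0 _ _ jk)); exact: Bs.
    - by rewrite (ger0_norm (th0 _ _ kj)) BE normrN; exact: Bs.
    - by rewrite subrr normr0 mulr0 mulr_ge0.
  by rewrite -[leRHS]mul1r; exact: ler_pM.
apply: le_trans (ler_norm_sum _ _ _) _.
apply: (@le_trans _ _ (\sum_(k < n) n%:R * (2 * s))); last first.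
  by rewrite sumr_const card_ord -[leLHS]mulr_natl !mulrA.
apply: ler_sum => k _; rewrite !normrM mulrAC.
have dt := dtheta_le k r0 cmu as_.
rewrite -[leRHS]mul1r; apply: ler_pM => //; last by rewrite mulr_ile1.
Qed.

Lemma conn_ge0 top L p q : conn top L p q -> 0 <= L.
Proof.
elim=> [c d m dm V dV P {}p {}q [cd _ _ _ _] DP _ _|? ? ? ? ? _ ? _ ?].
  by apply: (primitive_ge0 (ltW cd) DP) => t; exact: gnorm_ge0.
exact: addr_ge0.
Qed.

(** The squared derivative of each weight is one of the terms of the metric. *)
Lemma conn_weight_le top L p q mu nu U V i : conn top L p q ->
  rep p mu U -> rep q nu V -> `|mu 0 i - nu 0 i| <= L.
Proof.
move=> C; elim: C mu nu U V => {p q L} [c d m dm V dV P p q S DP rp rq|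
    L1 L2 p q r _ IH1 _ IH2] mu nu U W rp' rq'.
  have [<- _] := rep_fun n_gt0 rp rp'; have [<- _] := rep_fun n_gt0 rq rq'.
  case: S => cd [Dm _] _ sp _; rewrite distrC -[leRHS]mul1r.
  apply: (primitive_abs_le (h := fun t => m t 0 i) (dh := fun t => dm t 0 i)
    (ltW cd) _ DP) => // [t _|t _].
    exact: ((is_derive_mxP _ _ _).1 (Dm t) 0 i).
  by rewrite mul1r; exact: gnorm_ge_a.
have [nu' [W' rq]] := rep_ex q.
apply: le_trans (ler_distD (nu' 0 i) _ _) _.
by rewrite lerD //; [exact: (IH1 _ _ _ _ rp' rq)|exact: (IH2 _ _ _ _ rq rq')].
Qed.

(** The bound by which two flags with the same weight are kept apart; [r] will be
    chosen below the positive entries of that weight. *)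
Lemma conn_flag_le (r : R) : 0 < r -> exists2 K, 0 <= K &
  forall top L p q mu nu U V x y, conn top L p q ->
  rep p mu U -> rep q nu V -> `|flag_mx r mu U x y - flag_mx r nu V x y| <= K * L.
Proof.
move=> r0; have [K K0 KP] := theta_gap r0.
pose K' := n%:R * (n%:R * K) + n%:R * (n%:R * 2); exists K'.
  by rewrite addr_ge0 // !mulr_ge0.
move=> top L p q mu nu U V x y C.
elim: C mu nu U V => {p q L} [c d m dm V dV P p q S DP rp rq|
    L1 L2 p q s _ IH1 _ IH2] mu nu U W rp' rq'.
  rewrite -(flag_mx_fun n_gt0 (ltW r0) rp rp') -(flag_mx_fun n_gt0 (ltW r0) rq rq').
  have sk := seg_skew S.
  case: S => cd [Dm _] [DV _] sp _; rewrite distrC.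
  apply: (primitive_abs_le (h := fun t => flag_mx r (m t) (V t) x y)
    (dh := fun t => dflag r (m t) (dm t) (V t) (dV t) x y)
    (ltW cd) _ DP) => // [|t _|t tcd].
  - by rewrite addr_ge0 // !mulr_ge0.
  - exact: is_derive_flag.
  have [|sm oV] := sp t; first by lra.
  have cm := simplex_cube sm.
  apply: dflag_le => //; first exact: ltW.
  - exact: gnorm_ge0.
  - exact: sk.
  - by move=> l; exact: gnorm_ge_a.
  - move=> i j ij; have /andP[a b] := KP _ i j cm ij.
    apply: (@le_trans _ _ (`|((V t)^T *m dV t) i j| * (K * f (truncation (m t) i j)))).
      by rewrite ler_wpM2l.
    rewrite mulrCA ler_wpM2l //.
    have := gnorm_ge_B f (m t) (dm t) ((V t)^T *m dV t) ij.
    by rewrite normrM (ger0_norm (f_ge0 (trunc_cube _ _ cm))) mulrC.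
  - by move=> i j /(KP _ i j cm)/andP[].
have [nu' [W' rq]] := rep_ex q.
apply: le_trans (ler_distD (flag_mx r nu' W' x y) _ _) _; rewrite mulrDr.
by rewrite lerD //; [exact: (IH1 _ _ _ _ rp' rq)|exact: (IH2 _ _ _ _ rq rq')].
Qed.
End LowerBound.

(** * Cayley curves in the orthogonal group *)

Section Signs.
Variable R : realType.

(** The determinant of [M + diag d] is affine in [d_0], with slope the
    determinant of the same kind of matrix in size [n - 1]. If the latter is
    nonzero, the values at [d_0 = 1] and [d_0 = -1] differ, hence are not both
    zero. *)
Lemma sign_shift n (M : 'M[R]_n) : exists d : 'rV[R]_n,
  (forall i, d 0 i ^+ 2 = 1) /\ \det (M + diag_mx d) != 0.
Proof.
elim: n M => [|n IH] M.
  by exists 0; split=> [[]//|]; rewrite det_mx00 oner_neq0.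
have [d' [d'1 dne]] := IH (row' 0 (col' 0 M)).
(* d s prescribes the sign s at index 0 and the signs d' elsewhere. *)
pose d s : 'rV[R]_n.+1 := \row_i oapp (fun j => d' 0 j) s (unlift ord0 i).
pose X s := M + diag_mx (d s).
have d1 s : s ^+ 2 = 1 -> forall i, d s 0 i ^+ 2 = 1.
  by move=> s1 i; rewrite mxE; case: unliftP => [j _|_] //=; exact: d'1.
have minor s : row' 0 (col' 0 (X s)) = row' 0 (col' 0 M) + diag_mx d'.
  apply/matrixP => i j; rewrite !mxE liftK /= (inj_eq lift_inj).
  by [].
have cof s j : cofactor (X s) 0 j = cofactor (X 1) 0 j.
  rewrite /cofactor; congr (_ * \det _); apply/matrixP => i k.
  by rewrite !mxE liftK.
have detE : \det (X 1) - \det (X (-1)) = 2 * \det (row' 0 (col' 0 M) + diag_mx d').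
  rewrite (expand_det_row (X 1) 0) (expand_det_row (X (-1)) 0).
  rewrite !big_ord_recl !cof [X in _ + X - _](_ : _ =
    \sum_(i < n) X (-1) 0 (lift ord0 i) * cofactor (X (-1)) 0 (lift ord0 i)).
    rewrite opprD addrACA subrr addr0 -mulrBl /cofactor /= expr0 mul1r minor.
    congr (_ * _); rewrite !mxE unlift_none /= ?eqxx ?mulr1n.
    by ring.
  by apply: eq_bigr => i _; rewrite cof; congr (_ * _); rewrite !mxE /= !mulr0n.
have [e|ne] := eqVneq (\det (X 1)) 0; last by exists (d 1); split=> //; exact/d1/expr1n.
exists (d (-1)); split; first by apply: d1; rewrite sqrrN expr1n.
apply: contra dne => /eqP e'; move: detE; rewrite e e' subrr => /esym/eqP.
by rewrite mulf_eq0 pnatr_eq0.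
Qed.
End Signs.

Section Cayley.
Variables (R : realType) (n : nat).
Implicit Types (A Q U : 'M[R]_n).

Definition sqn p (x : 'rV[R]_p) := (x *m x^T) 0 0.

Lemma sqnE p (x : 'rV[R]_p) : sqn x = \sum_i x 0 i ^+ 2.
Proof. by rewrite /sqn mxE; apply: eq_bigr => i _; rewrite mxE expr2. Qed.

Lemma sqn_ge0 p (x : 'rV[R]_p) : 0 <= sqn x.
Proof. by rewrite sqnE sumr_ge0 // => i _; exact: sqr_ge0. Qed.

Lemma sqn_eq0 p (x : 'rV[R]_p) : sqn x = 0 -> x = 0.
Proof.
rewrite sqnE => /eqP; rewrite psumr_eq0 => [/allP h|i _]; last exact: sqr_ge0.
apply/rowP => i; have := h i; rewrite mem_index_enum => /(_ isT).
by rewrite sqrf_eq0 mxE => /eqP.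
Qed.

Lemma skew_form0 A (x : 'rV[R]_n) : A^T = - A -> x *m A *m x^T = 0.
Proof.
move=> sk; have e : (x *m A *m x^T)^T = - (x *m A *m x^T).
  by rewrite !trmx_mul trmxK sk mulNmx mulmxN mulmxA.
move: (x *m A *m x^T) e => M e; apply/matrixP => i j; rewrite !ord1 [RHS]mxE.
have := congr1 (fun N : 'M[R]_1 => N 0 0) e; rewrite [LHS]mxE [RHS]mxE; lra.
Qed.

(** For skew [A] the vectors [x] and [x A] are orthogonal. *)
Lemma sqn_resolvent A (t : R) (x : 'rV[R]_n) : A^T = - A ->
  sqn (x *m (1%:M - t *: A)) = sqn x + t ^+ 2 * sqn (x *m A).
Proof.
move=> sk; have -> : x *m (1%:M - t *: A) = x - t *: (x *m A).
  by rewrite mulmxBr mulmx1 scalemxAr.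
have xy : x *m (x *m A)^T = 0.
  by rewrite trmx_mul sk mulNmx mulmxN mulmxA skew_form0 // oppr0.
have yx : x *m A *m x^T = 0 by exact: skew_form0.
rewrite /sqn; move: (x *m A) xy yx => y xy yx.
rewrite (_ : (x - t *: y)^T = x^T - t *: y^T); last by apply/matrixP => i j; rewrite !mxE.
rewrite mulmxBl !mulmxBr -!scalemxAl -!scalemxAr xy yx.
by rewrite !scaler0 subr0 sub0r opprK scalerA -expr2 [LHS]mxE [X in _ + X]mxE.
Qed.

Lemma row_unitmx (M : 'M[R]_n) : (forall x : 'rV[R]_n, x *m M = 0 -> x = 0) -> M \in unitmx.
Proof.
move=> h; rewrite -row_free_unit -kermx_eq0; apply/rowV0P => v /sub_kermxP.
exact: h.
Qed.

Lemma resolvent_unit A t : A^T = - A -> 1%:M - t *: A \in unitmx.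
Proof.
move=> sk; apply: row_unitmx => x e; apply: sqn_eq0.
have := sqn_resolvent t x sk; rewrite e /sqn mul0mx mxE => /esym/eqP.
rewrite paddr_eq0 ?sqn_ge0 //; last by rewrite mulr_ge0 ?sqr_ge0 ?sqn_ge0.
by move=> /andP[/eqP].
Qed.

(** Parametrized by [(1 - t A)^-1], so that it exists for all real [t] when [A] is
    skew. *)
Definition resolvent A (t : R) := invmx (1%:M - t *: A).

(** By [sqn_resolvent], the resolvent contracts the euclidean norm, so
    its rows have length at most 1. *)
Lemma resolvent_norm A t : A^T = - A -> `|resolvent A t| <= 1.
Proof.
move=> sk; apply/mx_norm_leP => // i j.
pose x := row i (resolvent A t).
have := sqn_resolvent t x sk.
rewrite -row_mul mulVmx ?resolvent_unit // => e.
have x1 : sqn x <= 1.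
  have -> : 1 = sqn (row i (1%:M : 'M[R]_n)).
    rewrite sqnE (bigD1 i) //= big1 ?addr0 => [|k ki].
      by rewrite !mxE eqxx expr1n.
    by rewrite !mxE eq_sym (negbTE ki) expr0n.
  by rewrite e lerDl mulr_ge0 ?sqr_ge0 ?sqn_ge0.
rewrite -(@expr_le1 _ 2) // real_normK ?num_real //; apply: le_trans x1.
rewrite sqnE (bigD1 j) //= mxE lerDl sumr_ge0 // => k _; exact: sqr_ge0.
Qed.

(** The resolvent identity; used twice, it yields the derivative of the
    resolvent with a quadratic error. *)
Lemma resolventB A s t : A^T = - A ->
  resolvent A s - resolvent A t = (s - t) *: (resolvent A s *m A *m resolvent A t).
Proof.
move=> sk; have us := resolvent_unit s sk; have ut := resolvent_unit t sk.
apply: (can_inj (mulKmx us)); apply: (can_inj (mulmxK ut)).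
have MX : (1%:M - s *: A) *m resolvent A s = 1%:M by rewrite mulmxV.
have YN : resolvent A t *m (1%:M - t *: A) = 1%:M by rewrite mulVmx.
have : (1%:M - t *: A) - (1%:M - s *: A) = (s - t) *: A.
  by rewrite opprB addrC addrA subrK scalerBl.
move: MX YN; move: (1%:M - s *: A) (1%:M - t *: A) => M N MX YN NM.
rewrite mulmxBr mulmxBl MX mul1mx -(mulmxA M) YN mulmx1 NM.
by rewrite -scalemxAr -scalemxAl !mulmxA MX mul1mx -(mulmxA A) YN mulmx1.
Qed.

Lemma resolventT A t : A^T = - A -> (resolvent A t)^T = resolvent A (- t).
Proof.
by move=> sk; rewrite /resolvent trmx_inv linearB /= linearZ /= trmx1 sk scalerN scaleNr.
Qed.

(** This is [(1 + t A) (1 - t A)^-1], written so that its derivative is read off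
    from that of the resolvent. *)
Definition cayley A t := 2 *: resolvent A t - 1%:M.

Lemma cayley0 A : cayley A 0 = 1%:M.
Proof.
rewrite /cayley /resolvent scale0r subr0 invmx1 -{2}[1%:M]scale1r -scalerBl.
by rewrite (_ : 2 - 1 = 1) ?scale1r //; ring.
Qed.

Lemma resolventM A t : A^T = - A ->
  (1%:M - t *: A) *m resolvent A t = 1%:M.
Proof. by move=> sk; rewrite mulmxV // resolvent_unit. Qed.

Lemma resolventMT A t : A^T = - A ->
  (1%:M - t *: A)^T + (1%:M - t *: A) = 2%:M.
Proof.
move=> sk; rewrite (_ : (1%:M - t *: A)^T = 1%:M - t *: A^T); last first.
  by rewrite raddfB /= trmx1 linearZ.
rewrite sk scalerN opprK addrACA subrr addr0.
by rewrite -raddfD.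
Qed.

Lemma cayleyE A t : A^T = - A ->
  cayley A t = (1%:M - t *: A)^T *m resolvent A t.
Proof.
move=> sk; have := resolventMT t sk => /(canRL (addrK _)) ->.
by rewrite mulmxBl resolventM // mul_scalar_mx.
Qed.

Lemma cayley_orth A t : A^T = - A -> orthogonal_group R n (cayley A t).
Proof.
move=> sk; rewrite /orthogonal_group /= cayleyE //.
set M := 1%:M - t *: A; rewrite trmx_mul trmxK.
have MM : M *m M^T = M^T *m M.
  have -> : M^T = 2%:M - M by rewrite -(resolventMT t sk) addrK.
  by move: M => M; rewrite mulmxBr mulmxBl scalar_mxC.
rewrite mulmxA -(mulmxA _ M) MM -!mulmxA (resolventM t sk) mulmx1.
by rewrite -trmx_mul (resolventM t sk) trmx1.
Qed.

(** The logarithmic derivative [C^T C'] of the Cayley curve. It is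
    block-diagonal if [A] is, and of the size of [A]. *)
Lemma cayley_dlog A t : A^T = - A ->
  (cayley A t)^T *m (2 *: (resolvent A t *m A *m resolvent A t)) =
  2 *: ((resolvent A t)^T *m A *m resolvent A t).
Proof.
move=> sk; rewrite cayleyE // trmx_mul trmxK -scalemxAr; congr (_ *: _).
by rewrite -!mulmxA (mulmxA (1%:M - _)) (resolventM t sk) mul1mx.
Qed.

Lemma resolvent_quad_norm A t s : A^T = - A ->
  `|resolvent A t *m A *m resolvent A s| <= n%:R ^+ 2 * `|A|.
Proof.
move=> sk; apply: le_trans (mulmx_norm_le _ _) _.
have h1 : `|resolvent A t *m A| <= n%:R * `|A|.
  apply: le_trans (mulmx_norm_le _ _) _; rewrite -mulrA ler_wpM2l //.
  by rewrite ler_piMl // resolvent_norm.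
apply: (@le_trans _ _ (n%:R * (n%:R * `|A|) * 1)); last by rewrite mulr1 mulrA.
by rewrite ler_pM ?mulr_ge0 // ?resolvent_norm // ler_wpM2l.
Qed.

Lemma C1R_cayley U A : A^T = - A ->
  C1R (fun t => U *m cayley A t)
      (fun t => U *m (2 *: (resolvent A t *m A *m resolvent A t))).
Proof.
move=> sk.
have DR t : is_derive t (1 : R) (resolvent A) (resolvent A t *m A *m resolvent A t).
  apply/is_deriveP => e e0.
  pose C := n%:R * (n%:R * (n%:R ^+ 2 * `|A|) * `|A|) * 1 + 1.
  have C0 : 0 < C by rewrite ltr_wpDl // !mulr_ge0.
  exists (e / C) => [|s st]; first exact: divr_gt0.
  rewrite resolventB // -scalerBr -mulmxBl -mulmxBl resolventB //.
  rewrite -!scalemxAl scalerA normrZ normrM.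
  apply: (@le_trans _ _ (`|s - t| * `|s - t| * C)).
    rewrite ler_wpM2l ?mulr_ge0 // /C; apply: ler_wpDr => //.
    apply: le_trans (mulmx_norm_le _ _) _; apply: ler_pM; rewrite ?mulr_ge0 ?resolvent_norm //.
    rewrite ler_wpM2l //; apply: le_trans (mulmx_norm_le _ _) _.
    by rewrite ler_wpM2r // ler_wpM2l // resolvent_quad_norm.
  by rewrite mulrC mulrA ler_wpM2r // mulrC -ler_pdivlMr // ltW.
have CR : continuous (resolvent A).
  move=> t; apply: differentiable_continuous; apply/derivable1_diffP.
  by case: (DR t).
split=> [t|t]; last first.
  have C1 : {for t, continuous (fun s => resolvent A s *m A)}.
    by apply: (@continuous_mulmx R R n n n _ (fun=> A)); [exact: CR|exact: cvg_cst].
  have C2 : {for t, continuous (fun s => resolvent A s *m A *m resolvent A s)}.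
    exact: (continuous_mulmx C1 (CR t)).
  apply: (@continuous_mulmx R R n n n (fun=> U) (fun s =>
    2 *: (resolvent A s *m A *m resolvent A s))); first exact: cvg_cst.
  by apply: cvgZr.
apply/is_deriveP => e e0; pose C := n%:R * `|U| * 2 + 1.
have C0 : 0 < C by rewrite ltr_wpDl // !mulr_ge0.
have /is_deriveP/(_ (e / C))[] := DR t; first exact: divr_gt0.
move=> r r0 H; exists r => // s /H {}H.
have -> : U *m cayley A s - U *m cayley A t -
    (s - t) *: (U *m (2 *: (resolvent A t *m A *m resolvent A t))) =
  U *m (2 *: (resolvent A s - resolvent A t - (s - t) *: (resolvent A t *m A *m resolvent A t))).
  rewrite scalemxAr -!mulmxBr /cayley; congr (U *m _).
  move: (resolvent A t *m A *m resolvent A t) (resolvent A s) (resolvent A t) => X P S.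
  by apply/matrixP => i j; rewrite !mxE; ring.
apply: le_trans (mulmx_norm_le _ _) _; rewrite normrZ ger0_norm // mulrA.
apply: (@le_trans _ _ (C * (e / C * `|s - t|))); last first.
  by rewrite mulrA mulrCA divff ?mulr1 ?gt_eqF.
by apply: ler_pM; rewrite ?mulr_ge0 // /C lerDl.
Qed.

(** The inverse Cayley transform, with value [Q] at time 1. *)
Lemma cayley_param Q : orthogonal_group R n Q -> Q + 1%:M \in unitmx ->
  exists2 A, A^T = - A /\ Q = cayley A 1 & A = (Q - 1%:M) *m invmx (Q + 1%:M).
Proof.
move=> oQ uQ; set I := invmx (Q + 1%:M); exists ((Q - 1%:M) *m I) => //.
have oQ' : Q^T *m Q = 1%:M := oQ.
have AQ : (Q - 1%:M) *m I *m (Q + 1%:M) = Q - 1%:M.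
  by rewrite -mulmxA mulVmx // mulmx1.
have IQ : I *m (Q + 1%:M) = 1%:M by rewrite mulVmx.
have uI : I \in unitmx by rewrite unitmx_inv.
move: ((Q - 1%:M) *m I) AQ => A AQ; have sk : A^T = - A.
  have uT : (Q + 1%:M)^T \in unitmx by rewrite unitmx_tr.
  apply: (can_inj (mulmxK uQ)); apply: (can_inj (mulKmx uT)).
  have QT : (Q + 1%:M)^T = Q^T + 1%:M by rewrite [LHS]raddfD /= trmx1.
  have QT' : (Q - 1%:M)^T = Q^T - 1%:M by rewrite [LHS]raddfB /= trmx1.
  rewrite mulmxA -trmx_mul AQ mulNmx AQ QT QT'.
  rewrite mulmxBl mul1mx mulmxDr oQ' mulmx1 mulmxN mulmxDl mul1mx mulmxBr oQ' mulmx1.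
  by move: Q^T => X; apply/matrixP => i j; rewrite !mxE; ring.
split=> //; rewrite /cayley /resolvent scale1r.
have -> : 1%:M - A = 2 *: I.
  apply: (can_inj (mulmxK uQ)); rewrite mulmxBl mul1mx AQ -scalemxAl IQ.
  by apply/matrixP => i j; rewrite !mxE; ring.
have u2 : 2 *: I \in unitmx by rewrite unitmxZ // unitfE pnatr_eq0.
apply/esym/eqP; rewrite subr_eq; apply/eqP/(can_inj (mulKmx u2)).
by rewrite -scalemxAr mulmxV // -scalemxAl IQ.
Qed.
End Cayley.

(** * Reversing chains, straight segments and rotations *)

Section ChainOperations.
Variables (R : realType) (n : nat) (f : 'rV[R]_n -> R) (kf : R).
Hypothesis n_gt0 : (0 < n)%N.
Hypothesis f_ge0 : forall mu, cube R n mu -> 0 <= f mu.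
Hypothesis kf_ge0 : 0 <= kf.
Hypothesis f_lip : forall x y, cube R n x -> cube R n y ->
  `|f x - f y| <= kf * `|x - y|.
Hypothesis f_eq0 : forall mu, cube R n mu -> (f mu = 0 <-> mu = 0).
Local Notation WF := (weighted_flag R n).

(** Lengths do not depend on affine changes of the parameter, in either
    direction. *)
Lemma gnorm_scale mu a B (k : R) :
  gnorm f mu (k *: a) (k *: B) = `|k| * gnorm f mu a B.
Proof.
rewrite /gnorm -sqrtr_sqr -sqrtrM ?sqr_ge0 // !metric_gE mulrDr; congr (Num.sqrt (_ + _)).
  by rewrite mulr_sumr; apply: eq_bigr => i _; rewrite mxE exprMn.
rewrite mulr_sumr; apply: eq_bigr => i _; rewrite mulr_sumr; apply: eq_bigr => j _.
by rewrite mxE mulrCA exprMn.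
Qed.

Section Affine.
Variables (c d : R) (m dm : R -> 'rV[R]_n) (V dV : R -> 'M[R]_n) (a b : R).
Local Notation phi t := (a * t + b).

Lemma sigma_affine t :
  sigma f (fun t => m (phi t)) (fun t => a *: dm (phi t))
          (fun t => V (phi t)) (fun t => a *: dV (phi t)) t =
  `|a| * sigma f m dm V dV (phi t).
Proof. by rewrite /sigma -scalemxAr gnorm_scale. Qed.

Lemma seg_affine top c' d' : c' < d' ->
  (forall t, c' <= t <= d' -> c <= phi t <= d) ->
  (forall t, c' < t < d' -> c < phi t < d) ->
  seg top c d m dm V dV ->
  seg top c' d' (fun t => m (phi t)) (fun t => a *: dm (phi t))
                (fun t => V (phi t)) (fun t => a *: dV (phi t)).
Proof.
move=> cd' h1 h2 [cd Cm CV sp pos]; split=> //.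
- exact: C1R_affine.
- exact: C1R_affine.
- by move=> t /h1; exact: sp.
- move=> t tcd i; apply: pos; case: top tcd => tcd; [exact: h1|exact: h2].
Qed.

Lemma primitive_affine P s c' d' (k : R) :
  (forall t, c' <= t <= d' -> c <= phi t <= d) ->
  primitive P c d s ->
  primitive (fun t => k * P (phi t)) c' d' (fun t => k * a * s (phi t)).
Proof.
move=> h1 DP t /h1 tcd.
have Dphi : is_derive t (1 : R) (fun t => phi t) a.
  have := is_deriveD (is_derive_mulf (is_derive_cst a t 1) (is_derive_id t 1))
    (is_derive_cst b t 1).
  by rewrite mul0r add0r mulr1 addr0.
have DPphi := is_derive1_comp (g := fun t => phi t) (DP _ tcd) Dphi.
have := is_derive_mulf (is_derive_cst k t 1) DPphi.
by rewrite mul0r add0r /cst mulrAC -mulrA [_ * a]mulrC.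
Qed.
End Affine.

Lemma conn_weaken top L p q : conn f top L p q -> conn f false L p q.
Proof.
elim=> [c d m dm V dV P {}p {}q [cd Cm CV sp pos] DP rp rq|]; last first.
  by move=> *; apply: conn_cat; eassumption.
apply: (@conn_seg _ _ _ _ c d m dm V dV P) => //; split=> // t tcd i.
by apply: pos; case: top => //; move: tcd; lra.
Qed.

Lemma conn_seg_eq top c d m dm V dV P p q L : seg top c d m dm V dV ->
    primitive P c d (sigma f m dm V dV) -> rep p (m c) (V c) -> rep q (m d) (V d) ->
    L = P d - P c -> conn f top L p q.
Proof. by move=> S DP rp rq ->; exact: conn_seg S DP rp rq. Qed.

Lemma conn_sym top L p q : conn f top L p q -> conn f top L q p.
Proof.
elim=> [c d m dm V dV P {}p {}q S DP rp rq|L1 L2 ? ? ? _ ? _ ?]; last first.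
  by rewrite addrC; apply: conn_cat; eassumption.
have cd : c < d by case: S.
have h1 t : c <= t <= d -> c <= -1 * t + (c + d) <= d by lra.
have h2 t : c < t < d -> c < -1 * t + (c + d) < d by lra.
have ec : -1 * c + (c + d) = d by ring.
have ed : -1 * d + (c + d) = c by ring.
apply: (conn_seg_eq (seg_affine cd h1 h2 S)
  (P := fun t => -1 * P (-1 * t + (c + d)))); rewrite ?ec ?ed //; last by ring.
move=> t tcd; rewrite sigma_affine.
have := primitive_affine (-1) h1 DP tcd.
by rewrite normrN normr1 mulN1r opprK.
Qed.

Lemma C1R_cst (E : normedModType R) (x : E) : C1R (fun=> x) (fun=> 0).
Proof. by split=> t; [exact: is_derive_cst|exact: cvg_cst]. Qed.

Lemma C1R_line (E : normedModType R) (x y : E) :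
  C1R (fun t : R => (1 - t) *: x + t *: y) (fun=> y - x).
Proof.
split=> t; last exact: cvg_cst.
apply/is_deriveP => e e0; exists 1 => // s _.
have E1 (r : R) : (1 - r) *: x + r *: y = x + r *: (y - x).
  by rewrite scalerBl scale1r scalerBr -addrA [- _ + _]addrC.
rewrite !E1 opprD addrACA subrr add0r -scalerBl subrr normr0.
by rewrite mulr_ge0 // ltW.
Qed.

Definition bary : 'rV[R]_n := const_mx n%:R^-1.
(** Pulling towards the barycentre makes all weights positive, and changes them
    by at most [e]. *)
Definition pull (e : R) mu : 'rV[R]_n := (1 - e) *: mu + e *: bary.

Lemma simplex_conv mu nu (t : R) : simplex R n mu -> simplex R n nu ->
  0 <= t <= 1 -> simplex R n ((1 - t) *: mu + t *: nu).
Proof.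
move=> [cm sm] [cn sn] t01; split=> [i|]; last first.
  rewrite /= (eq_bigr (fun i => (1 - t) * mu 0 i + t * nu 0 i)) => [|i _].
    by rewrite big_split /= -!mulr_sumr sm sn; ring.
  by rewrite !mxE.
rewrite !mxE; have /andP[a b] := cm i; have /andP[a' b'] := cn i.
by case/andP: t01 => t0 t1; apply/andP; split; nra.
Qed.

Lemma bary_gt0 i : 0 < bary 0 i.
Proof. by rewrite mxE invr_gt0 ltr0n. Qed.

Lemma simplex_bary : simplex R n bary.
Proof.
split=> [i|]; last first.
  rewrite /= (eq_bigr (fun=> n%:R^-1)) => [|i _]; last by rewrite mxE.
  by rewrite sumr_const card_ord -[LHS]mulr_natl divff // pnatr_eq0 -lt0n.
rewrite ltW ?bary_gt0 //= mxE invf_le1 ?ltr0n // ler1n //.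
Qed.

Lemma simplex_pull e mu : simplex R n mu -> 0 <= e <= 1 -> simplex R n (pull e mu).
Proof. by move=> sm e01; apply: simplex_conv => //; exact: simplex_bary. Qed.

Lemma pull_gt0 e mu i : simplex R n mu -> 0 < e <= 1 -> 0 < pull e mu 0 i.
Proof.
move=> [cm _] /andP[e0 e1]; rewrite !mxE; have /andP[a _] := cm i.
have := bary_gt0 i; rewrite mxE => b.
by rewrite ltr_wpDl ?mulr_gt0 // mulr_ge0 // subr_ge0.
Qed.

Lemma cube_dist mu nu : cube R n mu -> cube R n nu -> `|mu - nu| <= 1.
Proof.
move=> cm cn; apply/mx_norm_leP => // i j; rewrite (ord1 i) !mxE ler_norml.
by have /andP[a b] := cm j; have /andP[a' b'] := cn j; apply/andP; split; lra.
Qed.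

Lemma pull_dist e mu : simplex R n mu -> 0 <= e -> `|pull e mu - mu| <= e.
Proof.
move=> sm e0; have -> : pull e mu - mu = e *: (bary - mu).
  by rewrite /pull; apply/rowP => i; rewrite !mxE; ring.
rewrite normrZ ger0_norm // ler_piMr //.
by apply: cube_dist; apply: simplex_cube => //; exact: simplex_bary.
Qed.

(** Move the weights along a segment with a fixed frame. Positivity of [nu]
    alone already keeps the segment inside the open simplex, except perhaps at
    its start. *)
Lemma conn_straight (top : bool) mu nu U p q : simplex R n mu -> simplex R n nu ->
  orthogonal_group R n U -> (forall i, 0 < nu 0 i) ->
  (top -> forall i, 0 < mu 0 i) -> rep p mu U -> rep q nu U ->
  exists L, conn f top L p q /\ L <= n%:R * `|nu - mu|.
Proof.
move=> sm sn oU pn pm rp rq.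
pose m t : 'rV[R]_n := (1 - t) *: mu + t *: nu.
have S : seg top 0 1 m (fun=> nu - mu) (fun=> U) (fun=> 0).
  split; [exact: ltr01|exact: C1R_line|exact: C1R_cst| |].
    by move=> t t01; split=> //; exact: simplex_conv.
  move=> t tt i; rewrite !mxE; have /andP[a _] := sm.1 i.
  have b := pn i; case: top pm tt => [/(_ isT i) c|_] /andP[t0 t1].
    have [->|t_ne0] := eqVneq t 0; first by rewrite subr0 mul1r mul0r addr0.
    by rewrite ltr_wpDl ?mulr_gt0 ?mulr_ge0 ?subr_ge0 // lt_neqAle eq_sym t_ne0.
  by rewrite ltr_wpDl ?mulr_gt0 ?mulr_ge0 ?subr_ge0 // ltW.
have [P DP] := seg_primitive kf_ge0 f_lip S.
exists (P 1 - P 0); split.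
  apply: (conn_seg S DP); rewrite /m ?subr0 ?subrr ?scale1r ?scale0r ?addr0 ?add0r //.
have := @primitive_bound _ P 0 1 _ (n%:R * `|nu - mu|) ler01 DP.
rewrite subr0 mulr1; apply=> t _; rewrite -[`|nu - mu|]addr0; apply: gnorm_le => //.
  by move=> i; exact: mx_entry_le.
by move=> i j _; rewrite mulmx0 mxE mulr0 normr0.
Qed.

Lemma f_le x : cube R n x -> f x <= kf.
Proof.
move=> cx; have c0 : cube R n 0 by move=> i; rewrite mxE lexx ler01.
have f0 : f 0 = 0 by apply/f_eq0.
have := f_lip cx c0; rewrite f0 subr0 (ger0_norm (f_ge0 cx)) => /le_trans; apply.
by rewrite ler_piMr // cube_dist.
Qed.

(** Rotate the frame along a Cayley curve with fixed weights. *)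
Lemma conn_rot top mu U A (k : R) p q : simplex R n mu -> (forall i, 0 < mu 0 i) ->
  orthogonal_group R n U -> A^T = - A -> 0 <= k ->
  (forall t (i j : 'I_n), (i < j)%N ->
    f (truncation mu i j) *
    `|(2 *: ((resolvent A t)^T *m A *m resolvent A t)) i j| <= k) ->
  rep p mu U -> rep q mu (U *m cayley A 1) ->
  exists L, conn f top L p q /\ L <= n%:R * k.
Proof.
move=> sm pm oU sk k0 H rp rq.
have S : seg top 0 1 (fun=> mu) (fun=> 0) (fun t => U *m cayley A t)
    (fun t => U *m (2 *: (resolvent A t *m A *m resolvent A t))).
  split; [exact: ltr01|exact: C1R_cst|exact: C1R_cayley| |by []].
  by move=> t _; split=> //; apply: orthM => //; exact: cayley_orth.
have [P DP] := seg_primitive kf_ge0 f_lip S.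
exists (P 1 - P 0); split.
  by apply: (conn_seg S DP); rewrite ?cayley0 ?mulmx1.
have := @primitive_bound _ P 0 1 _ (n%:R * k) ler01 DP.
rewrite subr0 mulr1; apply=> t _; rewrite -[k]add0r; apply: gnorm_le => //.
  by move=> i; rewrite mxE normr0.
move=> i j ij; have UU X : (U *m cayley A t)^T *m (U *m X) = (cayley A t)^T *m X.
  by rewrite trmx_mul mulmxA -(mulmxA _ U^T) (oU : U^T *m U = 1%:M) mulmx1.
rewrite UU cayley_dlog // normrM ger0_norm; first exact: H.
exact/f_ge0/trunc_cube/simplex_cube.
Qed.

Lemma resolvent_norm2 (A : 'M[R]_n) t i j : A^T = - A ->
  `|(2 *: ((resolvent A t)^T *m A *m resolvent A t)) i j| <= 2 * (n%:R ^+ 2 * `|A|).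
Proof.
move=> sk; apply: le_trans (mx_entry_le _ _ _) _.
by rewrite normrZ ger0_norm // ler_wpM2l // resolventT // resolvent_quad_norm.
Qed.

Lemma blocky_diag (mu d : 'rV[R]_n) : blocky mu (diag_mx d).
Proof.
move=> s t w; rewrite mxE; case: eqP => // st.
by move: w; rewrite st wallxx.
Qed.

(** The cost of a rotation by a matrix that is block-diagonal for [mu0], made at
    another weight [mu]: the skew matrix of the Cayley curve is also
    block-diagonal for [mu0], so only the coefficients [f(mu_{i->j}) <= k] of
    directions inside the blocks of [mu0] matter, and [C] depends on [Q] alone. *)
Lemma conn_rotQ mu0 Q : orthogonal_group R n Q -> blocky mu0 Q ->
  exists2 C, 0 <= C & forall (top : bool) mu (k : R) U p q,
    simplex R n mu -> (forall i, 0 < mu 0 i) -> 0 <= k ->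
    (forall i j : 'I_n, (i < j)%N -> ~~ wall mu0 i j -> f (truncation mu i j) <= k) ->
    rep p mu U -> rep q mu (U *m Q) ->
    exists L, conn f top L p q /\ L <= C * k.
Proof.
move=> oQ bQ; have [d [d1 ne]] := sign_shift Q.
have DD : diag_mx d *m diag_mx d = 1%:M.
  rewrite mulmx_diag; apply/matrixP => i j; rewrite !mxE.
  by case: eqP => // ->; rewrite -expr2 d1.
have oD : orthogonal_group R n (diag_mx d) by rewrite /orthogonal_group /= tr_diag_mx.
have uD : diag_mx d \in unitmx by have := mulmx1_unit DD; case.
have uQ : Q *m diag_mx d + 1%:M \in unitmx.
  by rewrite -DD -mulmxDl unitmx_mul uD andbT unitmxE unitfE.
have oQD : orthogonal_group R n (Q *m diag_mx d) by exact: orthM.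
have [A [sk QA] AE] := cayley_param oQD uQ.
have bA : blocky mu0 A.
  have bQD : blocky mu0 (Q *m diag_mx d) by apply: blockyM => //; exact: blocky_diag.
  have b1 := @blocky1 R n mu0.
  rewrite AE; apply: blockyM; last by apply: blockyV; exact: blockyD.
  by apply: blockyD => //; rewrite -scaleN1r; exact: blockyZ.
exists (n%:R * (2 * (n%:R ^+ 2 * `|A|))); first by rewrite !mulr_ge0.
move=> top mu k U p q sm pm k0 fk rp rq.
have oU := rep_orth rp.
(* Multiplying the frame by diag d does not change the weighted flag. *)
have rq' : rep q mu (U *m cayley A 1).
  rewrite -QA; apply: (rep_same n_gt0 rq); first exact: orthM.
  rewrite mulmxA mulmxA (_ : (U *m Q)^T *m U *m Q = 1%:M).
    by rewrite mul1mx; exact: blocky_diag.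
  by rewrite -mulmxA; exact: (orthM oU oQ).
have k0' : 0 <= 2 * (n%:R ^+ 2 * `|A|) * k by rewrite !mulr_ge0.
have [|L [cL lL]] := @conn_rot top mu U A _ p q sm pm oU sk k0' _ rp rq'; last first.
  by exists L; split=> //; rewrite -mulrA.
move=> t i j ij; have [w|nw] := boolP (wall mu0 i j).
  rewrite [X in `|X|](_ : _ = 0) ?normr0 ?mulr0 //.
  have bR : blocky mu0 (resolvent A t).
    apply: blockyV; apply: blockyD; first exact: blocky1.
    by rewrite -scalerN; apply: blockyZ; rewrite -scaleN1r; exact: blockyZ.
  suff : blocky mu0 (2 *: ((resolvent A t)^T *m A *m resolvent A t)) by apply.
  by apply/blockyZ/blockyM => //; apply: blockyM => //; exact: blockyT.
rewrite mulrC; apply: ler_pM => //; last exact: fk.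
- exact/f_ge0/trunc_cube/simplex_cube.
- exact: resolvent_norm2.
Qed.
End ChainOperations.

(** * Pushing chains into the top cell *)

Section ChainPush.
Variables (R : realType) (n : nat) (f : 'rV[R]_n -> R) (kf : R).
Hypothesis n_gt0 : (0 < n)%N.
Hypothesis f_ge0 : forall mu, cube R n mu -> 0 <= f mu.
Hypothesis kf_ge0 : 0 <= kf.
Hypothesis f_lip : forall x y, cube R n x -> cube R n y ->
  `|f x - f y| <= kf * `|x - y|.
Hypothesis f_eq0 : forall mu, cube R n mu -> (f mu = 0 <-> mu = 0).
Local Notation WF := (weighted_flag R n).

(** At a fixed positive weight any rotation is possible: the weight 0 has a
    single block, so no constraint remains on the matrix. *)
Lemma conn_same_weight (U V : 'M[R]_n) : orthogonal_group R n U -> orthogonal_group R n V ->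
  forall (top : bool) mu p q, simplex R n mu -> (forall i, 0 < mu 0 i) ->
  rep p mu U -> rep q mu V -> exists L, conn f top L p q.
Proof.
move=> oU oV top mu p q sm pm rp rq.
have oQ : orthogonal_group R n (U^T *m V) by apply: orthM => //; exact: orth_tr.
have b0 : blocky (0 : 'rV[R]_n) (U^T *m V).
  by move=> s t /existsP[l /andP[_]]; rewrite mxE ltxx.
have [C C0 H] := conn_rotQ n_gt0 f_ge0 kf_ge0 f_lip oQ b0.
have rq' : rep q mu (U *m (U^T *m V)) by rewrite mulmxA orthT // mul1mx.
have [|L [cL _]] := H top mu kf U p q sm pm kf_ge0 _ rp rq'; last by exists L.
move=> i j _ _; apply: (f_le f_ge0 kf_ge0 f_lip f_eq0).
exact/trunc_cube/simplex_cube.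
Qed.

(** If [x (Q + 1) = 0] then [2 x = - x (Q - 1)], which has norm at most that of
    [x]. *)
Lemma close_unit (Q : 'M[R]_n) : n%:R * `|Q - 1%:M| <= 1 -> Q + 1%:M \in unitmx.
Proof.
move=> Q1; apply: row_unitmx => x xQ.
have e : 2 *: x = - (x *m (Q - 1%:M)).
  have : x *m (Q + 1%:M) - x *m (Q - 1%:M) = 2 *: x.
    rewrite -mulmxBr (_ : Q + 1%:M - (Q - 1%:M) = 2%:M) ?mul_mx_scalar //.
    by apply/matrixP => i j; rewrite !mxE; case: eqP => _ /=; ring.
  by rewrite xQ sub0r => ->.
have : 2 * `|x| <= `|x|.
  rewrite -{1}(ger0_norm (ler0n R 2)) -normrZ e normrN.
  apply: le_trans (mulmx_norm_le _ _) _.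
  by rewrite mulrAC ler_piMl.
move=> le; apply/eqP; rewrite -normr_le0; lra.
Qed.

(** No change of signs is made here, so that the rotation is short when the two
    frames are close. From [A (Q + 1) = Q - 1] follows [2 A = (Q - 1) - A (Q - 1)],
    hence [A] is at most the size of [Q - 1]. *)
Lemma conn_close (top : bool) mu (U V : 'M[R]_n) p q :
  simplex R n mu -> (forall i, 0 < mu 0 i) ->
  rep p mu U -> rep q mu V -> n%:R * `|U^T *m V - 1%:M| <= 1 ->
  exists L, conn f top L p q /\
    L <= n%:R * (kf * (2 * (n%:R ^+ 2 * `|U^T *m V - 1%:M|))).
Proof.
move=> sm pm rp rq; have oU := rep_orth rp; have oV := rep_orth rq.
have VE : V = U *m (U^T *m V) by rewrite mulmxA orthT // mul1mx.
have oQ : orthogonal_group R n (U^T *m V) by apply: orthM => //; exact: orth_tr.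
move: (U^T *m V) VE oQ => Q VE oQ Q1.
have uQ := close_unit Q1; have [A [sk QA] AE] := cayley_param oQ uQ.
have AQ : `|A| <= `|Q - 1%:M|.
  have e : 2 *: A = (Q - 1%:M) - A *m (Q - 1%:M).
    have AQ : A *m (Q + 1%:M) = Q - 1%:M by rewrite AE -mulmxA mulVmx // mulmx1.
    rewrite -{1}AQ -mulmxBr (_ : Q + 1%:M - (_ - _) = 2%:M) ?mul_mx_scalar //.
    by apply/matrixP => i j; rewrite !mxE; case: eqP => _ /=; ring.
  have : 2 * `|A| <= `|Q - 1%:M| + `|A|.
    rewrite -{1}(ger0_norm (ler0n R 2)) -normrZ e.
    apply: le_trans (ler_normB _ _) _; rewrite lerD2l.
    by apply: le_trans (mulmx_norm_le _ _) _; rewrite mulrAC ler_piMl.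
  lra.
have rq' : rep q mu (U *m cayley A 1) by rewrite -QA -VE.
have k0 : 0 <= kf * (2 * (n%:R ^+ 2 * `|A|)) by rewrite !mulr_ge0.
have [|L [cL lL]] := @conn_rot R n f kf n_gt0 f_ge0 kf_ge0 f_lip top mu U A _ p q
  sm pm oU sk k0 _ rp rq'; last first.
  exists L; split=> //; apply: le_trans lL _.
  by rewrite ler_wpM2l // ler_wpM2l // ler_wpM2l // ler_wpM2l // exprn_ge0.
move=> t i j ij; have ct := trunc_cube i j (simplex_cube sm).
apply: ler_pM => //; first exact: f_ge0.
- exact: (f_le f_ge0 kf_ge0 f_lip f_eq0).
- exact: resolvent_norm2.
Qed.

(** Inside a block of [mu] the truncation of [mu] is 0, where [f] vanishes, and
    the pull moves it by at most [e]. *)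
Lemma trunc_pull_le mu (e : R) (i j : 'I_n) : simplex R n mu -> 0 <= e <= 1 ->
  (i < j)%N -> ~~ wall mu i j -> f (truncation (pull e mu) i j) <= kf * e.
Proof.
move=> sm /andP[e0 e1] ij /existsPn nw.
have c0 : cube R n 0 by move=> k; rewrite mxE lexx ler01.
have f0 : f 0 = 0 by apply/f_eq0.
have ct : cube R n (truncation (pull e mu) i j).
  by apply/trunc_cube/simplex_cube/simplex_pull => //; rewrite e0.
have := f_lip ct c0; rewrite f0 subr0 (ger0_norm (f_ge0 ct)) => /le_trans; apply.
rewrite ler_wpM2l // subr0; apply/mx_norm_leP => // a l; rewrite mxE.
case: ifP => [lij|_]; last by rewrite normr0.
have m0 : mu 0 l = 0.
  apply/eqP; rewrite eq_le; have /andP[-> _] := sm.1 l; rewrite andbT leNgt.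
  by have := nw l; rewrite lij.
have -> : pull e mu 0 l = (pull e mu - mu) 0 l by rewrite [RHS]mxE [X in _ + X]mxE m0 subr0.
by apply: le_trans (mx_entry_le _ _ _) _; exact: pull_dist.
Qed.

(** The squared coefficients [f^2] grow by at most [3 kf^2 e] under the pull and
    the angular velocity of the arc is bounded, so the speed grows by at most
    [n] times the square root of [K e]. *)
Lemma seg_push c d m dm V dV P (eta : R) : seg false c d m dm V dV ->
  primitive P c d (sigma f m dm V dV) -> 0 < eta ->
  exists2 e0 : R, 0 < e0 & forall (e : R) p q, 0 < e -> e <= e0 -> e <= 1 ->
    rep p (pull e (m c)) (V c) -> rep q (pull e (m d)) (V d) ->
    exists L, conn f true L p q /\ L <= P d - P c + eta.
Proof.
move=> S DP eta0; have [cd Cm CV sp _] := S.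
have [b b0 bP] : exists2 b : R, 0 <= b & forall t, c <= t <= d -> `|(V t)^T *m dV t| <= b.
  have CB : continuous (fun t => `|(V t)^T *m dV t|).
    move=> t; apply: (@continuous_comp _ _ _ (fun t => (V t)^T *m dV t) (fun x => `|x|));
      last exact: norm_continuous.
    apply: (@continuous_mulmx R R n n n (fun t => (V t)^T) dV).
      by apply: (@continuous_trmx R R n n V); exact: (C1R_cont CV).
    by case: CV => _; apply.
  have [t0 _ t0P] := EVT_max (ltW cd) (continuous_subspaceT CB).
  by exists `|(V t0)^T *m dV t0|.
have n1 : 0 < n%:R :> R by rewrite ltr0n.
pose dl := eta / (n%:R * (d - c)).
have dl0 : 0 < dl by rewrite divr_gt0 // mulr_gt0 // subr_gt0.
(* The added 1 only keeps the denominator positive. With e at most dl^2 / K, the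
   increase of each squared coefficient of the speed is at most dl^2. *)
pose K := 3 * kf ^+ 2 * b ^+ 2 + 1.
have K0 : 0 < K by rewrite ltr_wpDl // !mulr_ge0 // sqr_ge0.
exists (dl ^+ 2 / K) => [|e p q e0 ee0 e1 rp rq].
  by rewrite divr_gt0 // exprn_gt0.
have e01 : 0 <= e <= 1 by rewrite ltW.
pose me t := pull e (m t).
have Cme : C1R me (fun t => (1 - e) *: dm t).
  have [Dm Cdm] := Cm; split=> t; last by apply: cvgZr; exact: Cdm.
  apply/is_deriveP => x x0; have /is_deriveP/(_ x x0)[r r0 H] := Dm t.
  exists r => // s /H; apply: le_trans.
  rewrite (_ : _ - _ - _ = (1 - e) *: (m s - m t - (s - t) *: dm t)).
    rewrite normrZ ler_piMl // ger0_norm; lra.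
  by rewrite /me /pull; apply/rowP => i; rewrite !mxE; ring.
have Se : seg true c d me (fun t => (1 - e) *: dm t) V dV.
  split=> // [t /sp[sm oV]|t /sp[sm oV] i].
    by split=> //; exact: simplex_pull.
  by apply: pull_gt0 => //; rewrite e0.
have [Pe DPe] := seg_primitive kf_ge0 f_lip Se.
exists (Pe d - Pe c); split; first exact: conn_seg Se DPe rp rq.
have DPl : primitive (fun t => P t + n%:R * dl * t) c d
    (fun t => sigma f m dm V dV t + n%:R * dl).
  move=> t tcd; exact: (is_deriveD (DP t tcd) (@primitive_lin R (n%:R * dl) c d t tcd)).
have := primitive_le (ltW cd) DPe DPl.
have -> : P d + n%:R * dl * d - (P c + n%:R * dl * c) = P d - P c + eta.
  have -> : eta = n%:R * dl * (d - c); last by ring.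
  have dc0 : 0 < d - c by rewrite subr_gt0.
  by rewrite -mulrA mulrCA /dl divfK // mulf_neq0 ?gt_eqF.
apply=> t tcd; have tcd' : c <= t <= d by lra.
have [sm oV] := sp t tcd'.
apply: gnorm_add => [|i|i j ij]; first exact: ltW.
  by rewrite mxE normrM ler_piMl // ger0_norm; lra.
have cm := simplex_cube sm; have cme := simplex_cube (simplex_pull n_gt0 sm e01).
set x := f (truncation (m t) i j); set y := f (truncation (me t) i j).
set z := ((V t)^T *m dV t) i j.
have x0 : 0 <= x by exact/f_ge0/trunc_cube.
have y0 : 0 <= y by exact/f_ge0/trunc_cube.
have xk : x <= kf by apply: (f_le f_ge0 kf_ge0 f_lip f_eq0); exact: trunc_cube.
have yx : y <= x + kf * e.
  have := f_lip (trunc_cube i j cme) (trunc_cube i j cm); rewrite -/x -/y.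
  move=> /(le_trans (ler_norm _)); rewrite lerBlDl => /le_trans; apply.
  rewrite lerD2l ler_wpM2l // (le_trans (trunc_lip _ _ _ _)) // pull_dist //; exact: ltW.
have zb : z ^+ 2 <= b ^+ 2.
  rewrite -(real_normK (num_real z)) lerXn2r ?nnegrE //.
  by apply: le_trans (bP t tcd'); exact: mx_entry_le.
(* Expand the square of x + kf e, using x <= kf and e <= 1. *)
have y2 : y ^+ 2 <= x ^+ 2 + 3 * kf ^+ 2 * e.
  have : y ^+ 2 <= (x + kf * e) ^+ 2 by rewrite lerXn2r ?nnegrE // (le_trans y0).
  move/le_trans; apply; rewrite sqrrD exprMn.
  have h1 : x * (kf * e) <= kf * (kf * e) by rewrite ler_wpM2r // mulr_ge0 // ltW.
  have h2 : kf ^+ 2 * e ^+ 2 <= kf ^+ 2 * e.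
    by rewrite ler_wpM2l ?sqr_ge0 // expr2 ler_piMl // ltW.
  rewrite -addrA lerD2l.
  have -> : 3 * kf ^+ 2 * e = (kf * (kf * e)) *+ 2 + kf ^+ 2 * e by ring.
  by rewrite lerD // lerMn2r.
rewrite [(y * z) ^+ 2]exprMn [(x * z) ^+ 2]exprMn.
apply: (@le_trans _ _ ((x ^+ 2 + 3 * kf ^+ 2 * e) * z ^+ 2)).
  by rewrite ler_wpM2r // sqr_ge0.
rewrite mulrDl lerD2l.
apply: (@le_trans _ _ (K * e)).
  apply: (@le_trans _ _ (3 * kf ^+ 2 * e * b ^+ 2)).
    by rewrite ler_wpM2l // !mulr_ge0 ?sqr_ge0 // ltW.
  by rewrite mulrAC ler_wpM2r ?(ltW e0) // /K lerDl.
by rewrite mulrC -ler_pdivlMr.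
Qed.

(** Two representatives of the same point stop being equivalent after the pull;
    the rotation that joins them stays inside the blocks of [mu] and costs
    O(e). *)
Lemma rot_push (mu : 'rV[R]_n) (U V : 'M[R]_n) (eta : R) : simplex R n mu ->
  orthogonal_group R n U -> orthogonal_group R n V -> blocky mu (U^T *m V) -> 0 < eta ->
  exists2 e0 : R, 0 < e0 & forall (e : R) p q, 0 < e -> e <= e0 -> e <= 1 ->
    rep p (pull e mu) U -> rep q (pull e mu) V ->
    exists L, conn f true L p q /\ L <= eta.
Proof.
move=> sm oU oV bQ eta0.
have oQ : orthogonal_group R n (U^T *m V) by apply: orthM => //; exact: orth_tr.
have [C C0 H] := conn_rotQ n_gt0 f_ge0 kf_ge0 f_lip oQ bQ.
have K0 : 0 < C * kf + 1 by rewrite ltr_wpDl // mulr_ge0.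
exists (eta / (C * kf + 1)) => [|e p q e0 ee0 e1 rp rq]; first exact: divr_gt0.
have rq' : rep q (pull e mu) (U *m (U^T *m V)) by rewrite mulmxA orthT // mul1mx.
have e01 : 0 <= e <= 1 by rewrite ltW.
have [| | | |L [cL lL]] := H true (pull e mu) (kf * e) U p q _ _ _ _ rp rq'.
- exact: simplex_pull.
- by move=> i; apply: pull_gt0 => //; rewrite e0.
- by rewrite mulr_ge0 // ltW.
- by move=> i j ij nw; exact: trunc_pull_le.
exists L; split=> //; apply: le_trans lL _.
apply: (@le_trans _ _ ((C * kf + 1) * e)); last by rewrite mulrC -ler_pdivlMr.
by rewrite mulrA ler_wpM2r ?(ltW e0) // lerDl.
Qed.

(** The pulled weights are positive even at the ends of arcs, so the pushed
    chain stays in the top cell. *)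
Lemma conn_push L p q : conn f false L p q ->
  forall mu U nu V (eta : R), rep p mu U -> rep q nu V -> 0 < eta ->
  exists2 e0 : R, 0 < e0 & forall (e : R) p' q', 0 < e -> e <= e0 -> e <= 1 ->
    rep p' (pull e mu) U -> rep q' (pull e nu) V ->
    exists L', conn f true L' p' q' /\ L' <= L + eta.
Proof.
elim=> {L p q} [c d m dm V dV P p q S DP rp rq|L1 L2 p q r _ IH1 _ IH2] mu U nu W eta.
  move=> rp' rq' eta0; have e3 : 0 < eta / 3 by rewrite divr_gt0.
  have [cd _ _ sp _] := S.
  have [mE b1] := rep_fun n_gt0 rp' rp; have [nE b2] := rep_fun n_gt0 rq rq'.
  have oVc := rep_orth rp; have oVd := rep_orth rq.
  have [x x0 H1] := rot_push (rep_simplex rp') (rep_orth rp') oVc b1 e3.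
  have [y y0 H2] := seg_push S DP e3.
  have [z z0 H3] := rot_push (rep_simplex rq) oVd (rep_orth rq') b2 e3.
  (* An arc starts and ends at its own representatives, so its pushed image is
     preceded and followed by rotations to the prescribed ones. *)
  exists (Num.min x (Num.min y z)); first by rewrite !lt_min x0 y0.
  move=> e p' q' e0; rewrite !le_min => /and3P[ex ey ez] e1 rp1 rq1.
  have e01 : 0 <= e <= 1 by rewrite ltW.
  have [p2 rp2] := rep_make (simplex_pull n_gt0 (rep_simplex rp) e01) oVc.
  have [q2 rq2] := rep_make (simplex_pull n_gt0 (rep_simplex rq) e01) oVd.
  have [|L1 [c1 l1]] := H1 e p' p2 e0 ex e1 rp1; first by rewrite mE.
  have [L2 [c2 l2]] := H2 e p2 q2 e0 ey e1 rp2 rq2.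
  have [|L3 [c3 l3]] := H3 e q2 q' e0 ez e1 rq2; first by rewrite nE.
  exists (L1 + (L2 + L3)); split; last by lra.
  by apply: conn_cat c1 _; apply: conn_cat c2 c3.
move=> rp rr eta0; have e2 : 0 < eta / 2 by rewrite divr_gt0.
have [mq [Uq rq]] := rep_ex q.
have [x x0 H1] := IH1 _ _ _ _ _ rp rq e2.
have [y y0 H2] := IH2 _ _ _ _ _ rq rr e2.
exists (Num.min x y); first by rewrite lt_min x0.
move=> e p' q' e0; rewrite le_min => /andP[ex ey] e1 rp1 rr1.
have e01 : 0 <= e <= 1 by rewrite ltW.
have [q2 rq2] := rep_make (simplex_pull n_gt0 (rep_simplex rq) e01) (rep_orth rq).
have [L1' [c1 l1]] := H1 e p' q2 e0 ex e1 rp1 rq2.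
have [L2' [c2 l2]] := H2 e q2 q' e0 ey e1 rq2 rr1.
by exists (L1' + L2'); split; [exact: conn_cat c1 c2|lra].
Qed.

(** Pull [(mu, U)] into the top cell, move the weights, rotate, and undo the
    pull. The detour allows weights with vanishing entries. *)
Lemma conn_near mu nu (U V : 'M[R]_n) p q (e : R) : 0 < e -> e <= 1 ->
  rep p mu U -> rep q nu V -> n%:R * `|U^T *m V - 1%:M| <= 1 ->
  exists L, conn f false L p q /\
    L <= n%:R * (2 * e + `|nu - mu| + kf * (2 * (n%:R ^+ 2 * `|U^T *m V - 1%:M|))).
Proof.
move=> e0 e1 rp rq Q1.
have sm := rep_simplex rp; have sn := rep_simplex rq.
have oU := rep_orth rp; have oV := rep_orth rq.
have e01 : 0 <= e <= 1 by rewrite ltW.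
have spm := simplex_pull n_gt0 sm e01; have spn := simplex_pull n_gt0 sn e01.
have e0' := ltW e0.
have pos mu' : simplex R n mu' -> forall i, 0 < pull e mu' 0 i.
  by move=> s i; apply: pull_gt0 => //; rewrite e0.
have [p1 rp1] := rep_make spm oU.
have [q1 rq1] := rep_make spn oU.
have [q2 rq2] := rep_make spn oV.
have [|L1 [c1 l1]] := conn_straight n_gt0 kf_ge0 f_lip sm spm oU (pos _ sm) _ rp rp1 (top := false).
  by [].
have [L2 [c2 l2]] := conn_straight n_gt0 kf_ge0 f_lip spm spn oU (pos _ sn)
  (fun _ => pos _ sm) rp1 rq1 (top := false).
have [L3 [c3 l3]] := conn_close false spn (pos _ sn) rq1 rq2 Q1.
have [|L4 [c4 l4]] := conn_straight n_gt0 kf_ge0 f_lip sn spn oV (pos _ sn) _ rq rq2 (top := false).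
  by [].
exists (L1 + (L2 + (L3 + L4))); split.
  apply: conn_cat c1 _; apply: conn_cat c2 _; apply: conn_cat c3 _; exact: conn_sym.
have d1 := pull_dist n_gt0 sm e0'; have d4 := pull_dist n_gt0 sn e0'.
have d2 : `|pull e nu - pull e mu| <= `|nu - mu|.
  have -> : pull e nu - pull e mu = (1 - e) *: (nu - mu).
    by rewrite /pull; apply/rowP => i; rewrite !mxE; ring.
  by rewrite normrZ ler_piMl // ger0_norm; lra.
have n0 : 0 <= n%:R :> R by [].
have := ler_wpM2l n0 d1; have := ler_wpM2l n0 d2; have := ler_wpM2l n0 d4.
rewrite !mulrDr; lra.
Qed.

End ChainPush.

(** * From paths to chains *)

Section PathToChain.
Variables (R : realType) (n : nat) (f : 'rV[R]_n -> R) (kf : R).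
Hypothesis n_gt0 : (0 < n)%N.
Hypothesis f_ge0 : forall mu, cube R n mu -> 0 <= f mu.
Hypothesis kf_ge0 : 0 <= kf.
Hypothesis f_lip : forall x y, cube R n x -> cube R n y ->
  `|f x - f y| <= kf * `|x - y|.
Local Notation WF := (weighted_flag R n).
Local Notation full_flag := (@flag_proj R n (full_type n)).
Implicit Types (gamma : R -> WF).

(** On the top cell all types are [(1, ..., 1)], so a lift to O(n) of the full
    flag is a representative of the weighted flag. *)
Lemma lift_rep (p : WF) mu V : top_cell R n p -> orthogonal_group R n V ->
  wf_coords p mu (full_flag V) -> rep p mu V /\ forall i, 0 < mu 0 i.
Proof.
move=> tp oV /wf_coordsP[U [rp e]].
have pos : forall i, 0 < mu 0 i by apply/(top_cellP n_gt0 rp).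
split=> //; apply: (rep_same n_gt0 rp oV); apply/(flag_proj_eq n_gt0) => //.
  exact: rep_orth rp.
by rewrite -e weight_type_pos.
Qed.

Lemma rep_lift (p : WF) mu V : rep p mu V -> (forall i, 0 < mu 0 i) ->
  [/\ top_cell R n p, orthogonal_group R n V & wf_coords p mu (full_flag V)].
Proof.
move=> rp pos; split; [exact/(top_cellP n_gt0 rp)|exact: rep_orth rp|].
by apply/wf_coordsP; exists V; split=> //; rewrite weight_type_pos.
Qed.

Lemma blocky_pos_diag (mu : 'rV[R]_n) (Q : 'M[R]_n) i j :
  (forall i, 0 < mu 0 i) -> blocky mu Q -> i != j -> Q i j = 0.
Proof.
move=> pos bQ ij; apply: bQ; apply/existsP.
have [lt|gt|/val_inj e] := ltngtP i j; last by rewrite e eqxx in ij.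
  by exists i; rewrite pos leqnn lt.
by exists j; rewrite pos leqnn gt orbT.
Qed.

(** Two lifts differ by a diagonal sign matrix, which is locally constant by
    continuity. Hence the velocities are conjugate by that sign matrix, and the
    metric only sees squares of entries. *)
Lemma velocity_norm gamma t m (V : R -> 'M[R]_n) alpha dV mu' alpha' B :
  (\forall s \near t, rep (gamma s) (m s) (V s) /\ forall i, 0 < m s 0 i) ->
  is_derive t (1 : R) m alpha -> is_derive t (1 : R) V dV ->
  has_velocity gamma t mu' alpha' B ->
  gnorm f mu' alpha' B = gnorm f (m t) alpha ((V t)^T *m dV).
Proof.
move=> nr Dm DV [m2 [V2 [n2 <- sk Dm2 DV2]]].
have nE : \forall s \near t, m2 s = m s /\ forall i j, i != j -> ((V s)^T *m V2 s) i j = 0.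
  near=> s; have [rs pos] : rep (gamma s) (m s) (V s) /\ forall i, 0 < m s 0 i.
    by near: s; exact: nr.
  have [tp oV2 co] : [/\ top_cell R n (gamma s), orthogonal_group R n (V2 s) &
      wf_coords (gamma s) (m2 s) (full_flag (V2 s))] by near: s; exact: n2.
  have [rs2 _] := lift_rep tp oV2 co; have [e b] := rep_fun n_gt0 rs rs2.
  by split=> // i j; exact: (blocky_pos_diag pos b).
have nO : \forall s \near t, orthogonal_group R n (V s).
  by apply: filterS nr => s [/rep_orth].
have nO2 : \forall s \near t, orthogonal_group R n (V2 s).
  by apply: filterS n2 => s [].
have [rt pt] := nbhs_singleton nr; have oVt := rep_orth rt.
have oV2t := nbhs_singleton nO2; have [mE Gd] := nbhs_singleton nE.
have -> : alpha' = alpha.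
  apply: (is_derive_uniq Dm2); apply: near_eq_is_derive Dm.
  by apply: filterS nE => s [->].
pose G s := (V s)^T *m V2 s.
have GE s : orthogonal_group R n (V s) -> V2 s = V s *m G s.
  by move=> o; rewrite /G mulmxA orthT // mul1mx.
have G1 s i : orthogonal_group R n (V s) -> orthogonal_group R n (V2 s) ->
    (forall i j, i != j -> G s i j = 0) -> G s i i ^+ 2 = 1.
  move=> o o2 d; have oG : orthogonal_group R n (G s) by apply: orthM => //; exact: orth_tr.
  have := orth_row i oG; rewrite (bigD1 i) //= big1 ?addr0 // => j ji.
  by rewrite d ?expr0n // eq_sym.
have CG : {for t, continuous G}.
  have CV : {for t, continuous V}.
    by apply: differentiable_continuous; apply/derivable1_diffP; case: DV.
  have CV2 : {for t, continuous V2}.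
    by apply: differentiable_continuous; apply/derivable1_diffP; case: DV2.
  exact: (continuous_mulmx (continuous_trmx CV) CV2).
(* Diagonal entries of G are signs, and two distinct signs differ by 2. *)
have nG : \forall s \near t, G s = G t.
  have near1 : \forall s \near t, `|G t - G s| <= 1.
    by have /cvgrPdist_le/(_ _ ltr01) := CG.
  near=> s; have oV : orthogonal_group R n (V s) by near: s; exact: nO.
  have oV2 : orthogonal_group R n (V2 s) by near: s; exact: nO2.
  have [_ ds] : m2 s = m s /\ forall i j, i != j -> G s i j = 0 by near: s; exact: nE.
  have d1 : `|G t - G s| <= 1 by near: s; exact: near1.
  apply/matrixP => i j; have [<-|ij] := eqVneq i j; last by rewrite ds // [RHS]Gd.
  have gs := G1 s i oV oV2 ds; have gt := G1 t i oVt oV2t Gd.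
  have := le_trans (mx_entry_le (G t - G s) i i) d1; rewrite [X in `|X|]mxE [X in _ + X]mxE.
  rewrite ler_norml => /andP[h1 h2].
  have /eqP : (G s i i - G t i i) * (G s i i + G t i i) = 0 by rewrite -subr_sqr gs gt subrr.
  rewrite mulf_eq0 => /orP[/eqP|/eqP]; first by move/eqP; rewrite subr_eq0 => /eqP.
  move=> e; exfalso; have eG : G s i i = - G t i i by lra.
  by move: gt h1 h2; rewrite eG; move: (G t i i) => b; nra.
have dV2 : V2 t *m B = dV *m G t.
  apply: (is_derive_uniq DV2); apply: (@near_eq_is_derive _ _ _ (fun s => V s *m G t)).
    near=> s; rewrite (GE s); last by near: s; exact: nO.
    by congr (_ *m _); apply/esym; near: s; exact: nG.
  apply/is_derive_mxP => i j; rewrite mxE.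
  rewrite (_ : (fun _ => _) = fun s => \sum_k V s i k * G t k j); last first.
    by apply/funext => s; rewrite mxE.
  apply: is_derive_sumf => k _.
  have := is_derive_mulf ((is_derive_mxP _ _ _).1 DV i k) (is_derive_cst (G t k j) t 1).
  by rewrite mulr0 addr0.
have BE : B = (G t)^T *m ((V t)^T *m dV) *m G t.
  have : (V2 t)^T *m (V2 t *m B) = B.
    by rewrite mulmxA (oV2t : (V2 t)^T *m V2 t = 1%:M) mul1mx.
  by rewrite dV2 => <-; rewrite {1}(GE t oVt) trmx_mul !mulmxA.
rewrite mE /gnorm !metric_gE; congr (Num.sqrt (_ + _)).
apply: eq_bigr => i _; apply: eq_bigr => j _; rewrite !exprMn; congr (_ * _).
have -> : B i j = G t i i * ((V t)^T *m dV) i j * G t j j.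
  rewrite BE mxE (bigD1 j) //= big1 ?addr0 => [|k kj]; last by rewrite [G t k j]Gd ?mulr0.
  rewrite mxE (bigD1 i) //= big1 ?addr0 => [|k ki]; first by rewrite [(G t)^T i i]mxE.
  by rewrite [(G t)^T i k]mxE [G t k i]Gd ?mul0r.
by rewrite !exprMn (G1 t i) // (G1 t j) // mul1r mulr1.
Unshelve. all: by end_near. Qed.

Lemma speed_seg c d m dm V dV gamma t : seg false c d m dm V dV ->
  (forall s, c < s < d -> rep (gamma s) (m s) (V s)) -> c < t < d ->
  speed f gamma t = sigma f m dm V dV t.
Proof.
move=> S gr tcd; have sk := seg_skew S tcd.
have [cd [Dm _] [DV _] sp pos] := S; have /andP[ct td] := tcd.
have nr : \forall s \near t, rep (gamma s) (m s) (V s) /\ forall i, 0 < m s 0 i.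
  by apply: (near_oo ct td) => s scd; split; [exact: gr|exact: pos].
have [|_ oV] := sp t; first by lra.
apply: xget_unique.
  exists (m t), (dm t), ((V t)^T *m dV t); split=> //.
  exists m, V; split=> //.
  - by apply: filterS nr => s [rs ps]; have [] := rep_lift rs ps.
  - by rewrite mulmxA orthT // mul1mx.
by move=> y [mu [a [B [hv ->]]]]; exact: (velocity_norm nr (Dm t) (DV t) hv).
Qed.

(** [L] is at once the length of the path [gamma] between the times [c] and [d] and
    that of a chain. Measurability of the speed is carried along because it is
    needed to add integrals. *)
Definition span (top : bool) gamma (c d : R) (L : R) :=
  [/\ conn f top L (gamma c) (gamma d), path_length f gamma c d = L%:E &
      measurable_fun `[c, d] (speed f gamma)].

Lemma is_derive_LR (P : R -> R) c d s : c < d -> primitive P c d s ->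
  derivable_oo_LRcontinuous P c d.
Proof.
move=> cd DP; have C t : c <= t <= d -> P @ t --> P t.
  by move=> tcd; exact: (is_derive_cont (DP t tcd)).
split.
- by move=> t; rewrite in_itv /= => tcd; have [|] := DP t _; first by lra.
- by apply: cvg_at_right_filter; apply: C; lra.
- by apply: cvg_at_left_filter; apply: C; lra.
Qed.

(** The second fundamental theorem of calculus for the speed of the lift. *)
Lemma span_seg top c d m dm V dV P gamma : seg top c d m dm V dV ->
  primitive P c d (sigma f m dm V dV) ->
  (forall s, c <= s <= d -> rep (gamma s) (m s) (V s)) ->
  span top gamma c d (P d - P c).
Proof.
move=> S DP gr.
have S' : seg false c d m dm V dV.
  have [cd Cm CV sp pos] := S; split=> // t tcd; apply: pos.
  by case: (top) => //; lra.
have [cd Cm CV sp pos] := S'.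
have C := seg_sigma_clamp kf_ge0 f_lip S'.
set g := sigma f m dm V dV \o clamp c d in C.
have sE : {in `]c, d[, speed f gamma =1 g}.
  move=> t; rewrite in_itv /= => tcd; rewrite (speed_seg S') //.
    by rewrite /g /= clamp_id //; lra.
  by move=> s scd; apply: gr; lra.
have mg D : measurable D -> measurable_fun D g.
  by move=> mD; apply: measurable_funTS; exact: continuous_measurable_fun.
have ms : measurable_fun `]c, d[ (speed f gamma).
  apply: (eq_measurable_fun g); last exact: mg.
  by move=> t; rewrite inE /= => tcd; rewrite sE.
split.
- by apply: (conn_seg S DP); apply: gr; lra.
- rewrite /path_length (eq_integral_itv_bounded (g := g)) //; last exact: mg.
  rewrite (continuous_FTC2 (F := P)) //.
  + exact: continuous_subspaceT.
  + exact: is_derive_LR DP.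
  + move=> t; rewrite in_itv /= => tcd; have tcd' : c <= t <= d by lra.
    have [_ de] := DP t tcd'.
    by rewrite derive1E de /g /= clamp_id.
- exact: measurable_fun_itv_cc ms.
Qed.

Lemma speed_ge0 gamma t : 0 <= speed f gamma t.
Proof.
rewrite /speed; case: xgetP => // x _ [mu [a [B [_ ->]]]].
exact: sqrtr_ge0.
Qed.

Lemma span_cat top gamma c d e L1 L2 : c < d -> d < e ->
  span top gamma c d L1 -> span top gamma d e L2 -> span top gamma c e (L1 + L2).
Proof.
move=> cd de [C1 l1 m1] [C2 l2 m2]; split; first exact: conn_cat C1 C2.
  have cE : `[c, e]%classic = (`[c, d] `|` `]d, e])%classic :> set R.
    by rewrite -itv_bndbnd_setU // bnd_simp ltW.
  have mU : measurable_fun (`[c, d] `|` `]d, e]) (EFin \o speed f gamma).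
    apply/measurable_EFinP/measurable_funU => //; split=> //.
    exact: measurable_fun_itv_oc m2.
  rewrite /path_length cE ge0_integral_setU //=.
  - rewrite EFinD -l1 -l2; congr (_ + _)%E.
    apply: integral_itv_obnd_cbnd.
    by apply/measurable_EFinP; exact: measurable_fun_itv_oc m2.
  - by move=> t _; rewrite lee_fin speed_ge0.
  - apply/disj_setPS => t [] /=; rewrite !in_itv /=; lra.
have -> : `[c, e]%classic = (`[c, d] `|` `[d, e])%classic :> set R.
  rewrite (itv_bndbnd_setU (x := BRight d)) ?bnd_simp ?ltW //.
  apply/seteqP; split=> t /=; rewrite !in_itv /=.
    by move=> [->|/andP[a ->]]; [left|right; rewrite ltW].
  by move=> [->|tde]; [left|case: (ltP d t) => dt; [right|left]; lra].
by apply/measurable_funU.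
Qed.

(** Lifts exist only near each time. The supremum of the times reached from [a]
    by a relation that is transitive and locally valid is [b]. *)
Lemma cousin (Q : R -> R -> Prop) (a b : R) : a < b ->
  (forall c d e, c < d -> d < e -> Q c d -> Q d e -> Q c e) ->
  (forall t, a <= t <= b -> exists2 r : R, 0 < r & forall c d, a <= c -> c < d -> d <= b ->
     `|c - t| < r -> `|d - t| < r -> Q c d) -> Q a b.
Proof.
move=> ab tr loc.
pose E := [set t | a < t <= b /\ Q a t].
have [|r r0 H] := loc a; first by rewrite lexx ltW.
have E0 : E !=set0.
  pose t := a + Num.min (r / 2) (b - a).
  have [tb ta tr'] : [/\ t <= b, a < t & `|t - a| < r].
    have [m1 m2 m3] : [/\ 0 < Num.min (r / 2) (b - a), Num.min (r / 2) (b - a) <= r / 2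
        & Num.min (r / 2) (b - a) <= b - a].
      by case: (leP (r / 2) (b - a)) => ?; split; lra.
    rewrite /t [a + _]addrC addrK ger0_norm; last exact: ltW.
    by split; lra.
  exists t; split; first by rewrite ta.
  by apply: H => //; rewrite subrr normr0.
have Eub : ubound E b by move=> t [/andP[_ ?] _].
have hsE : has_sup E by split=> //; exists b.
set s := sup E.
have sb : s <= b by exact: ge_sup.
have as_ : a < s.
  have [t Et] := E0; have := ub_le_sup (ex_intro _ b Eub) Et.
  by case: Et => /andP[? _] _; rewrite -/s; lra.
have [|q q0 Hq] := loc s; first by rewrite sb ltW.
have [t Et ts] := sup_adherent q0 hsE.
have tles := ub_le_sup (ex_intro _ b Eub) Et; rewrite -/s in ts tles.
case: Et => /andP[at_ tb] Qat.
have tsq : `|t - s| < q by rewrite ler0_norm; lra.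
(* The relation is extended from a to u, which lies beyond the supremum s unless
   s = b. *)
pose u := Num.min (s + q / 2) b.
have us : `|u - s| < q /\ s <= u <= b.
  by rewrite /u; case: (leP (s + q / 2) b) => ?; rewrite ger0_norm; lra.
have Eu : Q a u.
  have [tu|ut] := ltP t u; last by have -> : u = t by lra.
  by apply: (tr _ t) => //; apply: Hq => //; lra.
suff <- : u = b by [].
have uE : E u by split=> //; lra.
have := ub_le_sup (ex_intro _ b Eub) uE; rewrite -/s /u.
by case: (leP (s + q / 2) b) => ?; lra.
Qed.

Lemma piecewise_rel (P Q : R -> R -> Prop) (a b : R) :
  (forall c d e, c < d -> d < e -> Q c d -> Q d e -> Q c e) ->
  a < b -> (forall c d, a <= c -> c < d -> d <= b -> P c d -> Q c d) ->
  piecewise P a b -> Q a b.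
Proof.
move=> tr ab PQ [s [[ps /eqP ls] Ps]].
elim: s a ps ls Ps ab PQ => [a _ /= -> |x s IH a /= /andP[ax ps] ls Ps ab PQ].
  by rewrite ltxx.
have Pax : P a x by exact: (Ps 0%N).
case: s ps ls IH Ps => [|y s] ps ls IH Ps.
  by move: ls Pax => /= -> Pab; exact: PQ.
have xb : x < b.
  move: ls ps => <-; rewrite /= => /andP[xy ps].
  apply: lt_le_trans xy _; rewrite le_eqVlt.
  have := mem_last y s; rewrite inE => /orP[/eqP -> |ml]; first by rewrite eqxx.
  by rewrite (allP (order_path_min lt_trans ps) _ ml) orbT.
apply: (tr _ x) => //; first by apply: PQ => //; exact: ltW.
apply: IH => //.
- by move=> i si; exact: (Ps i.+1).
- by move=> c d xc cd db; apply: PQ => //; rewrite (le_trans (ltW ax)).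
Qed.

Definition wf_weight (p : WF) : 'rV[R]_n := set_val (repr p).1.
(** With [wf_weight] it gives continuous coordinates on the quotient that
    separate points, so limits of paths are unique. *)
Definition wf_flag (p : WF) : 'M[R]_n := flag_mx 0 (wf_weight p) (set_val (repr p).2).

Lemma repr_rep p : rep p (wf_weight p) (set_val (repr p).2).
Proof. by exists (repr p); split=> //; rewrite /wf_class reprK. Qed.

Lemma wf_weightE p mu U : rep p mu U -> wf_weight p = mu.
Proof. by move=> rp; have [] := rep_fun n_gt0 (repr_rep p) rp. Qed.

Lemma wf_flagE p mu U : rep p mu U -> wf_flag p = flag_mx 0 mu U.
Proof. by move=> rp; exact: (flag_mx_fun n_gt0 (lexx 0) (repr_rep p) rp). Qed.

Lemma continuous_bump (r : R) : continuous (bump_sq r).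
Proof. by move=> x; exact: (is_derive_cont (is_derive_bump r x)). Qed.

Lemma continuous_flag_mx (T : topologicalType) (r : R) (m : T -> 'rV[R]_n)
    (U : T -> 'M[R]_n) t i j : {for t, continuous m} -> {for t, continuous U} ->
  {for t, continuous (fun s => flag_mx r (m s) (U s) i j)}.
Proof.
move=> Cm CU; rewrite (_ : (fun _ => _) =
  fun s => \sum_k U s i k * ((\sum_(l < n | (k <= l)%N) bump_sq r (m s 0 l)) * U s j k)).
  apply: continuous_sumf => k _; apply: cvgM; first exact: continuous_entry.
  apply: cvgM; last exact: continuous_entry.
  apply: continuous_sumf => l _.
  apply: (@continuous_comp _ _ _ (fun s => m s 0 l) (bump_sq r)).
    exact: continuous_entry.
  exact: continuous_bump.
by apply/funext => s; rewrite flag_mxE; apply: eq_bigr => k _; rewrite mxE.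
Qed.

Local Notation prewf := ((simplex R n : Type) * (orthogonal_group R n : Type))%type.

Lemma wf_continuous (h : WF -> R) (g : prewf -> R) :
  (forall x, h (wf_class x) = g x) -> continuous g -> continuous h.
Proof.
move=> hg cg; apply/quotient_continuous.
by rewrite (_ : h \o _ = g) //; apply/funext => x; exact: hg.
Qed.

Lemma continuous_pre1 : continuous (fun x : prewf => set_val x.1 : 'rV[R]_n).
Proof.
move=> x; apply: (@continuous_comp _ _ _ (fun x : prewf => x.1) set_val).
  exact: cvg_fst.
exact: initial_continuous.
Qed.

Lemma continuous_pre2 : continuous (fun x : prewf => set_val x.2 : 'M[R]_n).
Proof.
move=> x; apply: (@continuous_comp _ _ _ (fun x : prewf => x.2) set_val).
  exact: cvg_snd.
exact: initial_continuous.
Qed.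

Lemma class_rep (x : prewf) : rep (wf_class x) (set_val x.1) (set_val x.2).
Proof. by exists x. Qed.

Lemma wf_weight_cont i : continuous (fun p => wf_weight p 0 i).
Proof.
apply: (wf_continuous (g := fun x => (set_val x.1 : 'rV[R]_n) 0 i)) => x.
  by rewrite (wf_weightE (class_rep x)).
exact: (continuous_entry (i := 0) (j := i) (@continuous_pre1 x)).
Qed.

Lemma wf_flag_cont i j : continuous (fun p => wf_flag p i j).
Proof.
apply: (wf_continuous (g := fun x => flag_mx 0 (set_val x.1) (set_val x.2) i j)) => x.
  by rewrite (wf_flagE (class_rep x)).
exact: (continuous_flag_mx (r := 0) (i := i) (j := j) (@continuous_pre1 x) (@continuous_pre2 x)).
Qed.

(** The coordinates with [r = 0] separate all weighted flags: 0 is below every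
    positive weight. *)
Lemma wf_sep p q : (forall i, wf_weight p 0 i = wf_weight q 0 i) ->
  (forall i j, wf_flag p i j = wf_flag q i j) -> p = q.
Proof.
move=> hw hf; have rp := repr_rep p; have rq := repr_rep q.
have e : wf_weight p = wf_weight q by apply/rowP.
rewrite -e in rq; apply: (flag_mx_sep n_gt0 (r := 0) _ rp rq) => //.
have : wf_flag p = wf_flag q by apply/matrixP.
by rewrite /wf_flag e.
Qed.

(** Uniqueness of limits at the two ends of a segment. *)
Lemma within_eq_ends (g h : R -> R) c d : c < d ->
  {within `[c, d], continuous g} -> continuous h ->
  (forall t, c < t < d -> g t = h t) -> g c = h c /\ g d = h d.
Proof.
move=> cd /subspace_continuousP Cg Ch gh.
have key x : c <= x <= d -> (forall e : R, 0 < e -> exists2 t, c < t < d & `|t - x| < e) ->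
    g x = h x.
  move=> xcd acc; apply/eqP; rewrite -subr_eq0 -normr_le0 leNgt; apply/negP => e0.
  set e := `|g x - h x| in e0.
  have e2 : 0 < e / 3 by rewrite divr_gt0.
  have /cvgrPdist_le/(_ _ e2) := Cg x xcd; rewrite near_withinE => /nearP[r1 r10 H1].
  have /cvgrPdist_le/(_ _ e2) := Ch x => /nearP[r2 r20 H2].
  have [|t tcd] := acc (Num.min r1 r2); first by rewrite lt_min r10.
  rewrite lt_min => /andP[t1 t2].
  have h1 := H1 t t1 _; have {}h1 : `|g x - g t| <= e / 3 by apply: h1; rewrite /= in_itv /=; lra.
  have h2 := H2 t t2; rewrite -(gh t tcd) in h2.
  have : e <= e / 3 + e / 3.
    rewrite {1}/e -(subrKA (g t)); apply: le_trans (ler_normD _ _) _.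
    by rewrite lerD // distrC.
  lra.
split; apply: key => [|e e0]; try lra.
  exists (c + Num.min (e / 2) ((d - c) / 2)).
    by case: (leP (e / 2) ((d - c) / 2)) => ?; lra.
  rewrite addrAC subrr add0r ger0_norm; case: (leP (e / 2) ((d - c) / 2)) => ?; lra.
exists (d - Num.min (e / 2) ((d - c) / 2)).
  by case: (leP (e / 2) ((d - c) / 2)) => ?; lra.
rewrite addrAC subrr add0r normrN ger0_norm; case: (leP (e / 2) ((d - c) / 2)) => ?; lra.
Qed.

(** A path of weighted flags is tied to its lift only inside the segment, since
    the extension of the lift to the ends is a priori unrelated to the path
    there. Continuity and separation of points force agreement at the ends. *)
Lemma rep_ends gamma c d m (V : R -> 'M[R]_n) : c < d -> {within `[c, d], continuous gamma} ->
  continuous m -> continuous V ->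
  (forall t, c <= t <= d -> simplex R n (m t) /\ orthogonal_group R n (V t)) ->
  (forall t, c < t < d -> rep (gamma t) (m t) (V t)) ->
  forall t, c <= t <= d -> rep (gamma t) (m t) (V t).
Proof.
move=> cd Cg Cm CV sp gr.
have comp (h : WF -> R) : continuous h -> {within `[c, d], continuous (h \o gamma)}.
  move=> Ch; apply: (@within_continuous_comp _ _ _ _ gamma h) => // x _; exact: Ch.
have W i := within_eq_ends cd (comp _ (@wf_weight_cont i))
  (fun t => continuous_entry (i := 0) (j := i) (Cm t)).
have F i j := within_eq_ends cd (comp _ (@wf_flag_cont i j))
  (fun t => continuous_flag_mx (r := 0) (i := i) (j := j) (Cm t) (CV t)).
have ends t : c <= t <= d -> (forall i, wf_weight (gamma t) 0 i = m t 0 i) ->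
    (forall i j, wf_flag (gamma t) i j = flag_mx 0 (m t) (V t) i j) ->
    rep (gamma t) (m t) (V t).
  move=> tcd hw hf; have [sm oV] := sp t tcd; have [q rq] := rep_make sm oV.
  suff -> : gamma t = q by [].
  by apply: wf_sep => [i|i j]; rewrite ?(wf_weightE rq) ?(wf_flagE rq).
have Wi i t : c < t < d -> wf_weight (gamma t) 0 i = m t 0 i.
  by move=> tcd; rewrite (wf_weightE (gr t tcd)).
have Fi i j t : c < t < d -> wf_flag (gamma t) i j = flag_mx 0 (m t) (V t) i j.
  by move=> tcd; rewrite (wf_flagE (gr t tcd)).
move=> t tcd; have [/eqP tc|tc] := boolP (t == c).
  rewrite tc; apply: ends => [|i|i j]; first by lra.
    by have [] := W i (Wi i).
  by have [] := F i j (Fi i j).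
have [/eqP td|td] := boolP (t == d).
  rewrite td; apply: ends => [|i|i j]; first by lra.
    by have [] := W i (Wi i).
  by have [] := F i j (Fi i j).
by apply: gr; move: tcd; rewrite !le_eqVlt (negbTE td) eq_sym (negbTE tc).
Qed.

(** Lift the piece near each time, prolong the lift to a global C^1 curve, and
    patch with [cousin]. *)
Lemma piece_span (top : bool) gamma c d m W : c < d -> C1_path `[c, d] m W ->
  (if top then forall t, c <= t <= d ->
     top_cell R n (gamma t) /\ wf_coords (gamma t) (m t) (W t)
   else {within `[c, d], continuous gamma} /\ forall t, c < t < d ->
     top_cell R n (gamma t) /\ wf_coords (gamma t) (m t) (W t)) ->
  exists L, span top gamma c d L.
Proof.
move=> cd [Cm sm CW] H.
apply: (cousin (Q := fun c d => exists L, span top gamma c d L) cd).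
  move=> x y z xy yz [L1 s1] [L2 s2]; exists (L1 + L2); exact: span_cat s1 s2.
move=> t tcd; have [|e e0 [V [CV VW]]] := CW t; first by rewrite /= in_itv.
exists e => // x y cx xy yd xt yt.
have sub : `[x, y] `<=` `[c, d] `&` ball t e.
  move=> z /=; rewrite !in_itv /= => zxy; split; first by lra.
  rewrite /ball /= distrC; move: xt yt; rewrite !ltr_norml; lra.
have [m' [dm [Cm' mE]]] := C1_on_extend xy (C1_on_sub (subset_trans sub (@subIsetl _ _ _)) Cm).
have [V' [dV [CV' VE]]] := C1_on_extend xy (C1_on_sub sub CV).
have inxy z : x <= z <= y -> z \in `[x, y] by rewrite in_itv.
have sp z : x <= z <= y -> simplex R n (m' z) /\ orthogonal_group R n (V' z).
  move=> zxy; rewrite mE ?VE; do ?exact: inxy; split.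
    by apply: sm; rewrite /= in_itv /=; lra.
  by have [] := VW z (sub z (inxy z zxy)).
have lift z : x <= z <= y ->
    top_cell R n (gamma z) /\ wf_coords (gamma z) (m z) (W z) ->
    rep (gamma z) (m' z) (V' z) /\ forall i, 0 < m' z 0 i.
  move=> zxy [tp co]; have [oV WE] := VW z (sub z (inxy z zxy)).
  rewrite mE ?VE; do ?exact: inxy; apply: lift_rep => //.
  by rewrite -WE.
have S : seg top x y m' dm V' dV.
  split=> // z zxy; have [] // := lift z.
    by case: (top) zxy; lra.
  by move: H zxy; case: (top) => [H|[_ H]] zxy; apply: H; lra.
have gr : forall z, x <= z <= y -> rep (gamma z) (m' z) (V' z).
  move: H lift => {S}; case: (top) => [H|[Cg H]] lift.
    by move=> z zxy; have [] // := lift z zxy; apply: H; lra.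
  apply: rep_ends => //.
  - by apply: continuous_subspaceW Cg; exact: subset_trans sub (@subIsetl _ _ _).
  - exact: C1R_cont Cm'.
  - exact: C1R_cont CV'.
  - by move=> z zxy; have [] // := lift z; [lra|apply: H; lra].
have [P DP] := seg_primitive kf_ge0 f_lip S.
by exists (P y - P x); exact: span_seg S DP gr.
Qed.

Lemma wf_path_span gamma a b : a < b -> wf_path gamma a b ->
  exists L, span false gamma a b L.
Proof.
move=> ab [Cg]; apply: (piecewise_rel (Q := fun c d => exists L, span false gamma c d L)) => //.
  move=> x y z xy yz [L1 s1] [L2 s2]; exists (L1 + L2); exact: span_cat s1 s2.
move=> c d ac cd db [m [W [CW H]]]; apply: (piece_span cd CW); split.
  apply: continuous_subspaceW Cg => z /=; rewrite !in_itv /=; lra.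
by move=> t tcd; apply: H; rewrite in_itv.
Qed.

Lemma top_path_span gamma a b : a < b -> top_path gamma a b ->
  exists L, span true gamma a b L.
Proof.
move=> ab; apply: (piecewise_rel (Q := fun c d => exists L, span true gamma c d L)) => //.
  move=> x y z xy yz [L1 s1] [L2 s2]; exists (L1 + L2); exact: span_cat s1 s2.
move=> c d ac cd db [m [W [CW H]]]; apply: (piece_span cd CW).
by move=> t tcd; apply: H; rewrite in_itv.
Qed.

End PathToChain.

(** * From chains to paths *)

Section ChainToPath.
Variables (R : realType) (n : nat) (f : 'rV[R]_n -> R) (kf : R).
Hypothesis n_gt0 : (0 < n)%N.
Hypothesis f_ge0 : forall mu, cube R n mu -> 0 <= f mu.
Hypothesis kf_ge0 : 0 <= kf.
Hypothesis f_lip : forall x y, cube R n x -> cube R n y ->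
  `|f x - f y| <= kf * `|x - y|.
Local Notation WF := (weighted_flag R n).
Local Notation full_flag := (@flag_proj R n (full_type n)).
Implicit Types (gamma : R -> WF).

Lemma piecewise1 (P : R -> R -> Prop) a b : a < b -> P a b -> piecewise P a b.
Proof. by move=> ab Pab; exists [:: b]; split; [exact: itv_partition1|case]. Qed.

Lemma piecewise_cat (P : R -> R -> Prop) a c b :
  piecewise P a c -> piecewise P c b -> piecewise P a b.
Proof.
move=> [s [ps Ps]] Pcb.
elim: s a ps Ps => [a /itv_partition_nil -> //|x s IH a ps Ps].
have [|t [pt Pt]] := IH x (itv_partition_cons ps).
  by move=> i si; exact: (Ps i.+1).
exists (x :: t); split.
  by move: ps pt => [/= /andP[ax _] _] [pt lt]; split=> //=; rewrite ax.
by case=> [_|i si]; [exact: (Ps 0%N)|exact: Pt].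
Qed.

Lemma piecewise_sub (P Q : R -> R -> Prop) a b :
  (forall c d, a <= c -> d <= b -> P c d -> Q c d) ->
  piecewise P a b -> piecewise Q a b.
Proof.
move=> PQ [s [ps Ps]]; exists s; split=> // i si; apply: PQ; last exact: Ps.
- by apply: itv_partition_nth_ge ps; rewrite ltnS ltnW.
- exact: itv_partition_nth_le ps.
Qed.

Lemma rep_inj (p q : WF) mu U : rep p mu U -> rep q mu U -> p = q.
Proof.
move=> rp rq; apply/(rep_eq n_gt0 rp rq); split=> //.
by rewrite (rep_orth rp : U^T *m U = 1%:M); exact: blocky1.
Qed.

(** Continuity of the quotient map. *)
Lemma rep_nbhs (p : WF) mu U (O : set WF) : rep p mu U -> nbhs p O ->
  exists2 r : R, 0 < r & forall q nu V, rep q nu V ->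
    `|nu - mu| < r -> `|V - U| < r -> O q.
Proof.
move=> [x [-> -> ->]] nO.
have Cc : continuous (@wf_class R n) by exact: pi_continuous.
have /nbhs_ballP[r /= r0 H] := Cc x O nO.
exists r => // q nu V [y [-> -> ->]] h1 h2; apply: H; split.
  by rewrite -[ball _ _ _]/(ball (set_val x.1) r (set_val y.1)) mx_norm_ball /ball_ /= distrC.
by rewrite -[ball _ _ _]/(ball (set_val x.2) r (set_val y.2)) mx_norm_ball /ball_ /= distrC.
Qed.

Lemma rep_continuous gamma (A : set R) m (V : R -> 'M[R]_n) :
  continuous m -> continuous V -> (forall t, A t -> rep (gamma t) (m t) (V t)) ->
  {within A, continuous gamma}.
Proof.
move=> Cm CV gr; apply/subspace_continuousP => t At O nO.
have [r r0 H] := rep_nbhs (gr t At) nO.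
have r2 : 0 < r / 2 by rewrite divr_gt0.
have rr x : x <= r / 2 -> x < r by move=> h; lra.
have /cvgrPdist_le/(_ _ r2) N1 := Cm t; have /cvgrPdist_le/(_ _ r2) N2 := CV t.
suff : \forall s \near t, A s -> O (gamma s) by [].
near=> s => As.
apply: (H _ _ _ (gr s As)); apply: rr; rewrite distrC; near: s; [exact: N1|exact: N2].
Unshelve. all: by end_near. Qed.

Lemma seg_wf_piece top gamma c d m dm V dV : seg top c d m dm V dV ->
  (forall t, c <= t <= d -> rep (gamma t) (m t) (V t)) -> wf_path_piece gamma c d.
Proof.
move=> [cd Cm CV sp pos] gr; exists m, (fun t => full_flag (V t)); split.
  split; first exact: C1R_C1_on Cm.
    by move=> t; rewrite /= in_itv /= => /sp[].
  move=> t tcd; exists 1 => //; exists V; split; first exact: C1R_C1_on CV.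
  by move=> s [scd _]; split=> //; move: scd; rewrite /= in_itv /= => /sp[].
move=> t; rewrite in_itv /= => tcd; have tcd' : c <= t <= d by lra.
have [|? _ ?] := rep_lift n_gt0 (gr t tcd') => //.
by apply: pos; case: (top).
Qed.

Lemma seg_top_piece gamma c d m dm V dV : seg true c d m dm V dV ->
  (forall t, c <= t <= d -> rep (gamma t) (m t) (V t)) -> top_path_piece gamma c d.
Proof.
move=> [cd Cm CV sp pos] gr; exists m, (fun t => full_flag (V t)); split.
  split; first exact: C1R_C1_on Cm.
    by move=> t; rewrite /= in_itv /= => /sp[].
  move=> t tcd; exists 1 => //; exists V; split; first exact: C1R_C1_on CV.
  by move=> s [scd _]; split=> //; move: scd; rewrite /= in_itv /= => /sp[].
move=> t; rewrite in_itv /= => tcd.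
by have [|? _ ?] := rep_lift n_gt0 (gr t tcd) => //; exact: pos.
Qed.

(** The speed depends on the germ of the path only; in particular gluing
    changes it at no more than the gluing times. *)
Lemma speed_local gamma gamma' t : (\forall s \near t, gamma s = gamma' s) ->
  speed f gamma t = speed f gamma' t.
Proof.
move=> e; rewrite /speed; congr (xget 0 _); apply/seteqP; split=> v /=.
  move=> [mu [a [B [[m [V [H1 H2 H3 H4 H5]]] ->]]]]; exists mu, a, B; split=> //.
  exists m, V; split=> //; near=> s.
  have <- : gamma s = gamma' s by near: s.
  by near: s.
move=> [mu [a [B [[m [V [H1 H2 H3 H4 H5]]] ->]]]]; exists mu, a, B; split=> //.
exists m, V; split=> //; near=> s.
have -> : gamma s = gamma' s by near: s.
by near: s.
Unshelve. all: by end_near. Qed.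

Lemma span_eq top gamma gamma' c d L : c < d ->
  (forall t, c <= t <= d -> gamma t = gamma' t) ->
  span f top gamma' c d L -> span f top gamma c d L.
Proof.
move=> cd e [C l mes].
have se : {in `]c, d[, speed f gamma =1 speed f gamma'}.
  move=> t; rewrite in_itv /= => /andP[ct td]; apply: speed_local.
  by apply: (near_oo ct td) => s scd; apply: e; lra.
have m' : measurable_fun `]c, d[ (speed f gamma').
  by apply: measurable_funS mes => // t /=; rewrite !in_itv /=; lra.
have m : measurable_fun `]c, d[ (speed f gamma).
  by apply: eq_measurable_fun m' => t; rewrite inE => /se.
split.
- by rewrite !e // ?lexx ltW.
- by rewrite /path_length (eq_integral_itv_bounded _ _ m m' se) -l.
- exact: measurable_fun_itv_cc m.
Qed.

Lemma glue_path gamma1 gamma2 a c b : a < c -> c < b -> gamma1 c = gamma2 c ->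
  exists gamma, (forall t, a <= t <= c -> gamma t = gamma1 t) /\
                (forall t, c <= t <= b -> gamma t = gamma2 t).
Proof.
move=> ac cb e; exists (fun t => if t <= c then gamma1 t else gamma2 t); split=> t.
  by move=> /andP[_ ->].
move=> /andP[ct _]; case: ifP => // tc.
by have -> : t = c by apply: le_anti; rewrite ct tc.
Qed.

Lemma wf_path_eq gamma gamma' c d : c < d ->
  (forall t, c <= t <= d -> gamma t = gamma' t) -> wf_path gamma' c d -> wf_path gamma c d.
Proof.
move=> cd e [Cg Pg]; split.
  apply/subspace_continuousP => t tcd.
  have /subspace_continuousP/(_ t tcd) H := Cg.
  have et : gamma t = gamma' t by apply: e; move: tcd; rewrite /= in_itv.
  move=> O nO; have nO' : nbhs (gamma' t) O by rewrite -et; exact: nO.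
  have nH : \forall s \near t, `[c, d]%classic s -> O (gamma' s) by exact: (H O nO').
  suff : \forall s \near t, `[c, d]%classic s -> O (gamma s) by [].
  apply: filterS nH => s Os scd; rewrite e; first exact: Os.
  by move: scd; rewrite /= in_itv.
apply: piecewise_sub Pg => x y cx yd [m [W [CW H]]]; exists m, W; split=> // t txy.
by rewrite e; [exact: H|move: txy; rewrite in_itv /=; lra].
Qed.

Lemma top_path_eq gamma gamma' c d : c < d ->
  (forall t, c <= t <= d -> gamma t = gamma' t) -> top_path gamma' c d -> top_path gamma c d.
Proof.
move=> cd e; apply: piecewise_sub => x y cx yd [m [W [CW H]]]; exists m, W; split=> // t txy.
by rewrite e; [exact: H|move: txy; rewrite in_itv /=; lra].
Qed.

Lemma wf_path_cat gamma a c b : a < c -> c < b ->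
  wf_path gamma a c -> wf_path gamma c b -> wf_path gamma a b.
Proof.
move=> ac cb [C1 P1] [C2 P2]; split; last exact: piecewise_cat P1 P2.
have -> : `[a, b]%classic = (`[a, c] `|` `[c, b])%classic :> set R.
  apply/seteqP; split=> t /=; rewrite !in_itv /=.
    by move=> tab; case: (lerP t c) => tc; [left|right]; lra.
  by case; lra.
by apply: withinU_continuous => //; exact: interval_closed.
Qed.

(** Each arc is reparametrized affinely to the time it is given, and the
    weighted flags it passes through are chosen pointwise: a path of weighted
    flags is determined by its representatives. *)
Lemma conn_path (top : bool) L p q : conn f top L p q -> forall a b : R, a < b ->
  exists gamma, [/\ gamma a = p, gamma b = q, span f top gamma a b L,
    wf_path gamma a b & top -> top_path gamma a b].
Proof.
elim=> {L p q} [c d m dm V dV P p q S DP rp rq|L1 L2 p q r _ IH1 _ IH2] a b ab.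
  have cd : c < d by case: S.
  (* The affine map t -> k t + l sends a, b to c, d. *)
  pose k := (d - c) / (b - a); pose l := c - k * a.
  have ba : 0 < b - a by rewrite subr_gt0.
  have k0 : 0 < k by rewrite divr_gt0 // subr_gt0.
  have ka : k * a + l = c by rewrite /l addrC subrK.
  have kb : k * b + l = d.
    have -> : k * b + l = k * (b - a) + c by rewrite /l; ring.
    by rewrite /k divfK ?gt_eqF // subrK.
  have h1 t : a <= t <= b -> c <= k * t + l <= d.
    by rewrite -{1}ka -kb !lerD2r !ler_pM2l.
  have h2 t : a < t < b -> c < k * t + l < d.
    by rewrite -{1}ka -kb !ltrD2r !ltr_pM2l.
  have S' := seg_affine ab h1 h2 S.
  have DP' : primitive (fun t => 1 * P (k * t + l)) a b
      (sigma f (fun t => m (k * t + l)) (fun t => k *: dm (k * t + l))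
          (fun t => V (k * t + l)) (fun t => k *: dV (k * t + l))).
    move=> t tab; rewrite sigma_affine gtr0_norm // -[X in X * _]mul1r.
    exact: (primitive_affine 1 h1 DP tab).
  have [gamma gr'] : {gamma : R -> WF & forall t, a <= t <= b ->
      rep (gamma t) (m (k * t + l)) (V (k * t + l))}.
    apply: (@choice R WF (fun t x => a <= t <= b -> rep x (m (k * t + l)) (V (k * t + l)))) => t.
    have [tab|tab] := boolP (a <= t <= b); last by exists p.
    have [_ _ _ sp _] := S'; have [sm oV] := sp t tab.
    by have [x rx] := rep_make sm oV; exists x.
  have [_ Cm CV _ _] := S'.
  exists gamma; split.
  - by apply: (rep_inj (gr' a _)); rewrite ?ka // lexx ltW.
  - by apply: (rep_inj (gr' b _)); rewrite ?kb // lexx ltW.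
  - by have := span_seg n_gt0 kf_ge0 f_lip S' DP' gr'; rewrite !mul1r ka kb.
  - split; last by apply: piecewise1 => //; exact: seg_wf_piece S' gr'.
    apply: (rep_continuous (C1R_cont Cm) (C1R_cont CV)) => t.
    by rewrite /= in_itv; exact: gr'.
  - by move=> tt; apply: piecewise1 => //; move: S'; rewrite tt => S'; exact: seg_top_piece S' gr'.
pose c := (a + b) / 2; have [ac cb] : a < c /\ c < b by rewrite /c; split; lra.
have [g1 [g1a g1c s1 w1 t1]] := IH1 a c ac.
have [g2 [g2c g2b s2 w2 t2]] := IH2 c b cb.
have [|g [e1 e2]] := glue_path ac cb (gamma1 := g1) (gamma2 := g2); first by rewrite g1c.
exists g; split.
- by rewrite e1 // lexx ltW.
- by rewrite e2 // lexx ltW.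
- apply: (span_cat ac cb); first exact: span_eq s1.
  exact: span_eq s2.
- by apply: (wf_path_cat ac cb); [exact: wf_path_eq w1|exact: wf_path_eq w2].
- move=> tt; apply: (@piecewise_cat _ a c b).
    exact: (top_path_eq ac e1 (t1 tt)).
  exact: (top_path_eq cb e2 (t2 tt)).
Qed.

(** Infimum of the lengths of chains. The value of [top] selects the distance
    on the completion or the Riemannian one. *)
Definition conn_dist (top : bool) (p q : WF) : \bar R :=
  ereal_inf [set L%:E | L in [set L | conn f top L p q]].

Lemma wf_distE : wf_dist f = conn_dist false.
Proof.
apply/funext => p; apply/funext => q; congr ereal_inf; apply/seteqP; split=> x /=.
  move=> [g [w <- <-] <-].
  have [L [C l _]] := wf_path_span n_gt0 kf_ge0 f_lip ltr01 w.
  by exists L.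
move=> [L C <-]; have [g [g0 g1 [_ l _] w _]] := conn_path C ltr01.
by exists g.
Qed.

Lemma riemannian_distE : riemannian_dist f = conn_dist true.
Proof.
apply/funext => p; apply/funext => q; congr ereal_inf; apply/seteqP; split=> x /=.
  move=> [g [w <- <-] <-].
  have [L [C l _]] := top_path_span n_gt0 kf_ge0 f_lip ltr01 w.
  by exists L.
move=> [L C <-]; have [g [g0 g1 [_ l _] w tp]] := conn_path C ltr01.
exists g => //; split=> //; exact: tp.
Qed.

End ChainToPath.

(** * The completion *)

Section Completion.
Variables (R : realType) (n : nat) (f : 'rV[R]_n -> R) (kf : R).
Hypothesis n_gt0 : (0 < n)%N.
Hypothesis f_ge0 : forall mu, cube R n mu -> 0 <= f mu.
Hypothesis kf_ge0 : 0 <= kf.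
Hypothesis f_lip : forall x y, cube R n x -> cube R n y ->
  `|f x - f y| <= kf * `|x - y|.
Hypothesis f_eq0 : forall mu, cube R n mu -> (f mu = 0 <-> mu = 0).
Local Notation WF := (weighted_flag R n).
Local Notation D := (conn_dist f).

Lemma conn_dist_le top L p q : conn f top L p q -> (D top p q <= L%:E)%E.
Proof. by move=> C; apply: ereal_inf_lbound; exists L. Qed.

Lemma conn_dist_ge0 top p q : (0 <= D top p q)%E.
Proof.
by apply: le_ereal_inf_tmp => _ [L C <-]; rewrite lee_fin; exact: conn_ge0 C.
Qed.

Lemma conn_dist_lt top p q (x : R) : (D top p q < x%:E)%E ->
  exists2 L, conn f top L p q & L < x.
Proof. by move=> /ereal_inf_lt[_ [L C <-]]; rewrite lte_fin => Lx; exists L. Qed.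

Lemma conn_dist_approx top p q (x : R) :
  (forall e : R, 0 < e -> exists2 L, conn f top L p q & L <= x + e) ->
  (D top p q <= x%:E)%E.
Proof.
move=> H; apply/lee_addgt0Pr => e /H[L C Le].
by apply: le_trans (conn_dist_le C) _; rewrite -EFinD lee_fin.
Qed.

(** The interior of an arc lies in the top cell, so a boundary point admits no
    constant chain, and its distance to itself needs short loops. *)
Lemma conn_loop p (e : R) : 0 < e -> exists2 L, conn f false L p p & L <= e.
Proof.
move=> e0; have [mu [U rp]] := rep_ex p.
have n1 : 0 < n%:R * 2 :> R by rewrite mulr_gt0 // ltr0n.
have Q1 : n%:R * `|U^T *m U - 1%:M| <= 1.
  by rewrite (rep_orth rp : U^T *m U = 1%:M) subrr normr0 mulr0.
pose x := Num.min 1 (e / (n%:R * 2)).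
have x0 : 0 < x by rewrite lt_min ltr01 divr_gt0.
have x1 : x <= 1 by rewrite ge_min lexx.
have [L [C Le]] := conn_near n_gt0 f_ge0 kf_ge0 f_lip f_eq0 x0 x1 rp rp Q1.
exists L => //; apply: le_trans Le _.
rewrite (rep_orth rp : U^T *m U = 1%:M) !subrr !normr0 !mulr0 !addr0 mulrA mulrC.
by rewrite -ler_pdivlMr // ge_min lexx orbT.
Qed.

Lemma conn_exists p q : exists L, conn f false L p q.
Proof.
have [mu [U rp]] := rep_ex p; have [nu [V rq]] := rep_ex q.
have sb := simplex_bary R n_gt0.
have bp i : 0 < bary R n 0 i by exact: bary_gt0.
have [p1 rp1] := rep_make sb (rep_orth rp); have [q1 rq1] := rep_make sb (rep_orth rq).
have [|L1 [C1 _]] := conn_straight n_gt0 kf_ge0 f_lip (rep_simplex rp) sb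
  (rep_orth rp) bp _ rp rp1 (top := false); first by [].
have [|L3 [C3 _]] := conn_straight n_gt0 kf_ge0 f_lip (rep_simplex rq) sb
  (rep_orth rq) bp _ rq rq1 (top := false); first by [].
have [L2 C2] := conn_same_weight n_gt0 f_ge0 kf_ge0 f_lip f_eq0 (rep_orth rp)
  (rep_orth rq) false sb bp rp1 rq1.
exists (L1 + (L2 + L3)); apply: conn_cat C1 _; apply: conn_cat C2 _; exact: conn_sym.
Qed.

Lemma pos_lower_bound (mu : 'rV[R]_n) :
  exists2 r : R, 0 < r & forall l, 0 < mu 0 l -> r < mu 0 l.
Proof.
(* The default value 1 covers the absence of positive entries. *)
pose r := \big[Num.min/1]_(l | 0 < mu 0 l) mu 0 l.
have r0 : 0 < r by apply: lt_bigmin.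
exists (r / 2) => [|l ml]; first exact: divr_gt0.
have : r <= mu 0 l by exact: bigmin_le_cond.
lra.
Qed.

Lemma le_all_eps (x K : R) : 0 <= K -> (forall e, 0 < e -> x <= K * e) -> x <= 0.
Proof.
move=> K0 H; apply/ler_addgt0Pl => e e0; rewrite addr0.
have K1 : 0 < K + 1 by rewrite ltr_wpDl.
have := H (e / (K + 1)) (divr_gt0 e0 K1) => /le_trans; apply.
rewrite mulrCA ler_piMr ?(ltW e0) //.
by rewrite ler_pdivrMr // mul1r lerDl.
Qed.

(** Choose [r] below the positive entries of the common weight. *)
Lemma conn_dist0 p q : (D false p q = 0)%E -> p = q.
Proof.
move=> D0; have short e : 0 < e -> exists2 L, conn f false L p q & L < e.
  by move=> e0; apply: conn_dist_lt; rewrite D0 lte_fin.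
have [mu [U rp]] := rep_ex p; have [nu [V rq]] := rep_ex q.
have e : mu = nu.
  apply/rowP => i; apply/eqP; rewrite -subr_eq0 -normr_le0.
  apply: (@le_all_eps _ 1) => // x x0; have [L C Lx] := short x x0.
  by rewrite mul1r (le_trans (conn_weight_le n_gt0 i C rp rq)) // ltW.
rewrite -{}e in rq; have [r r0 rm] := pos_lower_bound mu.
apply: (flag_mx_sep n_gt0 rm rp rq); apply/matrixP => i j.
apply/eqP; rewrite -subr_eq0 -normr_le0.
have [K K0 KP] := conn_flag_le n_gt0 f_ge0 kf_ge0 f_lip f_eq0 r0.
apply: (@le_all_eps _ K) => // x x0; have [L C Lx] := short x x0.
apply: le_trans (KP _ _ _ _ _ _ _ _ i j C rp rq) _.
by rewrite ler_wpM2l // ltW.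
Qed.

Lemma conn_dist_sym top p q : D top p q = D top q p.
Proof.
congr ereal_inf; apply/seteqP; split=> _ [L C <-]; exists L => //; exact: conn_sym.
Qed.

Lemma conn_dist_fin p q : D false p q \is a fin_num.
Proof.
rewrite ge0_fin_numE ?conn_dist_ge0 //; have [L C] := conn_exists p q.
exact: le_lt_trans (conn_dist_le C) (ltry _).
Qed.

Lemma conn_dist_triangle p q r : (D false p r <= D false p q + D false q r)%E.
Proof.
rewrite -(fineK (conn_dist_fin p q)) -(fineK (conn_dist_fin q r)) -EFinD.
apply: conn_dist_approx => e e0; have e2 : 0 < e / 2 by rewrite divr_gt0.
have [|L1 C1 l1] := @conn_dist_lt false p q (fine (D false p q) + e / 2).
  by rewrite EFinD fineK ?conn_dist_fin // lteDl ?conn_dist_fin // lte_fin.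
have [|L2 C2 l2] := @conn_dist_lt false q r (fine (D false q r) + e / 2).
  by rewrite EFinD fineK ?conn_dist_fin // lteDl ?conn_dist_fin // lte_fin.
exists (L1 + L2); first exact: conn_cat C1 C2.
lra.
Qed.

Lemma conn_dist_metric : metric_on setT (D false).
Proof.
split=> [p q _ _|p q _ _|p q _ _|p q r _ _ _].
- by rewrite conn_dist_ge0 -ge0_fin_numE ?conn_dist_fin ?conn_dist_ge0.
- split=> [/conn_dist0 //|->]; apply: le_anti; rewrite conn_dist_ge0 andbT.
  apply: conn_dist_approx => e /(conn_loop q)[L C Le]; exists L => //.
  by rewrite add0r.
- exact: conn_dist_sym.
- exact: conn_dist_triangle.
Qed.

Lemma conn_pull (top : bool) p mu U (e : R) : rep p mu U -> 0 < e -> e <= 1 ->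
  (top -> top_cell R n p) -> exists q, [/\ rep q (pull e mu) U, top_cell R n q &
    exists2 L, conn f top L p q & L <= n%:R * e].
Proof.
move=> rp e0 e1 tp; have e01 : 0 <= e <= 1 by rewrite ltW.
have sm := rep_simplex rp.
have spm := simplex_pull n_gt0 sm e01.
have pos i : 0 < pull e mu 0 i by apply: pull_gt0 => //; rewrite e0.
have [q rq] := rep_make spm (rep_orth rp); exists q; split=> //.
  exact/(top_cellP n_gt0 rq).
have [|L [C Le]] := conn_straight n_gt0 kf_ge0 f_lip sm spm (rep_orth rp) pos _ rp rq
  (top := top); first by move=> /tp/(top_cellP n_gt0 rp) h; exact: h.
exists L => //; apply: le_trans Le _; rewrite ler_wpM2l //.
by apply: pull_dist => //; exact: ltW.
Qed.

(** A chain in the top cell is in particular a chain. Conversely, push a given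
    chain into the top cell and join its ends to the pulled ones inside that
    cell. *)
Lemma conn_dist_top p q : top_cell R n p -> top_cell R n q -> D true p q = D false p q.
Proof.
move=> tp tq; apply: le_anti; apply/andP; split; last first.
  apply: le_ereal_inf_tmp => _ [L C <-]; apply: conn_dist_le; exact: (conn_weaken C).
apply: le_ereal_inf_tmp => _ [L C <-]; apply: conn_dist_approx => e e0.
have [mu [U rp]] := rep_ex p; have [nu [V rq]] := rep_ex q.
have e2 : 0 < e / 2 by rewrite divr_gt0.
have n1 : 0 < n%:R :> R by rewrite ltr0n.
have [x x0 H] := conn_push n_gt0 f_ge0 kf_ge0 f_lip f_eq0 C rp rq e2.
pose y := Num.min x (Num.min 1 (e / 4 / n%:R)).
have y0 : 0 < y by rewrite !lt_min x0 ltr01 !divr_gt0.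
have yx : y <= x by rewrite ge_min lexx.
have y1 : y <= 1 by rewrite !ge_min lexx orbT.
have yn : n%:R * y <= e / 4.
  by rewrite mulrC -ler_pdivlMr // !ge_min lexx !orbT.
have [p1 [rp1 _ [L1 C1 l1]]] := conn_pull rp y0 y1 (fun _ : true => tp).
have [q1 [rq1 _ [L3 C3 l3]]] := conn_pull rq y0 y1 (fun _ : true => tq).
have [L2 [C2 l2]] := H y p1 q1 y0 yx y1 rp1 rq1.
exists (L1 + (L2 + L3)); last by lra.
apply: conn_cat C1 _; apply: conn_cat C2 _; exact: conn_sym.
Qed.

Lemma conn_dist_dense : dense_dist (top_cell R n) (D false).
Proof.
move=> p e e0; have [mu [U rp]] := rep_ex p.
have n1 : 0 < n%:R :> R by rewrite ltr0n.
pose y := Num.min 1 (e / 2 / n%:R).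
have y0 : 0 < y by rewrite !lt_min ltr01 !divr_gt0.
have y1 : y <= 1 by rewrite !ge_min lexx.
have yn : n%:R * y <= e / 2 by rewrite mulrC -ler_pdivlMr // !ge_min lexx !orbT.
have [|q [_ tq [L C Le]]] := @conn_pull false p mu U y rp y0 y1 _; first by [].
exists q => //; apply: le_lt_trans (conn_dist_le C) _; rewrite lte_fin; lra.
Qed.

(** Sequential compactness of the simplex times O(n), obtained from the
    compactness of boxes of entries: the conditions defining the two factors
    are closed, hence pass to cluster points. *)
Lemma rep_cluster (u : nat -> WF) : exists p, forall e : R, 0 < e -> forall N, exists i,
  (N <= i)%N /\ exists mu U nu V, [/\ rep (u i) mu U, rep p nu V, `|nu - mu| < e & `|V - U| < e].
Proof.
have [m mP] : {m : nat -> 'rV[R]_n * 'M[R]_n & forall i, rep (u i) (m i).1 (m i).2}.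
  apply: (@choice nat _ (fun i x => rep (u i) x.1 x.2)) => i.
  by have [mu [U r]] := rep_ex (u i); exists (mu, U).
pose A1 := [set v : 'rV[R]_n | forall i, `[(0 : R), 1]%classic (v ord0 i)].
(* Matrices are flattened to rows, for which boxes are known to be compact. *)
pose A2 := [set v : 'rV[R]_(n * n) | forall i, `[(-1 : R), 1]%classic (v ord0 i)].
have cA : compact (A1 `*` A2).
  apply: compact_setX.
    by apply: (@rV_compact R n (fun=> `[(0 : R), 1]%classic)) => i; exact: segment_compact.
  by apply: (@rV_compact R (n * n) (fun=> `[(-1 : R), 1]%classic)) => i; exact: segment_compact.
pose w i := ((m i).1, mxvec (m i).2).
have wA i : (A1 `*` A2) (w i).
  split=> j /=; rewrite in_itv /=; first by have [c _] := rep_simplex (mP i); exact: c.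
  case/mxvec_indexP: j => a b; rewrite mxvecE -ler_norml.
  by apply: orth_le1; exact: rep_orth (mP i).
have [[mu v] [[A1mu A2v] cl]] := cA (w @ \oo) _ (filterE _ wA).
have near_w (e : R) : 0 < e -> forall N, exists i, [/\ (N <= i)%N,
    `|mu - (m i).1| < e & `|vec_mx v - (m i).2| < e].
  move=> e0 N; have [|x [[i Ni <-] [/= b1 b2]]] := cl [set w i | i in [set i | (N <= i)%N]]
      (ball (mu, v) (e / 2)) _ (nbhsx_ballx _ _ (divr_gt0 e0 (ltr0n R 2))).
    by exists N => // i Ni; exists i.
  have e2 : e / 2 < e by lra.
  move: b1 b2; rewrite !mx_norm_ball /ball_ /= => b1 b2.
  exists i; split=> //; first exact: lt_trans b1 e2.
  apply: le_lt_trans e2; apply/mx_norm_leP => [|a b]; first by lra.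
  have := mx_entry_le (v - mxvec (m i).2) 0 (mxvec_index a b).
  move=> /le_trans/(_ (ltW b2)); rewrite [X in `|X| <= _]mxE [X in _ + X]mxE mxvecE.
  by rewrite !mxE.
have n0 : 0 <= n%:R :> R by [].
have oUi i : (m i).2^T *m (m i).2 = 1%:M := rep_orth (mP i).
have norm1 (U : 'M[R]_n) : (forall a b, `|U a b| <= 1) -> `|U| <= 1.
  by move=> h; apply/mx_norm_leP.
have Ui1 i : `|(m i).2| <= 1.
  by apply: norm1 => a b; apply: orth_le1; exact: rep_orth (mP i).
set U := vec_mx v in near_w.
have U1 : `|U^T| <= 1.
  by apply: norm1 => a b; rewrite !mxE ler_norml; have := A2v (mxvec_index b a); rewrite /= in_itv.
have sm : simplex R n mu.
  split=> [i|]; first by have := A1mu i; rewrite /= in_itv.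
  apply/eqP; rewrite /= -subr_eq0 -normr_le0; apply: (le_all_eps n0) => e e0.
  have [i [_ d _]] := near_w e e0 0%N; have [_ /= s1] := rep_simplex (mP i).
  rewrite -[X in `|_ - X|]s1 -sumrB; apply: le_trans (ler_norm_sum _ _ _) _.
  apply: (@le_trans _ _ (\sum_(j < n) e)); last by rewrite sumr_const card_ord mulr_natl.
  apply: ler_sum => j _; apply: le_trans (ltW d).
  by have := mx_entry_le (mu - (m i).1) 0 j; rewrite [X in `|X| <= _]mxE [X in _ + X]mxE.
have oU : orthogonal_group R n U.
  apply/eqP; rewrite -subr_eq0 -normr_le0.
  apply: (@le_all_eps _ (n%:R + n%:R)); first by rewrite addr_ge0.
  move=> e e0; have [i [_ _ d]] := near_w e e0 0%N.
  have -> : U^T *m U - 1%:M = U^T *m (U - (m i).2) + (U - (m i).2)^T *m (m i).2.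
    by rewrite [(U - _)^T]raddfB /= mulmxBr mulmxBl addrA subrK oUi.
  have dT : `|(U - (m i).2)^T| <= e.
    apply/mx_norm_leP => [|a b]; first exact: ltW.
    by rewrite mxE; apply: le_trans (mx_entry_le _ _ _) (ltW d).
  rewrite mulrDl; apply: le_trans (ler_normD _ _) _; rewrite lerD //.
    apply: le_trans (mulmx_norm_le _ _) _; rewrite -mulrA ler_wpM2l //.
    by rewrite -[leRHS]mul1r; apply: ler_pM => //; exact: ltW.
  apply: le_trans (mulmx_norm_le _ _) _; rewrite -mulrA ler_wpM2l //.
  by rewrite -[leRHS]mulr1; apply: ler_pM.
have [p rp] := rep_make sm oU; exists p => e e0 N.
have [i [Ni d1 d2]] := near_w e e0 N; exists i; split=> //.
by exists (m i).1, (m i).2, mu, U.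
Qed.

(** A Cauchy sequence converges to any of its cluster points. *)
Lemma conn_dist_complete : complete_dist (D false).
Proof.
move=> u Cu; have [p cl] := rep_cluster u; exists p => e e0.
have e2 : 0 < e / 2 by rewrite divr_gt0.
have [N HN] := Cu _ e2; exists N => i Ni.
have n1 : 0 < n%:R :> R by rewrite ltr0n.
pose K := n%:R * (3 + kf * (2 * (n%:R ^+ 2 * n%:R))).
have K0 : 0 <= K by rewrite mulr_ge0 // addr_ge0 // !mulr_ge0 // exprn_ge0.
have K1 : 0 < K + 1 by rewrite ltr_wpDl.
(* The second bound makes the frames close enough for conn_near, the third makes
   its length at most e / 4. *)
pose x := Num.min 1 (Num.min (n%:R * n%:R)^-1 (e / 4 / (K + 1))).
have x0 : 0 < x by rewrite !lt_min ltr01 invr_gt0 mulr_gt0 // !divr_gt0.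
have x1 : x <= 1 by rewrite ge_min lexx.
have xn : x <= (n%:R * n%:R)^-1 by rewrite !ge_min lexx orbT.
have xK : x * (K + 1) <= e / 4 by rewrite -ler_pdivlMr // !ge_min lexx !orbT.
have [j [Nj [mu [U [nu [V [rj rp d1 d2]]]]]]] := cl x x0 N.
have oU := rep_orth rj.
have UT1 : `|U^T| <= 1.
  by apply/mx_norm_leP => // a b; rewrite mxE; exact: orth_le1.
have dQ : `|U^T *m V - 1%:M| <= n%:R * x.
  have -> : U^T *m V - 1%:M = U^T *m (V - U).
    by rewrite mulmxBr (oU : U^T *m U = 1%:M).
  apply: le_trans (mulmx_norm_le _ _) _; rewrite -mulrA ler_wpM2l //.
  by rewrite -[leRHS]mul1r; apply: ler_pM => //; exact: ltW.
have Q1 : n%:R * `|U^T *m V - 1%:M| <= 1.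
  apply: (@le_trans _ _ (n%:R * (n%:R * x))); first by rewrite ler_wpM2l.
  by rewrite mulrA mulrC -ler_pdivlMr ?mulr_gt0 // mul1r.
have [L [C Le]] := conn_near n_gt0 f_ge0 kf_ge0 f_lip f_eq0 x0 x1 rj rp Q1.
have Lx : L <= K * x.
  apply: le_trans Le _; rewrite /K -mulrA ler_wpM2l //.
  have -> : (3 + kf * (2 * (n%:R ^+ 2 * n%:R))) * x =
    2 * x + x + kf * (2 * (n%:R ^+ 2 * (n%:R * x))) by ring.
  rewrite lerD ?lerD ?(ltW d1) // ler_wpM2l // ler_wpM2l // ler_wpM2l //.
apply: le_lt_trans (conn_dist_triangle (u i) (u j) p) _.
have -> : e%:E = ((e / 2)%:E + (e / 2)%:E)%E by rewrite -EFinD -splitr.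
apply: lte_leD => //.
- exact: conn_dist_fin.
- exact: HN.
- apply: le_trans (conn_dist_le C) _; rewrite lee_fin; apply: le_trans Lx _.
  have := K0; rewrite mulrDr mulr1 mulrC in xK; lra.
Qed.

End Completion.

Theorem theorem4p8 (R : realType) (n : nat) (n_ge1 : (1 <= n)%N)
    (f : 'rV[R]_n -> R)
    (f_ge0 : forall mu, cube R n mu -> 0 <= f mu)
    (f_lipschitz : exists k : R, k.-lipschitz_(cube R n) f)
    (f_C2 : C2_on (cube R n `\ 0) f)
    (f_eq0 : forall mu, cube R n mu -> (f mu = 0 <-> mu = 0)) :
  is_completion (top_cell R n) (riemannian_dist f) (wf_dist f).
Proof.
have [k kP] := f_lipschitz; pose kf := `|k|.
have f_lip x y : cube R n x -> cube R n y -> `|f x - f y| <= kf * `|x - y|.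
  move=> cx cy; apply: le_trans (kP (x, y) (conj cx cy)) _.
  by rewrite ler_wpM2r // ler_norm.
have kf_ge0 : 0 <= kf by exact: normr_ge0.
rewrite (wf_distE n_ge1 kf_ge0 f_lip) (riemannian_distE n_ge1 kf_ge0 f_lip).
have topE := conn_dist_top n_ge1 f_ge0 kf_ge0 f_lip f_eq0.
have [d1 d2 d3 d4] := conn_dist_metric n_ge1 f_ge0 kf_ge0 f_lip f_eq0.
split.
- split=> [x y tx ty|x y tx ty|x y tx ty|x y z tx ty tz]; rewrite !topE //.
  + exact: d1.
  + exact: d2.
  + exact: d3.
  + exact: d4.
- by split.
- exact: (conn_dist_complete n_ge1 f_ge0 kf_ge0 f_lip f_eq0).
- exact: (conn_dist_dense n_ge1 kf_ge0 f_lip).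
- by move=> x y tx ty; rewrite topE.
Qed.
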